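(* Let $\beta\ge1$ and $\rho>0$, and set $$u=\frac12\left(1+\rho(\beta-1)+\sqrt{(1+\rho(\beta-1))^2+4\rho}\right),$$ $$r_{\mathrm{erg}}=\log u+\beta\log\left(1+\frac\rho u\right)-\left(1-u^{-1}\right),\qquad v_{\mathrm{erg}}=-\log\left(1-\frac{(1-u)^2}{\beta u^2}\right).$$ Then, as $r\to r_{\mathrm{erg}}$, $$\mathcal{E}_1(r)-\mathcal{E}_0=\frac{(r-r_{\mathrm{erg}})^2}{2v_{\mathrm{erg}}}+\frac{s_{\mathrm{erg}}}{6}(r-r_{\mathrm{erg}})^3+O\left((r-r_{\mathrm{erg}})^4\right),$$ where $s_{\mathrm{erg}}=\mathcal{E}_1'''(r_{\mathrm{erg}})$ is the third derivative of $\mathcal{E}_1$ with respect to $r$ at $r=r_{\mathrm{erg}}$.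
   Context: An integrable function $p:\mathbb{R}_+\to\mathbb{R}$ is called tame if $\int_0^\infty x|p(x)|\,dx<\infty$ and there is some $\varepsilon>0$ with $\int_0^\infty|p(x)|^{1+\varepsilon}dx<\infty$. Let $\Omega$ be the set of tame functions. For $\beta\ge1$ and $p\in\Omega$ the energy functional is $$\mathcal{E}[p]=\int_0^\infty x\,p(x)\,dx-(\beta-1)\int_0^\infty p(x)\log x\,dx-\int_0^\infty\!\!\int_0^\infty p(x)p(y)\log|x-y|\,dx\,dy .$$ $\mathcal{X}=\{p\in\Omega: p\ge0,\ \int_0^\infty p(x)\,dx=1\}$ and, for given $\rho>0$ and $r>0$, $\mathcal{X}_r=\{p\in\mathcal{X}:\int_0^\infty p(x)\log(1+\rho x)\,dx=r\}$. Set $\mathcal{E}_0=\inf_{q\in\mathcal{X}}\mathcal{E}[q]$ and $\mathcal{E}_1(r)=\inf_{q\in\mathcal{X}_r}\mathcal{E}[q]$. The parameters $\beta$ and $\rho$ are fixed and $r$ varies. Here $\log$ is the natural logarithm. *)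

(* Defs.v *)
From HB Require Import structures.
From mathcomp Require Import all_boot all_order all_algebra.
From mathcomp Require Import all_classical all_reals all_analysis.
Set Implicit Arguments.
Unset Strict Implicit.
Unset Printing Implicit Defensive.
Import Order.TTheory GRing.Theory Num.Theory.
Import numFieldNormedType.Exports.
Local Open Scope classical_set_scope.
Local Open Scope ring_scope.

Definition halfline (R : realType) : set R := [set x | 0 <= x].
Arguments halfline : clear implicits.

(* A function on the half-line is represented by a total function [R -> R];
   its values at negative arguments play no role. *)
Definition tame (R : realType) (p : R -> R) : Prop :=
  [/\ (@lebesgue_measure R).-integrable (halfline R) (EFin \o p),
      (\int[@lebesgue_measure R]_(x in halfline R) (x * `|p x|)%:E < +oo)%E
    & exists2 eps : R, 0 < eps &
      (\int[@lebesgue_measure R]_(x in halfline R)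
         (`|p x| `^ (1 + eps))%:E < +oo)%E].

(* [ln 0 = 0] in the library; this only affects null sets
   ([x = 0] and [x = y]) in the integrals below. *)
Definition energy (R : realType) (beta : R) (p : R -> R) : R :=
  \int[@lebesgue_measure R]_(x in halfline R) (x * p x)
  - (beta - 1) * \int[@lebesgue_measure R]_(x in halfline R) (p x * ln x)
  - \int[@lebesgue_measure R]_(y in halfline R)
      \int[@lebesgue_measure R]_(x in halfline R)
        (p x * p y * ln `|x - y|).

Definition tame_density (R : realType) : set (R -> R) :=
  [set p | [/\ tame p,
               (forall x, 0 <= x -> 0 <= p x)
             & \int[@lebesgue_measure R]_(x in halfline R) p x = 1]].
Arguments tame_density : clear implicits.

Definition tame_density_at (R : realType) (rho r : R) : set (R -> R) :=
  [set p | tame_density R p /\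
     \int[@lebesgue_measure R]_(x in halfline R) (p x * ln (1 + rho * x)) = r].

(* [inf] is the infimum of a nonempty set of reals that is bounded below, and
   [0] otherwise. The energy is bounded below on [tame_density R], since
   [ln `|x - y| <= ln (1 + x) + ln (1 + y)], and [tame_density_at rho r] is
   nonempty for [0 < rho] and [0 < r]. *)
Definition energy0 (R : realType) (beta : R) : R :=
  inf [set energy beta q | q in tame_density R].

Definition energy1 (R : realType) (beta rho r : R) : R :=
  inf [set energy beta q | q in tame_density_at rho r].

Definition u_erg (R : realType) (beta rho : R) : R :=
  2^-1 * (1 + rho * (beta - 1)
          + Num.sqrt ((1 + rho * (beta - 1)) ^+ 2 + 4 * rho)).

Definition r_erg (R : realType) (beta rho : R) : R :=
  let u := u_erg beta rho in
  ln u + beta * ln (1 + rho / u) - (1 - u^-1).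

Definition v_erg (R : realType) (beta rho : R) : R :=
  let u := u_erg beta rho in
  - ln (1 - (1 - u) ^+ 2 / (beta * u ^+ 2)).

Definition s_erg (R : realType) (beta rho : R) : R :=
  derive1n 3 (energy1 beta rho) (r_erg beta rho).

(* [derive1n] is total: it is meaningful at [x] only under derivability. *)
Definition thrice_derivable_at (R : realType) (f : R -> R) (x : R) : Prop :=
  [/\ (\forall y \near x, derivable f y 1),
      (\forall y \near x, derivable (derive1n 1 f) y 1)
    & derivable (derive1n 2 f) x 1].

(* Main.v *)
Require Import Defs.
From HB Require Import structures.
From mathcomp Require Import all_boot all_order all_algebra.
From mathcomp Require Import all_classical all_reals all_analysis.
From mathcomp Require Import measurable_realfun ring lra.
Set Implicit Arguments.
Unset Strict Implicit.
Unset Printing Implicit Defensive.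
Import Order.TTheory GRing.Theory Num.Theory.
Import numFieldNormedType.Exports.
Local Open Scope classical_set_scope.
Local Open Scope ring_scope.

(* Let [E_t] be the energy minus [t] times the integral of [p(x) log (1 + rho x)].
   For the parameters below its minimizer over tame densities is explicit: the
   density
     sqrt (2 P x - x^2 - delta^2) (kappa + rho x) / (2 pi x (1 + rho x)),
   where [P], [delta], [t] are functions of [kappa] and [kappa = 1] gives [t = 0].
   Substituting [x = P + 2 c cos theta] and expanding
   [log (1 - 2 z cos theta + z^2)] in a Fourier series gives its logarithmic
   potential at [P +- c (z + 1/z)], hence equality in the Euler-Lagrange condition
   on the support and, by the sign of a derivative in [z], inequality outside it.
   As the logarithmic energy is nonpositive on functions of integral 0, these
   conditions imply minimality.

   If the minimizers for [t] and [t'] have moments [r] and [r'], then minimality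
   of both gives
     t (r' - r) <= E_1(r') - E_1(r) <= t' (r' - r),
   so [E_1' (r) = t], viewed as a function of [r] through [kappa]. This function
   is smooth near [r_erg]; it vanishes there and its derivative there is
   [1 / v_erg], so Taylor's formula gives the expansion. *)

(** * Functions differentiable finitely often near a point *)

(** Why the parameter is kappa and not [t]: let a, b be the ends of the support, delta = sqrt (a b)
    and w = sqrt ((1 + rho a) (1 + rho b)). The density continues analytically with poles at 0 and -
    1 / rho, and its residues there must match those of the derivative of the external field: kappa
    delta = beta - 1 and rho t = (1 - kappa) w. Given kappa, these relations and total mass 1 leave
    a single quadratic equation, for w. All parameters are then explicit functions of kappa, smooth
    near 1, and only the scalar map from kappa to the moment has to be inverted. The obstacle on the
    support is that the kernel is singular: the Fourier series would be needed at |z| = 1, where its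
    error no longer decays geometrically. The potential is therefore computed at the complex points
    P + c (zeta + 1 / zeta) with |zeta| < 1, and |zeta| tends to 1 by dominated convergence. E_1 is
    an infimum of which no regularity is known beforehand. The two inequalities confine its
    difference quotients between values of one continuous function, and all further smoothness comes
    from the explicit formula for the slope. *)

Section smooth.
Variable R : realType.
Implicit Types (f g : R -> R) (x y : R).

(** The derivative is an existential witness on a neighbourhood, not an iterate of a total
    derivation operator, so that each closure rule is an induction exhibiting the formula for the
    derivative. *)
Fixpoint Ck (n : nat) f x : Prop :=
  if n is n'.+1 then
    exists2 df, (\forall y \near x, is_derive y (1 : R) f (df y)) & Ck n' df x
  else True.

Lemma is_derive_near_eq f g x d : {near x, f =1 g} ->
  is_derive x (1 : R) f d -> is_derive x (1 : R) g d.
Proof. by move=> fg; apply: near_eq_is_derive; rewrite ?oner_eq0. Qed.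

Lemma Ck_le m n f x : (m <= n)%N -> Ck n f x -> Ck m f x.
Proof.
elim: n m f => [|n IH] [|m] f //= mn [df fdf cdf].
by exists df => //; exact: IH cdf.
Qed.

Lemma CkS n f x : Ck n.+1 f x -> Ck n f x.
Proof. exact: Ck_le. Qed.

Lemma Ck_is_derive n f x : Ck n.+1 f x -> exists d, is_derive x (1 : R) f d.
Proof. by case=> df /nbhs_singleton fdf _; exists (df x). Qed.

Lemma Ck_continuous n f x : Ck n.+1 f x -> {for x, continuous f}.
Proof.
case/Ck_is_derive => d [dfx _].
exact/differentiable_continuous/derivable1_diffP.
Qed.

Lemma Ck_near_continuous n f x : Ck n.+1 f x -> {near x, continuous f}.
Proof.
case=> df fdf _; near=> y.
have [dfy _] : is_derive y (1 : R) f (df y) by near: y.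
exact/differentiable_continuous/derivable1_diffP.
Unshelve. all: by end_near. Qed.

Lemma Ck_cst n (a : R) x : Ck n (fun=> a) x.
Proof.
elim: n a => //= n IH a; exists (fun=> 0) => //.
by near=> y; exact: is_derive_cst.
Unshelve. all: by end_near. Qed.

Lemma Ck_id n x : Ck n (fun y => y) x.
Proof.
case: n => //= n; exists (fun=> 1); last exact: Ck_cst.
by near=> y; exact: is_derive_id.
Unshelve. all: by end_near. Qed.

Lemma CkD n f g x : Ck n f x -> Ck n g x -> Ck n (fun y => f y + g y) x.
Proof.
elim: n f g => //= n IH f g [df fdf cdf] [dg gdg cdg].
exists (fun y => df y + dg y); last exact: IH.
near=> y; apply: is_deriveD; [near: y; exact: fdf|near: y; exact: gdg].
Unshelve. all: by end_near. Qed.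

Lemma CkN n f x : Ck n f x -> Ck n (fun y => - f y) x.
Proof.
elim: n f => //= n IH f [df fdf cdf].
exists (fun y => - df y); last exact: IH.
near=> y; apply: is_deriveN; near: y; exact: fdf.
Unshelve. all: by end_near. Qed.

Lemma CkB n f g x : Ck n f x -> Ck n g x -> Ck n (fun y => f y - g y) x.
Proof. by move=> cf cg; apply: CkD => //; exact: CkN. Qed.

Lemma CkM n f g x : Ck n f x -> Ck n g x -> Ck n (fun y => f y * g y) x.
Proof.
elim: n f g => //= n IH f g cf cg.
have [df fdf cdf] := cf; have [dg gdg cdg] := cg.
exists (fun y => f y * dg y + g y * df y); last first.
  by apply: CkD; apply: IH => //; exact: CkS.
near=> y; apply: is_deriveM; [near: y; exact: fdf|near: y; exact: gdg].
Unshelve. all: by end_near. Qed.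

Lemma CkX n f k x : Ck n f x -> Ck n (fun y => f y ^+ k) x.
Proof.
move=> cf; elim: k => [|k IH]; first exact: Ck_cst.
have -> : (fun y => f y ^+ k.+1) = (fun y => f y * f y ^+ k).
  by apply/funext => y; rewrite exprS.
exact: CkM.
Qed.

Lemma Ck_comp n f g x : Ck n f x -> Ck n g (f x) -> Ck n (fun y => g (f y)) x.
Proof.
elim: n f g => //= n IH f g cf cg.
have [df fdf cdf] := cf; have [dg gdg cdg] := cg.
exists (fun y => dg (f y) * df y); last first.
  by apply: CkM => //; apply: IH => //; exact: CkS.
have cfx := @Ck_continuous n f x cf.
near=> y.
have h1 : is_derive y (1 : R) f (df y) by near: y.
have h2 : is_derive (f y) (1 : R) g (dg (f y)).
  by near: y; exact: (cfx _ gdg).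
exact: is_derive1_comp.
Unshelve. all: by end_near. Qed.

Lemma Ck_inv n x : x != 0 -> Ck n (fun y => y^-1) x.
Proof.
elim: n x => //= n IH x x0; exists (fun y => - (y^-1 * y^-1)); last first.
  by apply: CkN; apply: CkM; exact: IH.
near=> y.
have y0 : y != 0 by near: y; exact: (cvgr_neq0 x).
have dy : derivable (@id R) y 1 by exact: derivable_id.
apply: DeriveDef; first exact: (@derivableV _ _ (@id R)).
rewrite (@deriveV _ _ (@id R))// derive_id /GRing.scale/= mulr1.
by rewrite expr2 invfM.
Unshelve. all: by end_near. Qed.

Lemma CkV n f x : f x != 0 -> Ck n f x -> Ck n (fun y => (f y)^-1) x.
Proof. by move=> fx0 cf; apply: (Ck_comp cf); exact: Ck_inv. Qed.

Lemma Ck_div n f g x : g x != 0 -> Ck n f x -> Ck n g x ->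
  Ck n (fun y => f y / g y) x.
Proof. by move=> gx0 cf cg; apply: CkM => //; exact: CkV. Qed.

Lemma Ck_ln n f x : 0 < f x -> Ck n f x -> Ck n (fun y => ln (f y)) x.
Proof.
move=> fx0 cf; apply: (Ck_comp cf); case: n {cf} => //= n.
exists (fun y => y^-1); last by apply: Ck_inv; rewrite gt_eqF.
near=> y; apply: is_derive1_ln; near: y; exact: lt_nbhsr.
Unshelve. all: by end_near. Qed.

Lemma Ck_sqrt n f x : 0 < f x -> Ck n f x -> Ck n (fun y => Num.sqrt (f y)) x.
Proof.
move=> fx0 cf; apply: (Ck_comp cf); elim: n {cf} => //= n IH.
exists (fun y => (2 * Num.sqrt y)^-1).
  near=> y; apply: is_derive1_sqrt; near: y; exact: lt_nbhsr.
apply: CkV; first by rewrite mulf_neq0 ?pnatr_eq0// gt_eqF// sqrtr_gt0.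
by apply: CkM => //; exact: Ck_cst.
Unshelve. all: by end_near. Qed.

(** Two points with equal values would, by the mean value theorem, enclose a zero of the
    derivative. *)
Lemma near_derive_inj f df x : (\forall y \near x, is_derive y (1 : R) f (df y)) ->
  {for x, continuous df} -> df x != 0 ->
  exists2 e, 0 < e &
    forall a b, x - e < a < x + e -> x - e < b < x + e -> f a = f b -> a = b.
Proof.
move=> fdf cdf df0.
have : \forall y \near x, is_derive y (1 : R) f (df y) /\ df y != 0.
  by near=> y; split; near: y => //; exact: (cvgr_neq0 (df x)).
move=> /nbhs_ballP[e /= e0 he]; exists e => // a b.
wlog ab : a b / a <= b.
  move=> H ai bi fab; have [ab|/ltW ba] := leP a b; first exact: H.
  by apply/esym/H.
move=> ai bi fab; have D c : c \in `[a, b] -> is_derive c (1:R) f (df c) /\ df c != 0.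
  move=> cab; apply: he; rewrite /ball/=; move: ai bi cab; rewrite in_itv/=.
  by move=> /andP[? ?] /andP[? ?] /andP[? ?]; rewrite ltr_distlC; lra.
apply/eqP; rewrite eq_le ab/= leNgt; apply/negP => ltab.
have [|c cab] := @MVT R f df a b ltab (fun c cab => (D c (subset_itv_oo_cc cab)).1).
  apply: derivable_within_continuous => c cab.
  by have [[]] := D c cab.
rewrite fab subrr => /esym/eqP; rewrite mulf_eq0 subr_eq0 => /orP[|/eqP ba].
  by have [_ /negPf ->] := D c (subset_itv_oo_cc cab).
by move: ltab; rewrite ba ltxx.
Unshelve. all: by end_near. Qed.

(** The inverse is chosen pointwise among preimages in the interval of injectivity, with default
    [x]. Its continuity and smoothness are derived afterwards from cancellation. *)
Lemma local_inverse f df x : (\forall y \near x, is_derive y (1 : R) f (df y)) ->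
  {for x, continuous df} -> df x != 0 -> exists g, {near x, cancel f g}.
Proof.
move=> fdf cdf df0; have [e e0 inj] := near_derive_inj fdf cdf df0.
exists (fun z => xget x [set y | x - e < y < x + e /\ f y = z]).
near=> y; have ye : x - e < y < x + e.
  by rewrite -ltr_distlC; near: y; exact: nbhsx_ballx.
rewrite /= ; case: xgetP => [z _ [ze fzy]|/(_ y)]; last by case.
exact: inj.
Unshelve. all: by end_near. Qed.

(** Bootstrap on g' = 1 / f' (g): if [g] is [m] times differentiable, so is the right-hand side, as
    long as [m] does not exceed the order of f'. An order of at least 2 makes f' continuous, hence
    nonzero near [x]. *)
Lemma Ck_inverse n f g x d : {near x, cancel f g} -> Ck n.+2 f x ->
  is_derive x (1 : R) f d -> d != 0 -> Ck n.+2 g (f x).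
Proof.
move=> fK cf fd d0.
have fct := Ck_near_continuous cf.
have [gct gK] := near_can_continuousAcan_sym fK fct.
have [df fdf cdf] := cf.
have dfx : df x = d.
  by have [_ <-] := nbhs_singleton fdf; case: fd => _ <-.
have gfx : g (f x) = x by exact: nbhs_singleton fK.
have gcx : {for f x, continuous g} by exact: nbhs_singleton gct.
have gnbhs (P : set R) : (\forall y \near x, P y) -> \forall z \near f x, P (g z).
  by move=> Px; apply: gcx; rewrite gfx.
have dfc : {for x, continuous df} by exact: Ck_continuous cdf.
have gdg : \forall z \near f x, is_derive z (1 : R) g (df (g z))^-1.
  have h1 := gnbhs _ (near_join fK); have h2 := gnbhs _ (near_join fct).
  have h3 := gnbhs _ fdf.
  have h4 : \forall z \near f x, df (g z) != 0.
    have h : \forall y \near x, df y != 0.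
      by apply: (cvgr_neq0 (df x) dfc); rewrite dfx.
    exact: gnbhs h.
  near=> z; have {1}<- : f (g z) = z by near: z.
  by apply: is_derive_inverse; near: z.
have : (n.+2 <= n.+2)%N by [].
elim: {-2}n.+2 => // m IH mn; exists (fun z => (df (g z))^-1) => //.
apply: CkV; first by rewrite gfx dfx.
apply: Ck_comp; first by apply: IH; exact: ltnW.
by rewrite gfx; exact: (@Ck_le _ n.+1).
Unshelve. all: by end_near. Qed.

(** Mean value theorem between [x] and [y]. The gain of a factor 1 / (k + 1) is given up, since only
    the order of the remainder matters. *)
Lemma derive_bound_step k f df x M :
  (\forall y \near x, is_derive y (1 : R) f (df y)) -> f x = 0 -> 0 <= M ->
  (\forall y \near x, `|df y| <= M * `|y - x| ^+ k) ->
  \forall y \near x, `|f y| <= M * `|y - x| ^+ k.+1.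
Proof.
move=> fdf fx0 M0 dfM.
have : \forall y \near x, is_derive y (1 : R) f (df y) /\ `|df y| <= M * `|y - x| ^+ k.
  by near=> y; split; near: y.
move=> /nbhs_ballP[e /= e0 he].
apply/nbhs_ballP; exists e => //= y; rewrite /ball/= => yx.
have D c : `|c - x| <= `|y - x| -> is_derive c (1 : R) f (df c) /\ `|df c| <= M * `|c - x| ^+ k.
  by move=> cx; apply: he; rewrite /ball/= distrC (le_lt_trans cx)// distrC.
suff [c [cx E]] : exists c, `|c - x| <= `|y - x| /\ `|f y| = `|df c| * `|y - x|.
  rewrite E exprSr mulrA ler_wpM2r//; have [_ /le_trans] := D c cx; apply.
  by rewrite ler_wpM2l// lerXn2r// nnegrE.
have cont (i : interval R) : (forall c, c \in i -> `|c - x| <= `|y - x|) ->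
    {within [set` i], continuous f}.
  by move=> H; apply: derivable_within_continuous => c /H /D[[]].
have [xy|yx'] := leP x y.
  have H c : c \in `[x, y] -> `|c - x| <= `|y - x|.
    by rewrite in_itv/= => /andP[? ?]; rewrite !ger0_norm ?subr_ge0// lerD2r.
  have [c cab E] := MVT_segment xy (fun c cab => (D c (H c (subset_itv_oo_cc cab))).1) (cont _ H).
  by exists c; split; [exact: H|rewrite -normrM -E fx0 subr0].
have H c : c \in `[y, x] -> `|c - x| <= `|y - x|.
  rewrite in_itv/= => /andP[? ?]; rewrite distrC (distrC y) !ger0_norm ?subr_ge0//; last exact: ltW.
  by rewrite lerD2l lerN2.
have [c cab E] := MVT_segment (ltW yx') (fun c cab => (D c (H c (subset_itv_oo_cc cab))).1) (cont _ H).
by exists c; split; [exact: H|rewrite distrC -normrM -E fx0 sub0r normrN].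
Unshelve. all: by end_near. Qed.

Lemma is_derive_near_bound f x d : is_derive x (1 : R) f d ->
  exists2 M, 0 <= M & \forall y \near x, `|f y - f x| <= M * `|y - x|.
Proof.
move=> fd; have [cfd dfE] := fd.
exists (`|d| + 1); first by rewrite addr_ge0.
have := fd => /is_derive1_caratheodory[h [fE hC hxE]].
have : \forall y \near x, `|h y| < `|d| + 1.
  by apply: (cvgr_norm_lt (h x) hC); rewrite hxE ltrDl.
by apply: filterS => y hy; rewrite fE normrM ler_wpM2r// ltW.
Qed.

(** A derivative of [f3] at the single point [x] gives the linear bound on [f3 y - f3 x]; three
    applications of [derive_bound_step] raise it to order 4. *)
Lemma taylor3 f f1 f2 f3 x d : (\forall y \near x, is_derive y (1 : R) f (f1 y)) ->
  (\forall y \near x, is_derive y (1 : R) f1 (f2 y)) ->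
  (\forall y \near x, is_derive y (1 : R) f2 (f3 y)) ->
  is_derive x (1 : R) f3 d ->
  exists2 M, 0 <= M & \forall y \near x,
    `|f y - (f x + f1 x * (y - x) + f2 x / 2 * (y - x) ^+ 2
             + f3 x / 6 * (y - x) ^+ 3)| <= M * `|y - x| ^+ 4.
Proof.
move=> ff1 ff2 ff3 /is_derive_near_bound[M M0 f3M]; exists M => //.
have dB y (g : R -> R) a (b : R) : is_derive y (1 : R) g a ->
    is_derive y (1 : R) (fun z => g z - b) a.
  by move=> h; rewrite -[a]subr0; apply: is_deriveB.
have dX y (g : R -> R) a (b : R) n : is_derive y (1 : R) g a ->
    is_derive y (1 : R) (fun z => g z - b * (z - x) ^+ n.+1) (a - b * (n.+1%:R * (y - x) ^+ n)).
  move=> h; apply: is_deriveB.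
  have hz : is_derive y (1 : R) (fun z => z - x) 1 by apply: dB; exact: is_derive_id.
  have -> : b * (n.+1%:R * (y - x) ^+ n) = b *: ((n.+1%:R * (y - x) ^+ n) *: 1).
    by rewrite /GRing.scale/= mulr1.
  have -> : (fun z => b * (z - x) ^+ n.+1) = b *: ((fun z => z - x) ^+ n.+1).
    by apply/funext => z; rewrite exprfctE.
  by apply: is_deriveZ; exact: is_deriveX.
(* Taylor remainders of [f2], [f1] and [f]: each is the derivative of the next, and all vanish at
   [x]. *)
pose r2 y := f2 y - f2 x - f3 x * (y - x) ^+ 1.
pose r1 y := f1 y - f1 x - f2 x * (y - x) ^+ 1 - f3 x / 2 * (y - x) ^+ 2.
pose r0 y := f y - f x - f1 x * (y - x) ^+ 1 - f2 x / 2 * (y - x) ^+ 2 - f3 x / 6 * (y - x) ^+ 3.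
have r23 : \forall y \near x, is_derive y (1 : R) r2 (f3 y - f3 x).
  near=> y; have h : is_derive y (1 : R) f2 (f3 y) by near: y.
  have D := dX _ _ _ (f3 x) 0%N (dB _ _ _ (f2 x) h).
  apply: (is_derive_eq D).
  by rewrite expr0 !mulr1.
have r12 : \forall y \near x, is_derive y (1 : R) r1 (r2 y).
  near=> y; have h : is_derive y (1 : R) f1 (f2 y) by near: y.
  have D := dX _ _ _ (f3 x / 2) 1%N (dX _ _ _ (f2 x) 0%N (dB _ _ _ (f1 x) h)).
  apply: (is_derive_eq D).
  by rewrite /r2; field.
have r01 : \forall y \near x, is_derive y (1 : R) r0 (r1 y).
  near=> y; have h : is_derive y (1 : R) f (f1 y) by near: y.
  have D := dX _ _ _ (f3 x / 6) 2%N (dX _ _ _ (f2 x / 2) 1%N (dX _ _ _ (f1 x) 0%N (dB _ _ _ (f x) h))).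
  apply: (is_derive_eq D).
  by rewrite /r1; field.
have b3 : \forall y \near x, `|f3 y - f3 x| <= M * `|y - x| ^+ 1 by [].
have b2 := derive_bound_step r23 _ M0 b3.
have b1 := derive_bound_step r12 _ M0 (b2 _).
have b0 := derive_bound_step r01 _ M0 (b1 _ _).
have z1 : r2 x = 0 by rewrite /r2 !subrr expr1 mulr0 subr0.
have z2 : r1 x = 0 by rewrite /r1 !subrr expr1 expr0n !mulr0 !subr0.
have z3 : r0 x = 0 by rewrite /r0 !subrr expr1 !expr0n !mulr0 !subr0.
apply: filterS (b0 z3 z2 z1) => y.
by rewrite /r0 expr1 -!addrA -!opprD !addrA.
Unshelve. all: by end_near. Qed.

(** Each iterate of [derive1n] is identified with its witness on a whole neighbourhood before it is
    differentiated again, since a pointwise equality would not pass to derivatives. *)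
Lemma derive1n_near f f1 f2 f3 x :
  (\forall y \near x, is_derive y (1 : R) f (f1 y)) ->
  (\forall y \near x, is_derive y (1 : R) f1 (f2 y)) ->
  (\forall y \near x, is_derive y (1 : R) f2 (f3 y)) ->
  [/\ \forall y \near x, derivable f y 1,
      \forall y \near x, derivable (derive1n 1 f) y 1,
      derivable (derive1n 2 f) x 1
    & derive1n 3 f x = f3 x].
Proof.
move=> ff1 ff2 ff3.
have e1 : \forall y \near x, derive1n 1 f y = f1 y.
  by apply: filterS ff1 => y [_ <-]; rewrite derive1n1 derive1E.
have d2 : \forall y \near x, is_derive y (1 : R) (derive1n 1 f) (f2 y).
  have e1j := near_join e1; near=> y; apply: (@is_derive_near_eq f1); last by near: y.
  have : \near y, derive1n 1 f y = f1 y by near: y.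
  by apply: filterS => z ->.
have e2 : \forall y \near x, derive1n 2 f y = f2 y.
  by apply: filterS d2 => y [_ <-]; rewrite derive1nS derive1E.
have d3 : is_derive x (1 : R) (derive1n 2 f) (f3 x).
  apply: (@is_derive_near_eq f2); last exact: nbhs_singleton ff3.
  by apply: filterS e2 => z ->.
split.
- by near=> y; have [] : is_derive y (1 : R) f (f1 y) by near: y.
- by near=> y; have [] : is_derive y (1 : R) (derive1n 1 f) (f2 y) by near: y.
- by case: d3.
- by case: d3 => _ <-; rewrite derive1nS derive1E.
Unshelve. all: by end_near. Qed.
End smooth.

(** * Rules for derivatives at a point *)

Section pointwise_derivatives.
Variable R : realType.
Implicit Types (f g : R -> R) (x a b : R).

Lemma dvC (k : R) x : is_derive x (1 : R) (fun=> k) 0.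
Proof. exact: is_derive_cst. Qed.

Lemma dvI x : is_derive x (1 : R) (fun y => y) 1.
Proof. exact: is_derive_id. Qed.

Lemma dvD f g x a b : is_derive x (1 : R) f a -> is_derive x (1 : R) g b ->
  is_derive x (1 : R) (fun y => f y + g y) (a + b).
Proof. by move=> fa gb; apply: is_deriveD. Qed.

Lemma dvB f g x a b : is_derive x (1 : R) f a -> is_derive x (1 : R) g b ->
  is_derive x (1 : R) (fun y => f y - g y) (a - b).
Proof. by move=> fa gb; apply: is_deriveB. Qed.

Lemma dvM f g x a b : is_derive x (1 : R) f a -> is_derive x (1 : R) g b ->
  is_derive x (1 : R) (fun y => f y * g y) (f x * b + g x * a).
Proof. by move=> fa gb; apply: is_deriveM. Qed.

Lemma dvZ f x a (k : R) : is_derive x (1 : R) f a ->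
  is_derive x (1 : R) (fun y => k * f y) (k * a).
Proof. by move=> fa; apply: is_deriveZ. Qed.

Lemma dvX f x a n : is_derive x (1 : R) f a ->
  is_derive x (1 : R) (fun y => f y ^+ n) (n%:R * f x ^+ n.-1 * a).
Proof.
move=> fa; have -> : (fun y => f y ^+ n) = f ^+ n.
  by apply/funext => y; rewrite exprfctE.
exact: is_deriveX.
Qed.

Lemma dvV f x a : f x != 0 -> is_derive x (1 : R) f a ->
  is_derive x (1 : R) (fun y => (f y)^-1) (- a / f x ^+ 2).
Proof.
move=> fx0 [df <-]; apply: DeriveDef; first exact: derivableV.
by rewrite deriveV// /GRing.scale/= mulNr mulrC mulNr.
Qed.

Lemma dvcomp f g x a b : is_derive (g x) (1 : R) f a -> is_derive x (1 : R) g b ->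
  is_derive x (1 : R) (fun y => f (g y)) (a * b).
Proof. by move=> fa gb; exact: is_derive1_comp. Qed.

Lemma dvln f x a : 0 < f x -> is_derive x (1 : R) f a ->
  is_derive x (1 : R) (fun y => ln (f y)) (a / f x).
Proof.
by move=> fx0 fa; rewrite mulrC; apply: (dvcomp _ fa); exact: is_derive1_ln.
Qed.

Lemma dv_eq f x a b : is_derive x (1 : R) f a -> a = b -> is_derive x (1 : R) f b.
Proof. by move=> fa <-. Qed.

Lemma dv_continuous f x a : is_derive x (1 : R) f a -> {for x, continuous f}.
Proof. by case=> d _; exact/differentiable_continuous/derivable1_diffP. Qed.

Lemma dv_bound f df a b (M : R) :
  (forall x, Num.min a b <= x <= Num.max a b -> is_derive x (1 : R) f (df x) /\ `|df x| <= M) ->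
  `|f b - f a| <= M * `|b - a|.
Proof.
wlog ab : a b / a <= b => [H D|].
  have [ab|/ltW ba] := leP a b; first exact: H.
  by rewrite distrC (distrC b); apply: H => // x; rewrite minC maxC; exact: D.
rewrite min_l// max_r// => D.
have D1 x : x \in `]a, b[ -> is_derive x (1 : R) f (df x).
  by rewrite in_itv/= => /andP[? ?]; apply: (D x _).1; rewrite !ltW.
have cf : {within `[a, b], continuous f}.
  by apply: derivable_within_continuous => x; rewrite in_itv/= => /D[[]].
have [c cab ->] := MVT_segment ab D1 cf.
by rewrite normrM ler_wpM2r//; exact: (D c cab).2.
Qed.
End pointwise_derivatives.

(** * Integrals over the plane *)

Section plane.
Variable R : realType.
Notation mu := (@lebesgue_measure R).

(* A named copy of the planar measure: on [\x] itself, inference finds the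
   sigma-finiteness instance meant for subprobabilities only. *)
Definition plane_measure : set (measurableTypeR R * measurableTypeR R) -> \bar R :=
  (mu \x mu)%E.

HB.instance Definition _ := isMeasure.Build _ _ _ plane_measure
  (measure0 (mu \x mu)%E) (measure_ge0 (mu \x mu)%E)
  (@measure_semi_sigma_additive _ _ _ (mu \x mu)%E).

Let plane_measure_sigma_finite : sigma_finite setT plane_measure.
Proof.
have /sigma_finiteP[F [TF ndF Foo]] := sigma_finiteT mu.
(* Squares of one increasing exhaustion: nestedness places both coordinates of a point in a common
   [F n]. *)
exists (fun n => F n `*` F n) => [|k].
  apply/esym; rewrite -subTset => -[x y] _.
  have [n _ Fx] : (\bigcup_n F n) x by rewrite -TF.
  have [m _ Fy] : (\bigcup_n F n) y by rewrite -TF.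
  exists (maxn n m) => //; split => /=.
    by move: x Fx; exact/subsetPset/ndF/leq_maxl.
  by move: y Fy; exact/subsetPset/ndF/leq_maxr.
have [mF Fk] := Foo k; split; first exact: measurableX.
by rewrite /plane_measure product_measure1E// lte_mul_pinfty// ge0_fin_numE.
Qed.

HB.instance Definition _ :=
  Measure_isSigmaFinite.Build _ _ _ plane_measure plane_measure_sigma_finite.

End plane.

(** * Product functions on the plane and elementary integrals *)

Section prod.
Variable R : realType.

Lemma measurable_inv : measurable_fun setT (@GRing.inv R).
Proof.
(* Real powers are known to be measurable. At 0 both sides are 0, because inversion is total. *)
have -> : @GRing.inv R = fun x => x * ((x ^+ 2) `^ (-1)).
  apply/funext => x; have [->|x0] := eqVneq x 0; first by rewrite invr0 mul0r.
  by rewrite powR_inv1 ?sqr_ge0// expr2 invfM mulVKf.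
apply: measurable_funM => //.
by apply: (measurableT_comp (measurable_powR _)); exact: measurable_funX.
Qed.

Lemma measurable_funV d (T : measurableType d) (D : set T) (f : T -> R) :
  measurable_fun D f -> measurable_fun D (fun x => (f x)^-1).
Proof. by move=> mf; apply: (measurableT_comp measurable_inv). Qed.

Notation mu := (@lebesgue_measure R).
Implicit Types f g p q : R -> R.
Local Open Scope ereal_scope.

Lemma measurable_fst2 f : measurable_fun setT f ->
  measurable_fun [set: R * R] (fun z : R * R => f z.1).
Proof. by move=> mf; apply: measurableT_comp. Qed.

Lemma measurable_snd2 f : measurable_fun setT f ->
  measurable_fun [set: R * R] (fun z : R * R => f z.2).
Proof. by move=> mf; apply: measurableT_comp. Qed.

Lemma integrable_prod f g : mu.-integrable setT (EFin \o f) ->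
  mu.-integrable setT (EFin \o g) ->
  (mu \x mu)%E.-integrable setT (fun z => (f z.1 * g z.2)%:E).
Proof.
move=> fi gi.
have mf : measurable_fun setT f by have /measurable_EFinP := measurable_int _ fi.
have mg : measurable_fun setT g by have /measurable_EFinP := measurable_int _ gi.
have mfg : measurable_fun setT (fun z : R * R => (f z.1 * g z.2)%:E).
  by apply/measurable_EFinP/measurable_funM; [exact: measurable_fst2|exact: measurable_snd2].
apply/integrable12ltyP => //.
under eq_integral => x _.
  under eq_integral do rewrite /= normrM EFinM.
  rewrite ge0_integralZl//; first over.
  by do 2 apply: measurableT_comp => //.
rewrite /= ge0_integralZr//.
- case/integrableP: fi => _ fi; case/integrableP : gi => _ gi.
  by rewrite lte_mul_pinfty// ?ge0_fin_numE//; exact: integral_ge0.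
- by do 2 apply: measurableT_comp => //.
- exact: integral_ge0.
Qed.

Lemma Rintegral_prod f g : mu.-integrable setT (EFin \o f) ->
  mu.-integrable setT (EFin \o g) ->
  \int[(mu \x mu)%E]_z (f z.1 * g z.2)%:E = ((\int[mu]_x f x) * (\int[mu]_y g y))%:E.
Proof.
move=> fi gi; rewrite -integral12_prod_meas1 /=; last exact: integrable_prod.
rewrite /fubini_F.
under eq_integral => x _.
  under eq_integral do rewrite /= EFinM.
  rewrite integralZl//; over.
rewrite /= EFinM /Rintegral fineK; last exact: integrable_fin_num.
have := integrable_fin_num measurableT gi.
case E : (\int[mu]_y (EFin \o g) y) => [r| |]// _; by rewrite /= integralZr.
Qed.

Lemma integral_FTC (F f : R -> R) (a b : R) : (a <= b)%R ->
  (forall x, (a <= x <= b)%R -> is_derive x (1 : R)%R F (f x)) ->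
  {within `[a, b], continuous f} ->
  \int[mu]_(x in `[a, b]) (f x)%:E = (F b - F a)%:E.
Proof.
rewrite le_eqVlt => /predU1P[<- _ _|ab dF cf].
  by rewrite set_itv1 integral_set1 subrr.
have cF x : (a <= x <= b)%R -> {for x, continuous F}.
  by move=> /dF[d _]; exact/differentiable_continuous/derivable1_diffP.
rewrite (@continuous_FTC2 _ f F)//.
- split.
  + by move=> x; rewrite in_itv/= => /andP[? ?]; have [] := dF x; rewrite ?ltW//= !ltW.
  + by apply: cvg_at_right_filter; apply: cF; rewrite lexx ltW.
  + by apply: cvg_at_left_filter; apply: cF; rewrite lexx ltW.
- move=> x; rewrite in_itv/= => /andP[? ?]; have [|_ <-] := dF x; first by rewrite !ltW.
  by rewrite derive1E.
Qed.

Lemma integral_inv_cst (a b e : R) : (0 < a)%R -> (a <= b)%R ->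
  \int[mu]_(x in `]a, b]) (x^-1 - e)%:E = (ln b - ln a - e * (b - a))%:E.
Proof.
move=> a0 ab.
have D (x : R) : (a <= x <= b)%R -> is_derive x (1 : R)%R (fun x => ln x - e * x)%R (x^-1 - e)%R.
  move=> /andP[ax _]; have x0 : (0 < x)%R by rewrite (lt_le_trans a0).
  apply: is_deriveB; first exact: is_derive1_ln.
  by rewrite -[X in is_derive _ _ _ X]mulr1; apply: is_deriveZ.
have C : {within `[a, b], continuous (fun x => x^-1 - e)%R}.
  apply: continuous_in_subspaceT => x; rewrite inE/= in_itv/= => /andP[ax _].
  by apply: cvgB; [apply: cvgV => //; rewrite gt_eqF// (lt_le_trans a0)|exact: cvg_cst].
rewrite integral_itv_obnd_cbnd; last first.
  apply/measurable_EFinP/measurable_funB => //.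
  by apply: measurable_funV.
rewrite (@integral_FTC (fun x => ln x - e * x)%R)//; congr EFin; ring.
Qed.
Lemma integrable_plane f g : mu.-integrable setT (EFin \o f) ->
  mu.-integrable setT (EFin \o g) ->
  (@plane_measure R).-integrable setT (fun z => (f z.1 * g z.2)%:E).
Proof. by move=> fi gi; have := integrable_prod fi gi. Qed.

Lemma integral_plane f g : mu.-integrable setT (EFin \o f) ->
  mu.-integrable setT (EFin \o g) ->
  \int[@plane_measure R]_z (f z.1 * g z.2)%:E = ((\int[mu]_x f x) * (\int[mu]_y g y))%:E.
Proof. by move=> fi gi; have := Rintegral_prod fi gi. Qed.
End prod.

(** * Negativity of the logarithmic energy *)

Section logk.
Variable R : realType.
Notation mu := (@lebesgue_measure R).

(* [- ln d] is the integral of [logk s d] over [s]; for fixed [s] the kernel is, up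
   to a constant, [max (s^-1 - |x - y|) 0], the autocorrelation of the indicator
   function of an interval. *)
Definition logk (s d : R) : R :=
  if 0 < s then (Num.max (1 - s * d) 0 - Num.max (1 - s) 0) / s else 0.

(** The shape of [logk s d] in [s]: for [d <= 1] it is [1 - d] up to 1, then [s^-1 - d] up to
    [d^-1]; for [d >= 1] its opposite is [d - 1] up to [d^-1], then [s^-1 - 1] up to 1. *)
Lemma integral_two_pieces (f : R -> R) (a b m c e : R) : 0 <= a -> a <= b -> b <= m -> 0 <= c ->
  0 < b ->
  (forall s, b < s <= m -> 0 <= s^-1 - e) ->
  (forall s, f s = if a < s <= b then c else if b < s <= m then s^-1 - e else 0) ->
  (\int[mu]_s (f s)%:E = (c * (b - a) + (ln m - ln b - e * (m - b)))%:E)%E.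
Proof.
move=> a0 ab bm c0 b0 f0 fE.
pose f1 := (fun=> c%:E) \_ `]a, b] : R -> \bar R.
pose f2 := (fun s : R => (s^-1 - e)%:E) \_ `]b, m] : R -> \bar R.
transitivity (\int[mu]_s (f1 s + f2 s))%E.
  apply: eq_integral.
  move=> s _; rewrite /f1 /f2 !patchE !mem_setE !in_itv/=; rewrite fE.
  have [/andP[as_ sb]|_] := boolP (a < s <= b); last by case: ifP; rewrite add0e.
  by rewrite ltNge sb/= adde0.
have mf2 : measurable_fun `]b, m] (fun s : R => (s^-1 - e)%:E).
  by apply/measurable_EFinP/measurable_funB => //; exact: measurable_funV.
rewrite ge0_integralD//; first 1 last.
- by move=> s _; rewrite /f1 patchE; case: ifP.
- by apply/(measurable_restrictT _ _).1 => //.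
- move=> s _; rewrite /f2 patchE; case: ifPn => //; rewrite mem_setE in_itv/= => h.
  by rewrite lee_fin f0.
- by apply/(measurable_restrictT _ _).1 => //.
rewrite -!integral_mkcond integral_cst//= lebesgue_measure_itv/= lte_fin.
rewrite integral_inv_cst//.
case: ltP => [_|ba]; first by rewrite -EFinB -EFinM -EFinD.
have -> : a = b by apply/eqP; rewrite eq_le ab ba.
by rewrite mule0 add0e subrr mulr0 add0r.
Qed.

Lemma logk_le1 (d : R) : 0 < d -> d <= 1 ->
  (forall s, 0 <= logk s d) /\ (\int[mu]_s (logk s d)%:E = (- ln d)%:E)%E.
Proof.
move=> d0 d1; split.
  move=> s; rewrite /logk; case: ifP => // s0; apply: divr_ge0; last exact: ltW.
  by rewrite subr_ge0 ge_max !le_max lexx orbT andbT lerD2l lerN2 ger_pMr ?d1.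
have d1' : 1 <= d^-1 by rewrite -[leLHS]invr1 lef_pV2 ?posrE.
rewrite (@integral_two_pieces _ 0 1 d^-1 (1 - d) d)//.
- by rewrite ln1 lnV ?posrE//; congr EFin; field; lra.
- lra.
- by move=> s /andP[s1 sd]; rewrite subr_ge0 -[leLHS]invrK lef_pV2 ?posrE ?invr_gt0//; lra.
move=> s; rewrite /logk; case: ltP => //= s0; last first.
  by case: ifP => // /andP[]; lra.
have sn0 : s != 0 by lra.
have sd : (s <= d^-1) = (s * d <= 1) by rewrite -ler_pdivlMr// div1r.
have [s1|s1] := leP s 1.
  have sd1 : s * d <= 1 by rewrite mulr_ile1// ltW.
  by rewrite !max_l; [field|lra|lra].
rewrite /= sd; case: leP => sd1.
  by rewrite max_l ?max_r; [field| lra|lra].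
by rewrite !max_r; [rewrite subrr mul0r|lra|lra].
Qed.

Lemma logk_ge1 (d : R) : 1 <= d ->
  (forall s, logk s d <= 0) /\ (\int[mu]_s (- logk s d)%:E = (ln d)%:E)%E.
Proof.
move=> d1; have d0 : 0 < d by lra.
split.
  move=> s; rewrite /logk; case: ifP => // s0; rewrite pmulr_lle0 ?invr_gt0// subr_le0.
  by rewrite ge_max !le_max lexx orbT andbT lerD2l lerN2 ler_peMr ?d1// ltW.
have d1' : d^-1 <= 1 by rewrite -[leRHS]invr1 lef_pV2 ?posrE.
have di0 : 0 < d^-1 by rewrite invr_gt0.
rewrite (@integral_two_pieces _ 0 d^-1 1 (d - 1) 1)//.
- by rewrite ln1 lnV ?posrE//; congr EFin; field; lra.
- lra.
- lra.
- by move=> s /andP[s1 sd]; rewrite subr_ge0 -[leLHS]invr1 lef_pV2 ?posrE//; lra.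
move=> s; rewrite /logk; case: ltP => //= s0; last first.
  by rewrite oppr0; case: ifP => // /andP[]; lra.
have sn0 : s != 0 by lra.
have sd : (s <= d^-1) = (s * d <= 1) by rewrite -ler_pdivlMr// div1r.
have sd' : (d^-1 < s) = (1 < s * d) by rewrite ltNge sd -ltNge.
rewrite sd sd'; case: (leP (s * d)) => sd1.
  have s1 : s <= 1 by rewrite (le_trans _ sd1)// ler_peMr// ltW.
  by rewrite !max_l; [field|lra|lra].
rewrite /=; case: leP => s1.
  by rewrite max_r ?max_l; [field|lra|lra].
by rewrite !max_r; [rewrite subrr mul0r oppr0|lra|lra].
Qed.

Lemma measurable_logk d (T : measurableType d) (f g : T -> R) :
  measurable_fun setT f -> measurable_fun setT g ->
  measurable_fun setT (fun x => logk (f x) (g x)).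
Proof.
move=> mf mg; rewrite /logk; apply: measurable_fun_ifT => //.
  exact: measurable_fun_ltr.
apply: measurable_funM; last exact: measurable_funV.
by apply: measurable_funB; apply: measurable_maxr => //; apply: measurable_funB => //;
  apply: measurable_funM.
Qed.

Definition between (l x z : R) : R := ((x < z) && (z < x + l))%:R.

Lemma measurable_between d (T : measurableType d) (l : R) (f g : T -> R) :
  measurable_fun setT f -> measurable_fun setT g ->
  measurable_fun setT (fun x => between l (f x) (g x)).
Proof.
move=> mf mg; rewrite /between.
have -> : (fun x => ((f x < g x) && (g x < f x + l))%:R) =
    fun x => if (f x < g x) && (g x < f x + l) then 1 else 0 :> R.
  by apply/funext => x; case: ifP.
apply: measurable_fun_ifT => //; apply: measurable_and; apply: measurable_fun_ltr => //.
exact: measurable_funD.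
Qed.

Lemma integral_between (l x y : R) : 0 < l ->
  (\int[mu]_z (between l x z * between l y z)%:E = (Num.max (l - `|x - y|) 0)%:E)%E.
Proof.
move=> l0; pose i := `]Num.max x y, Num.min x y + l[.
transitivity (\int[mu]_z (\1_[set` i] z)%:E)%E.
  apply: eq_integral => z _; rewrite indicE mem_setE in_itv/= /between -natrM mulnb.
  congr (_%:R%:E); congr nat_of_bool; have E : (z < Num.min x y + l) = (z < x + l) && (z < y + l).
    by rewrite -ltrBlDr lt_min !ltrBlDr.
  by rewrite gt_max E andbACA.
rewrite integral_indic// setIT -[LHS]/(lebesgue_measure [set` i]).
rewrite lebesgue_measure_itv/= lte_fin.
have -> : Num.max x y = Num.min x y + `|x - y|.
  have [xy|/ltW xy] := leP x y; first by rewrite distrC ger0_norm ?subr_ge0// subrKC.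
  by rewrite ger0_norm ?subr_ge0// subrKC.
rewrite ltrD2l; case: ltP => h; last by rewrite max_r// subr_le0.
rewrite max_l ?subr_ge0; last by rewrite ltW.
by rewrite -EFinB; congr EFin; ring.
Qed.

Lemma le1_between l x z : 0 <= between l x z <= 1.
Proof. by rewrite /between; case: ((x < z) && _); rewrite ?lexx ?ler01. Qed.

Variable f : R -> R.
Hypothesis fi : mu.-integrable setT (EFin \o f).

Let mf : measurable_fun setT f.
Proof. by have /measurable_EFinP := measurable_int _ fi. Qed.

Lemma integrable_between l z : mu.-integrable setT (EFin \o (fun x => f x * between l x z)).
Proof.
apply: le_integrable fi => //.
  by apply/measurable_EFinP/measurable_funM => //; exact: measurable_between.
move=> x _; rewrite /= lee_fin normrM ler_piMr// ger0_norm; by case/andP: (le1_between l x z).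
Qed.

Local Notation mu2 := (@plane_measure R).

(** By [integral_between] the kernel is an integral over [z] of a product of one function of (x, z)
    and the same function of (y, z). After Fubini the quadratic form is an integral of squares. *)
Lemma triangle_pos (l : R) : 0 < l ->
  (0 <= \int[mu2]_w (f w.1 * f w.2 * Num.max (l - `|w.1 - w.2|) 0)%:E)%E.
Proof.
move=> l0.
pose Phi (w : (R * R) * R) := (f w.1.1 * f w.1.2 * (between l w.1.1 w.2 * between l w.1.2 w.2))%:E.
have b0 x z : 0 <= between l x z by have /andP[] := le1_between l x z.
have mff : measurable_fun setT (fun w : R * R => f w.1 * f w.2).
  by apply: measurable_funM; apply: measurableT_comp.
have mtri : measurable_fun setT (fun w : R * R => Num.max (l - `|w.1 - w.2|) 0).
  apply: measurable_maxr => //; apply: measurable_funB => //.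
  by apply: measurableT_comp => //; exact: measurable_funB.
have mbb (w : R * R) : measurable_fun setT (fun z => (between l w.1 z * between l w.2 z)%:E).
  by apply/measurable_EFinP; apply: measurable_funM; exact: measurable_between.
have mPhi : measurable_fun setT Phi.
  apply/measurable_EFinP; apply: measurable_funM.
    by apply: measurable_funM; apply: measurableT_comp => //; apply: measurableT_comp.
  apply: measurable_funM; apply: measurable_between => //; exact: measurableT_comp.
have iPhi : (mu2 \x mu)%E.-integrable setT Phi.
  apply: ((integrable12ltyP mu2 mu mPhi).2).
  under eq_integral => w _.
    under eq_integral do rewrite /Phi/= normrM EFinM (ger0_norm (mulr_ge0 (b0 _ _) (b0 _ _))).
    rewrite ge0_integralZl//=; last 2 first.
    - exact: mbb.
    - by move=> z _; rewrite lee_fin mulr_ge0// b0.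
    rewrite integral_between// -EFinM.
    over.
  apply: integrable_lty => //.
  have := integrableZr measurableT l (integrable_plane fi fi).
  apply: le_integrable => //.
    apply/measurable_EFinP; apply: measurable_funM.
      by apply: measurableT_comp => //; exact: mff.
    exact: mtri.
  move=> w _; rewrite /= lee_fin !normrM !normr_id; apply: ler_wpM2l; first exact: mulr_ge0.
  have := normr_ge0 (w.1 - w.2); set d := `|_| => d0.
  have h0 : 0 <= Num.max (l - d) 0 by rewrite le_max lexx orbT.
  by rewrite (ger0_norm h0) (ger0_norm (ltW l0)) ge_max; apply/andP; split; lra.
have inner w : (\int[mu]_z Phi (w, z) = (f w.1 * f w.2 * Num.max (l - `|w.1 - w.2|) 0)%:E)%E.
  rewrite /Phi/=; under eq_integral do rewrite EFinM.
  rewrite integralZl//; last first.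
    apply/integrableP; split; first exact: mbb.
    under eq_integral => z _.
      rewrite gee0_abs; last by rewrite lee_fin mulr_ge0 ?b0.
      over.
    by rewrite /= integral_between// ltry.
  by rewrite integral_between.
under eq_integral do rewrite -inner.
have -> : (\int[mu2]_w \int[mu]_z Phi (w, z) = \int[mu]_z \int[mu2]_w Phi (w, z))%E.
  exact: Fubini.
apply: integral_ge0 => z _.
rewrite (_ : (fun w => _) = (fun w : R * R => ((f w.1 * between l w.1 z) * (f w.2 * between l w.2 z))%:E)); last first.
  by apply/funext => w; rewrite /Phi/=; congr EFin; ring.
rewrite (@integral_plane _ (fun x => f x * between l x z) (fun x => f x * between l x z)); [|exact: integrable_between..].
by rewrite lee_fin -expr2 sqr_ge0.
Qed.

Lemma diag_null : mu2 [set w : R * R | w.1 = w.2] = 0%E /\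
  measurable [set w : R * R | w.1 = w.2].
Proof.
have mD : measurable [set w : R * R | w.1 = w.2].
  have -> : [set w : R * R | w.1 = w.2] = (fun w : R * R => w.1 - w.2) @^-1` [set 0].
    by apply/seteqP; split => w /=; [move=> ->; rewrite subrr|move/subr0_eq].
  rewrite -[X in measurable X]setTI.
  have mB : measurable_fun setT (fun w : R * R => w.1 - w.2).
    by apply: measurable_funB.
  by apply: mB.
split=> //; rewrite /plane_measure /product_measure1.
apply: integral0_eq => x _ /=.
rewrite (_ : xsection _ _ = [set x]) ?lebesgue_measure_set1//.
by apply/seteqP; split => y; rewrite /xsection/= inE/= => ->.
Qed.

(** [logk s] is the triangle kernel of width [s^-1] minus a constant, and the constant contributes a
    multiple of the squared integral of [f], which is 0. *)
Lemma logk_pos (s : R) : 0 < s -> \int[mu]_x f x = 0 ->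
  (0 <= \int[mu2]_w (f w.1 * f w.2 * logk s `|w.1 - w.2|)%:E)%E.
Proof.
move=> s0 f0; have sn0 : s != 0 by rewrite gt_eqF.
have fE (w : R * R) : (f w.1 * f w.2 * logk s `|w.1 - w.2|)%:E =
  ((f w.1 * f w.2 * Num.max (s^-1 - `|w.1 - w.2|) 0)%:E
   - (Num.max (1 - s) 0 / s)%:E * (f w.1 * f w.2)%:E)%E.
  rewrite -EFinM -EFinB; congr EFin; rewrite /logk s0.
  have -> : Num.max (1 - s * `|w.1 - w.2|) 0 = s * Num.max (s^-1 - `|w.1 - w.2|) 0.
    by rewrite maxr_pMr ?ltW// mulr0 mulrBr divff.
  by field.
under eq_integral do rewrite fE.
have ff := integrable_plane fi fi.
have sV : 0 < s^-1 by rewrite invr_gt0.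
rewrite integralB//=; last 2 first.
- apply: le_integrable (integrableZr measurableT s^-1 ff) => //.
    apply/measurable_EFinP; apply: measurable_funM.
      by apply: measurable_funM; apply: measurableT_comp.
    apply: measurable_maxr => //; apply: measurable_funB => //.
    by apply: measurableT_comp => //; apply: measurable_funB.
  move=> w _; rewrite /= lee_fin !normrM; apply: ler_wpM2l; first by rewrite mulr_ge0.
  have := normr_ge0 (w.1 - w.2); set d := `|_| => d0.
  have h0 : 0 <= Num.max (s^-1 - d) 0 by rewrite le_max lexx orbT.
  by rewrite (ger0_norm h0) (ger0_norm (ltW sV)) ge_max; apply/andP; split; lra.
- exact: integrableZl.
rewrite integralZl// integral_plane// f0 mulr0 mule0 sube0.
exact: triangle_pos.
Qed.

(** Integrate [logk_pos] over [s]. For fixed [d] the sign of [logk s d] does not depend on [s], so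
    its absolute value integrates to [|ln d|], and the integrability required by Fubini is exactly
    that of the logarithmic energy. *)
Lemma log_energy_le0 : \int[mu]_x f x = 0 ->
  mu2.-integrable setT (fun w => (f w.1 * f w.2 * ln `|w.1 - w.2|)%:E) ->
  (\int[mu2]_w (f w.1 * f w.2 * ln `|w.1 - w.2|)%:E <= 0)%E.
Proof.
move=> f0 iln.
(* The value 0 at [d = 0] matches [ln 0 = 0], whereas [logk s 0] has infinite integral over [s]. The
   kernel changes only on the diagonal, a null set. *)
pose k s d : R := if 0 < d then logk s d else 0.
pose Psi (w : (R * R) * R) := (f w.1.1 * f w.1.2 * k w.2 `|w.1.1 - w.1.2|)%:E.
have md : measurable_fun setT (fun w : (R * R) * R => `|w.1.1 - w.1.2|).
  apply: measurableT_comp => //; apply: measurable_funB.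
    by apply: (measurableT_comp measurable_fst).
  by apply: (measurableT_comp measurable_snd).
have mff : measurable_fun setT (fun w : R * R => f w.1 * f w.2).
  by apply: measurable_funM; apply: measurableT_comp.
have mPsi : measurable_fun setT Psi.
  apply/measurable_EFinP; apply: measurable_funM.
    exact: (measurableT_comp mff).
  rewrite /k; apply: measurable_fun_ifT => //; first exact: measurable_fun_ltr.
  exact: measurable_logk.
have mk d : measurable_fun setT (fun s => (k s d)%:E).
  apply/measurable_EFinP; rewrite /k; case: (0 < d) => //.
  exact: measurable_logk.
have mabs d : measurable_fun setT (fun s => `|k s d|%:E).
  by have /measurable_EFinP mkd := mk d; apply/measurable_EFinP/measurableT_comp.
have kint d : 0 <= d -> (\int[mu]_s `|(k s d)%:E| = `|ln d|%:E)%E /\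
    (\int[mu]_s (k s d)%:E = (- ln d)%:E)%E.
  rewrite le_eqVlt => /predU1P[<-|d0].
    rewrite ln0// oppr0 normr0 /k ltxx.
    by split; apply: integral0_eq => s _ //=; rewrite normr0.
  rewrite /k d0; have [d1|/ltW d1] := leP d 1.
    have [k0 kI] := logk_le1 d0 d1; split => //.
    rewrite ler0_norm ?ln_le0// -kI; apply: eq_integral => s _.
    by rewrite gee0_abs ?lee_fin.
  have [k0 kI] := logk_ge1 d1; split.
    rewrite ger0_norm ?ln_ge0// -kI; apply: eq_integral => s _.
    by rewrite lee0_abs ?lee_fin.
  rewrite EFinN -kI -integral_ge0N.
    by apply: eq_integral => s _; rewrite -EFinN opprK.
  by move=> s _; rewrite lee_fin oppr_ge0.
have iPsi : (mu2 \x mu)%E.-integrable setT Psi.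
  apply: ((integrable12ltyP mu2 mu mPsi).2).
  under eq_integral => w _.
    under eq_integral do rewrite /Psi/= normrM EFinM.
    rewrite ge0_integralZl//=; last exact: mabs.
    rewrite (kint _ (normr_ge0 _)).1 -EFinM -normrM.
    over.
  by case/integrableP: iln.
rewrite -oppe_ge0 -integralN; last exact: integrable_add_def.
have inner w : (- (f w.1 * f w.2 * ln `|w.1 - w.2|)%:E = \int[mu]_s Psi (w, s))%E.
  rewrite /Psi/=; under eq_integral do rewrite EFinM.
  rewrite integralZl//; last first.
    apply/integrableP; split; first exact: mk.
    by have [kI _] := kint _ (normr_ge0 (w.1 - w.2)); rewrite [ltLHS]kI ltry.
  by rewrite (kint _ (normr_ge0 _)).2 -EFinM mulrN.
under eq_integral do rewrite inner.
have -> : (\int[mu2]_w \int[mu]_z Psi (w, z) = \int[mu]_z \int[mu2]_w Psi (w, z))%E.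
  exact: Fubini.
apply: integral_ge0 => s _.
have [s0|s0] := leP s 0.
  rewrite integral0_eq// => w _; rewrite /Psi /k/= /logk.
  have -> : (0 < s) = false by apply/negbTE; rewrite -leNgt.
  by rewrite if_same mulr0.
suff -> : (\int[mu2]_w Psi (w, s) =
    \int[mu2]_w (f w.1 * f w.2 * logk s `|w.1 - w.2|)%:E)%E by exact: logk_pos.
apply: ae_eq_integral => //.
- by apply: (measurableT_comp mPsi).
- apply/measurable_EFinP; apply: measurable_funM => //; apply: measurable_logk => //.
  by apply: measurableT_comp => //; apply: measurable_funB.
- have [D0 mD] := diag_null; exists [set w : R * R | w.1 = w.2]; split => // w /=.
  apply: contra_notP => wn _; rewrite /Psi /k/= normr_gt0 subr_eq0.
  by move/eqP/negPf: wn => ->.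
Qed.
End logk.

(** * Integrability of logarithmic kernels *)

Section improper.
Variable R : realType.
Notation mu := (@lebesgue_measure R).

(** For integrands that may be unbounded at the ends: closed subintervals exhaust the open one, and
    monotone convergence applies. *)
Lemma ge0_integral_FTC_open (F f : R -> R) (a b : R) : a < b ->
  (forall x, a < x < b -> 0 <= f x) ->
  (forall x, a < x < b -> is_derive x (1 : R) F (f x)) ->
  {in `]a, b[, continuous f} ->
  F x @[x --> a^'+] --> F a -> F x @[x --> b^'-] --> F b ->
  (\int[mu]_(x in `]a, b[) (f x)%:E = (F b - F a)%:E)%E.
Proof.
move=> ab f0 dF cf cFa cFb.
(* Margins of at most half the length, so that every subinterval, including the degenerate one for
   [n = 0], has its ends in order. *)
pose e n : R := (b - a) / 2 * n.+1%:R^-1.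
have e0 n : 0 < e n by rewrite mulr_gt0 ?divr_gt0 ?subr_gt0 ?invr_gt0 ?ltr0n.
have en n : e n <= (b - a) / 2.
  rewrite /e ler_piMr ?divr_ge0 ?subr_ge0 ?(ltW ab)//.
  by rewrite invf_le1 ?ler1n ?ltr0n.
have ecvg : e n @[n --> \oo] --> 0.
  by rewrite -(mulr0 ((b - a) / 2)); apply: cvgM; [exact: cvg_cst|exact: cvg_harmonic].
pose A n := `[a + e n, b - e n]%classic.
have AE : `]a, b[%classic = \bigcup_n A n.
  apply/seteqP; split => [x|x [n _]]; rewrite /A/= !in_itv/=.
    move=> /andP[ax xb].
    have : \forall n \near \oo, e n < Num.min (x - a) (b - x).
      by apply: (cvgr_lt _ ecvg); rewrite lt_min !subr_gt0 ax.
    move=> [n _ /(_ n (leqnn n))] /=; rewrite lt_min => /andP[h1 h2].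
    by exists n => //; rewrite /A/= in_itv/=; apply/andP; split; lra.
  by have := e0 n; move=> ? /andP[? ?]; apply/andP; split; lra.
have sub n x : A n x -> a < x < b.
  by rewrite /A/= in_itv/= => /andP[? ?]; have := e0 n => ?; apply/andP; split; lra.
have mf : measurable_fun `]a, b[ f.
  apply: open_continuous_measurable_fun; first exact: interval_open.
  by move=> x; rewrite inE/= => xab; apply: cf.
have An n : A n `<=` `]a, b[ by move=> x /sub; rewrite /= in_itv.
have mA n : measurable (A n) by exact: measurable_itv.
have mfn n : measurable_fun (A n) (EFin \o f).
  apply/measurable_EFinP; apply: measurable_funS mf => //; exact: An.
have : (\int[mu]_(x in A n) (f x)%:E @[n --> \oo] --> \int[mu]_(x in `]a, b[) (f x)%:E)%E.
  rewrite AE; apply: ge0_nondecreasing_set_cvg_integral => //.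
  - move=> n m nm; apply/subsetPset => x; rewrite /A/= !in_itv/= => /andP[h1 h2].
    have : e m <= e n.
      rewrite /e ler_wpM2l ?divr_ge0 ?subr_ge0 ?(ltW ab)//.
      by rewrite lef_pV2 ?posrE ?ltr0n// ler_nat ltnS.
    by move=> ?; apply/andP; split; lra.
  - by move=> n x /sub xab; rewrite lee_fin f0.
have -> : (fun n => \int[mu]_(x in A n) (f x)%:E)%E = (fun n => (F (b - e n) - F (a + e n))%:E).
  apply/funext => n; apply: integral_FTC.
  - by have := en n; lra.
  - by move=> x /andP[? ?]; apply: dF; apply: (sub n); rewrite /A/= in_itv/=; apply/andP.
  - by apply: continuous_in_subspaceT => x; rewrite inE => /An xab; exact: cf.
move=> h1.
have h2 : (F (b - e n) - F (a + e n))%:E @[n --> \oo] --> (F b - F a)%:E.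
  apply: cvg_EFin; first by near=> n.
  apply: cvgB.
    have /cvg_at_leftP := cFb; apply; split.
      by move=> n; rewrite ltrBlDr ltrDl.
    by rewrite -[X in _ --> X]subr0; apply: cvgB => //; exact: cvg_cst.
  have /cvg_at_rightP := cFa; apply; split.
    by move=> n; rewrite ltrDl.
  by rewrite -[X in _ --> X]addr0; apply: cvgD => //; exact: cvg_cst.
exact: (cvg_unique _ h1 h2).
Unshelve. all: by end_near. Qed.

(** An integrable model of the logarithmic singularity: up to a constant it dominates every power of
    [- ln d] near 0, and its translates all have the same integral. *)
Definition isq (d : R) : R := if `|d| < 1 then (Num.sqrt `|d|)^-1 else 0.

Lemma isq_ge0 d : 0 <= isq d.
Proof. by rewrite /isq; case: ifP => // _; rewrite invr_ge0 sqrtr_ge0. Qed.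

Lemma measurable_isq : measurable_fun setT isq.
Proof.
apply: measurable_fun_ifT => //; first exact: measurable_fun_ltr.
apply: measurable_funV; apply: measurableT_comp => //.
by apply: continuous_measurable_fun; exact: sqrt_continuous.
Qed.

Lemma integral_isq (x : R) : (\int[mu]_y (isq (x - y))%:E = 4%:E)%E.
Proof.
pose f1 := (fun y : R => (Num.sqrt (x - y))^-1%:E) \_ `]x - 1, x[ : R -> \bar R.
pose f2 := (fun y : R => (Num.sqrt (y - x))^-1%:E) \_ `]x, x + 1[ : R -> \bar R.
have ms (h : R -> R) : measurable_fun setT h -> measurable_fun setT (fun y => (Num.sqrt (h y))^-1%:E).
  move=> mh; apply/measurable_EFinP/measurable_funV; apply: measurableT_comp => //.
  by apply: continuous_measurable_fun; exact: sqrt_continuous.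
have m1 : measurable_fun setT (fun y : R => (Num.sqrt (x - y))^-1%:E).
  by apply: ms; exact: measurable_funB.
have m2 : measurable_fun setT (fun y : R => (Num.sqrt (y - x))^-1%:E).
  by apply: ms; exact: measurable_funB.
transitivity (\int[mu]_y (f1 y + f2 y))%E.
  apply: eq_integral => y _; rewrite /f1 /f2 !patchE !mem_setE !in_itv/= /isq ltr_distlC.
  have [->|/eqP yx] := eqVneq y x.
    by rewrite !ltxx andbF/= subrr normr0 sqrtr0 invr0 adde0; case: ifP.
  case: (ltgtP y x) yx => // yx _; rewrite ?andbT ?andbF/= ?adde0 ?add0e.
    have -> : y < x + 1 by lra.
    by rewrite andbT ger0_norm ?subr_ge0 ?ltW//; case: ifP.
  have -> : x - 1 < y by lra.
  by rewrite distrC ger0_norm ?subr_ge0 ?ltW//=; case: ifP.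
have mf1 : measurable_fun setT f1.
  by apply/(measurable_restrictT _ _).1 => //; exact: measurable_funTS.
have mf2 : measurable_fun setT f2.
  by apply/(measurable_restrictT _ _).1 => //; exact: measurable_funTS.
have f10 y : (0 <= f1 y)%E.
  by rewrite /f1 patchE; case: ifP => // _; rewrite lee_fin invr_ge0 sqrtr_ge0.
have f20 y : (0 <= f2 y)%E.
  by rewrite /f2 patchE; case: ifP => // _; rewrite lee_fin invr_ge0 sqrtr_ge0.
rewrite ge0_integralD//.
rewrite -!integral_mkcond.
have dsq (y : R) : 0 < y -> is_derive y (1 : R) (fun y => 2 * Num.sqrt y) (Num.sqrt y)^-1.
  move=> y0; have sy : Num.sqrt y != 0 by rewrite gt_eqF// sqrtr_gt0.
  have -> : (Num.sqrt y)^-1 = 2 *: (2 * Num.sqrt y)^-1 by rewrite /GRing.scale/=; field.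
  by apply: is_deriveZ; exact: is_derive1_sqrt.
have cts (g : R -> R) : continuous g -> continuous (fun y => 2 * Num.sqrt (g y)).
  move=> cg y; apply: cvgM; first exact: cvg_cst.
  by apply: continuous_comp; [exact: cg|exact: sqrt_continuous].
have ctV (g : R -> R) y : continuous g -> 0 < g y -> {for y, continuous (fun y => (Num.sqrt (g y))^-1)}.
  move=> cg gy; apply: cvgV; first by rewrite gt_eqF// sqrtr_gt0.
  by apply: continuous_comp; [exact: cg|exact: sqrt_continuous].
have c1 : continuous (fun y : R => x - y) by move=> y; apply: cvgB => //; exact: cvg_cst.
have c2 : continuous (fun y : R => y - x) by move=> y; apply: cvgB => //; exact: cvg_cst.
have -> : (\int[mu]_(y in `](x - 1)%R, x[) (Num.sqrt (x - y))^-1%:E = 2%:E)%E.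
  rewrite (_ : 2 = - (2 * Num.sqrt (x - x)) - - (2 * Num.sqrt (x - (x - 1)))); last first.
    by rewrite subrr sqrtr0 opprB subrKC sqrtr1; ring.
  apply: (@ge0_integral_FTC_open (fun y => - (2 * Num.sqrt (x - y))) (fun y => (Num.sqrt (x - y))^-1)).
  - lra.
  - by move=> y _; rewrite invr_ge0 sqrtr_ge0.
  - move=> y /andP[_ yx]; have xy : 0 < x - y by lra.
    have -> : (Num.sqrt (x - y))^-1 = - ((Num.sqrt (x - y))^-1 * (0 - 1)) by rewrite sub0r mulrN1 opprK.
    have d1 : is_derive y (1 : R) (fun y => x - y) (0 - 1) by apply: is_deriveB.
    exact: (is_deriveN (@is_derive1_comp _ _ (fun y => x - y) _ _ _ (dsq _ xy) d1)).
  - by move=> y; rewrite in_itv/= => /andP[_ yx]; apply: (ctV _ _ c1); lra.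
  - by apply: cvg_at_right_filter; apply: cvgN; exact: (cts _ c1).
  - by apply: cvg_at_left_filter; apply: cvgN; exact: (cts _ c1).
have -> : (\int[mu]_(y in `]x, (x + 1)%R[) (Num.sqrt (y - x))^-1%:E = 2%:E)%E.
  rewrite (_ : 2 = 2 * Num.sqrt (x + 1 - x) - 2 * Num.sqrt (x - x)); last first.
    by rewrite subrr sqrtr0 addrAC subrr add0r sqrtr1; ring.
  apply: (@ge0_integral_FTC_open (fun y => 2 * Num.sqrt (y - x)) (fun y => (Num.sqrt (y - x))^-1)).
  - lra.
  - by move=> y _; rewrite invr_ge0 sqrtr_ge0.
  - move=> y /andP[xy _]; have xy' : 0 < y - x by lra.
    have -> : (Num.sqrt (y - x))^-1 = ((Num.sqrt (y - x))^-1 * (1 - 0)) by rewrite subr0 mulr1.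
    have d1 : is_derive y (1 : R) (fun y => y - x) (1 - 0) by apply: is_deriveB.
    exact: (@is_derive1_comp _ _ (fun y => y - x) _ _ _ (dsq _ xy') d1).
  - by move=> y; rewrite in_itv/= => /andP[xy _]; apply: (ctV _ _ c2); lra.
  - by apply: cvg_at_right_filter; exact: (cts _ c2).
  - by apply: cvg_at_left_filter; exact: (cts _ c2).
by rewrite -EFinD; congr EFin; ring.
Qed.
(** The exponent is 1/2 times 1 + 1/2: the equilibrium density is bounded by a multiple of x^(-1/2),
    and its tameness is shown with exponent 1 + 1/2. *)
Lemma integrable_powR34 (b : R) : 0 < b ->
  mu.-integrable `]0, b[ (EFin \o (fun x => x `^ (- (3 / 4)))).
Proof.
move=> b0; apply/integrableP; split.
  by apply/measurable_EFinP; apply: measurable_funTS; exact: measurable_powR.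
under eq_integral do rewrite /= ger0_norm ?powR_ge0//.
have dF (x : R) : 0 < x -> is_derive x (1 : R) (fun x => 4 * x `^ 4^-1) (x `^ (- (3 / 4))).
  move=> x0; have D := is_derive1_powR 4^-1 x0.
  apply: dv_eq (dvZ 4 D) _; rewrite mulrA mulfV ?mul1r// ?pnatr_eq0//.
  by congr powR; field.
rewrite (_ : integral _ _ _ = (4 * b `^ 4^-1 - 4 * 0 `^ 4^-1)%:E) ?ltry//.
apply: (@ge0_integral_FTC_open (fun x => 4 * x `^ 4^-1) (fun x => x `^ (- (3 / 4)))) => //.
- by move=> x _; exact: powR_ge0.
- by move=> x /andP[x0 _]; exact: dF.
- move=> x; rewrite in_itv/= => /andP[x0 _].
  exact: dv_continuous (is_derive1_powR (- (3 / 4)) x0).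
- apply: cvgM; first exact: cvg_cst.
  by rewrite powR0 ?invr_eq0 ?pnatr_eq0//; exact: powR_cvg0.
- by apply: cvg_at_left_filter; exact: dv_continuous (dF b b0).
Qed.

End improper.

(** * Tame functions against the logarithm *)

Section tame_log.
Variable R : realType.
Notation mu := (@lebesgue_measure R).
Local Notation mu2 := (@plane_measure R).
Implicit Types (p q : R -> R).

Lemma ln_powR_bound (k : R) : 0 < k ->
  exists2 C, 0 <= C & forall d, 0 < d < 1 -> (- ln d) `^ k <= C * (Num.sqrt d)^-1.
Proof.
(* [ln y <= y] at y = d^(-a) gives - ln d <= d^(-a) / a. With this [a] the power [k] of the
   right-hand side has exponent -1/2. *)
move=> k0; pose a := (2 * k)^-1.
have a0 : 0 < a by rewrite invr_gt0 mulr_gt0.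
exists (a^-1 `^ k) => [|d /andP[d0 d1]]; first exact: powR_ge0.
have ln0 : 0 <= - ln d by rewrite oppr_ge0 ln_le0// ltW.
have h : - ln d <= a^-1 * d `^ (- a).
  rewrite mulrC ler_pdivlMr// mulNr mulrC -mulNr -ln_powR ltW// ln_sublinear//.
  exact: powR_gt0.
have hh : (- ln d) `^ k <= (a^-1 * d `^ (- a)) `^ k.
  apply: ge0_ler_powR => //; rewrite ?nnegrE//; first exact: ltW.
  by rewrite mulr_ge0 ?powR_ge0// invr_ge0 ltW.
apply: (le_trans hh).
have a1 : 0 <= a^-1 by rewrite invr_ge0 ltW.
rewrite (powRM _ a1 (powR_ge0 _ _)) -powRrM.
have -> : - a * k = - 2^-1 by rewrite /a; field; rewrite gt_eqF.
by rewrite powRN powR12_sqrt// ltW.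
Qed.

(** This is where both conditions of tameness enter. For |x - y| < 1 it is Young's inequality with
    conjugate exponents [1 + eps] and [1 + eps^-1]; for |x - y| >= 1 the logarithm is at most |x| +
    |y|, which the first moment controls. *)
Lemma mul_log_bound (eps : R) : 0 < eps ->
  exists2 C, 0 <= C & forall x y q : R,
    `|q * ln `|x - y| | <= `|q| `^ (1 + eps) + C * isq (x - y) + (`|x| + `|y|) * `|q|.
Proof.
move=> eps0; pose k := 1 + eps^-1.
have k0 : 0 < k by rewrite addr_gt0// invr_gt0.
have [C C0 hC] := ln_powR_bound k0; exists C => // x y q.
have h1 : 0 <= `|q| `^ (1 + eps) by exact: powR_ge0.
have h2 : 0 <= C * isq (x - y) by rewrite mulr_ge0// isq_ge0.
have h3 : 0 <= (`|x| + `|y|) * `|q| by rewrite mulr_ge0// addr_ge0.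
have tri : `|x - y| <= `|x| + `|y| by exact: ler_normB.
rewrite normrM; move: tri h2; rewrite /isq; have := normr_ge0 (x - y).
move: (`|x - y| : R) => d d0 tri h2.
have [d1|d1] := leP 1 d.
  have : `|q| * `|ln d| <= (`|x| + `|y|) * `|q|.
    rewrite mulrC ler_wpM2r// ger0_norm ?ln_ge0//.
    by rewrite (le_trans _ tri)// ltW// ln_sublinear// (lt_le_trans ltr01).
  by move: h2; rewrite ltNge d1 /= => h2; lra.
move: d0; rewrite le_eqVlt => /predU1P[d0|d0].
  by move: h2; rewrite -d0 ln0// normr0 mulr0 ltr01 => h2; do 2 apply: addr_ge0 => //.
have lnd : 0 <= - ln d by rewrite oppr_ge0 ln_le0// ltW.
have : `|q| * `|ln d| <= `|q| `^ (1 + eps) + (- ln d) `^ k.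
  have -> : `|ln d| = - ln d by rewrite ler0_norm// -oppr_ge0.
  have e1 : 0 < 1 + eps by rewrite addr_gt0.
  have pq : (1 + eps)^-1 + k^-1 = 1.
    by rewrite /k; field; rewrite !gt_eqF// addrC addr_gt0.
  have := conjugate_powR (normr_ge0 q) lnd e1 k0 pq.
  move/le_trans; apply; apply: lerD; rewrite ler_pdivrMr// ler_peMr ?powR_ge0// lerDl ltW//.
  by rewrite invr_gt0.
have := hC d; rewrite d0 d1 => /(_ isT).
by move: h2; rewrite d1 => h2; lra.
Qed.

(* The conditions of [tame] for the extension of a function by zero. *)
Definition tame_line p : Prop :=
  [/\ mu.-integrable setT (EFin \o p),
      mu.-integrable setT (EFin \o (fun x => `|x| * p x))
    & exists2 eps : R, 0 < eps & mu.-integrable setT (EFin \o (fun x => `|p x| `^ (1 + eps)))].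

Lemma measurable_halfline : measurable (halfline R).
Proof. by rewrite /halfline -set_itvcy; exact: measurable_itv. Qed.

Lemma tame_line_patch p : tame p -> tame_line (p \_ (halfline R)).
Proof.
have mD := measurable_halfline.
have mk f : mu.-integrable (halfline R) f -> mu.-integrable setT (f \_ (halfline R)).
  by move=> h; exact: ((@integrable_mkcond _ _ R mu (halfline R) f mD).1 h).
move=> [ip ixp [eps eps0 iep]].
have mp : measurable_fun (halfline R) p by have /measurable_EFinP := measurable_int _ ip.
split.
- by rewrite -restrict_EFin; exact: mk.
- have -> : EFin \o (fun x => `|x| * (p \_ (halfline R)) x) =
            (EFin \o (fun x => x * p x)) \_ (halfline R).
    apply/funext => x; rewrite /= !patchE; case: ifPn; last by rewrite mulr0.
    by rewrite inE /halfline/= => x0; rewrite ger0_norm.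
  apply: mk; apply/integrableP; split.
    by apply/measurable_EFinP; apply: measurable_funM.
  apply: le_lt_trans ixp; apply: ge0_le_integral => //.
  - by apply: measurableT_comp => //; apply/measurable_EFinP/measurable_funM.
  - by apply/measurable_EFinP; apply: measurable_funM => //; exact: measurableT_comp.
  - by move=> x x0; rewrite lee_fin normrM (ger0_norm x0).
- exists eps => //.
  have -> : EFin \o (fun x => `|(p \_ (halfline R)) x| `^ (1 + eps)) =
            (EFin \o (fun x => `|p x| `^ (1 + eps))) \_ (halfline R).
    apply/funext => x; rewrite /= !patchE; case: ifPn => // _.
    by rewrite normr0 powR0// gt_eqF// addr_gt0.
  apply: mk; apply/integrableP; split.
    apply/measurable_EFinP; apply: (measurableT_comp (measurable_powR _)).
    exact: measurableT_comp.
  under eq_integral do rewrite /= ger0_norm ?powR_ge0//.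
  by [].
Qed.

Lemma measurable_tame_line p : tame_line p -> measurable_fun setT p.
Proof. by case=> ip _ _; have /measurable_EFinP := measurable_int _ ip. Qed.

Lemma integrable_isq (x : R) : mu.-integrable setT (fun y => (isq (x - y))%:E).
Proof.
apply/integrableP; split.
  apply/measurable_EFinP; apply: (measurableT_comp (@measurable_isq R)).
  exact: measurable_funB.
under eq_integral do rewrite gee0_abs ?lee_fin ?isq_ge0//.
by rewrite integral_isq ltry.
Qed.

Lemma integrable_log q (x : R) : tame_line q ->
  mu.-integrable setT (fun y => (q y * ln `|x - y|)%:E).
Proof.
move=> tq; have mq := measurable_tame_line tq; case: tq => iq iyq [eps eps0 ieq].
have [C C0 hC] := mul_log_bound eps0.
pose g y := `|q y| `^ (1 + eps) + C * isq (x - y) + (`|x| * `|q y| + `| `|y| * q y |).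
have ig : mu.-integrable setT (EFin \o g).
  have i2 := integrableZl measurableT C (integrable_isq x).
  have i3 := integrableZl measurableT `|x| (integrable_norm iq).
  have i4 := integrable_norm iyq.
  have := integrableD measurableT (integrableD measurableT ieq i2)
    (integrableD measurableT i3 i4).
  by apply: eq_integrable => // y _; rewrite /g/= !EFinD !EFinM.
apply: le_integrable ig => //.
  apply/measurable_EFinP; apply: measurable_funM => //.
  apply: (measurableT_comp (@measurable_ln R)); apply: measurableT_comp => //.
  exact: measurable_funB.
move=> y _; rewrite /= lee_fin (le_trans (hC x y (q y)))//.
apply: le_trans (ler_norm _); rewrite /g normrM normr_id; lra.
Qed.

Lemma integrable_plane_isq p : mu.-integrable setT (EFin \o p) ->
  mu2.-integrable setT (fun w => (p w.1 * isq (w.1 - w.2))%:E).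
Proof.
move=> ip; have mp : measurable_fun setT p by have /measurable_EFinP := measurable_int _ ip.
have misq := @measurable_isq R.
have mPsi : measurable_fun setT (fun w : R * R => (p w.1 * isq (w.1 - w.2))%:E).
  apply/measurable_EFinP; apply: measurable_funM; first exact: measurableT_comp.
  by apply: (measurableT_comp misq); exact: measurable_funB.
apply: ((integrable12ltyP mu mu mPsi).2).
under eq_integral => x _.
  under eq_integral => y _ do rewrite /= normrM EFinM (ger0_norm (isq_ge0 _)).
  rewrite ge0_integralZl//=; last 2 first.
  - apply/measurable_EFinP; apply: (measurableT_comp misq); exact: measurable_funB.
  - by move=> y _; rewrite lee_fin isq_ge0.
  rewrite integral_isq.
  over.
apply: integrable_lty => //; apply: integrableZr => //.
exact: integrable_norm ip.
Qed.

Lemma integrable_plane_log p q : tame_line p -> tame_line q ->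
  mu2.-integrable setT (fun w => (p w.1 * q w.2 * ln `|w.1 - w.2|)%:E).
Proof.
move=> tp tq; have mp := measurable_tame_line tp; have mq := measurable_tame_line tq.
case: tp tq => ip ixp _ [iq iyq [eps eps0 ieq]].
have [C C0 hC] := mul_log_bound eps0.
have np := integrable_norm ip; have nq := integrable_norm iq.
pose g (w : R * R) := `|p w.1| * `|q w.2| `^ (1 + eps) + C * (`|p w.1| * isq (w.1 - w.2))
  + (`| `|w.1| * p w.1 | * `|q w.2| + `|p w.1| * `| `|w.2| * q w.2 |).
have ig : mu2.-integrable setT (EFin \o g).
  have i1 := integrable_plane np ieq.
  have i2 := integrableZl measurableT C (integrable_plane_isq np).
  have i3 := integrable_plane (integrable_norm ixp) nq.
  have i4 := integrable_plane np (integrable_norm iyq).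
  have := integrableD measurableT (integrableD measurableT i1 i2)
    (integrableD measurableT i3 i4).
  by apply: eq_integrable => // w _; rewrite /g/= !EFinD !EFinM.
apply: le_integrable ig => //.
  apply/measurable_EFinP; apply: measurable_funM.
    by apply: measurable_funM; apply: measurableT_comp.
  apply: (measurableT_comp (@measurable_ln R)); apply: measurableT_comp => //.
  exact: measurable_funB.
move=> w _; rewrite /= lee_fin.
apply: le_trans (ler_norm _); rewrite -mulrA normrM.
apply: le_trans (ler_wpM2l (normr_ge0 _) (hC w.1 w.2 (q w.2))) _.
rewrite /g !normrM !normr_id; lra.
Qed.

Lemma integrable_ln_affine q (rho : R) : 0 <= rho -> tame_line q -> (forall x, x < 0 -> q x = 0) ->
  mu.-integrable setT (fun x => (q x * ln (1 + rho * x))%:E).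
Proof.
move=> rho0 tq q0; have mq := measurable_tame_line tq; case: tq => iq ixq _.
apply: le_integrable (integrableZl measurableT rho ixq) => //.
  apply/measurable_EFinP; apply: measurable_funM => //.
  apply: (measurableT_comp (@measurable_ln R)); apply: measurable_funD => //.
move=> x _; rewrite /= lee_fin; have [x0|x0] := ltP x 0.
  by rewrite q0// mul0r normr0.
rewrite !normrM normr_id mulrA mulrC ler_wpM2r// !ger0_norm//; last first.
  by rewrite ln_ge0// lerDl mulr_ge0.
by rewrite le_ln1Dx// (lt_le_trans _ (mulr_ge0 rho0 x0))// ltrN10.
Qed.
End tame_log.

(** * The variational inequality *)

Section variational.
Variable R : realType.
Notation mu := (@lebesgue_measure R).
Local Notation mu2 := (@plane_measure R).
Implicit Types (p q P Q : R -> R).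

Definition log_energy P Q : R := \int[mu2]_w (P w.1 * Q w.2 * ln `|w.1 - w.2|).

Definition log_potential P (x : R) : R := \int[mu]_y (P y * ln `|x - y|).

Lemma integrable_log_scaled P (c x : R) : tame_line P ->
  mu.-integrable setT (fun y => (c * P y * ln `|x - y|)%:E).
Proof.
move=> tP; have := integrableZl measurableT c (integrable_log x tP).
by apply: eq_integrable => // y _; rewrite /= -EFinM mulrA.
Qed.

Lemma Rintegral_log_scaled P (c x : R) : tame_line P ->
  (\int[mu]_y (c * P y * ln `|x - y|)%:E = (c * log_potential P x)%:E)%E.
Proof.
move=> tP; rewrite /log_potential -RintegralZl//; last exact: integrable_log.
rewrite /Rintegral fineK.
  by apply: eq_integral => y _; rewrite mulrA.
have := integrable_fin_num measurableT (integrable_log_scaled c x tP).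
by congr (_ \is a fin_num); apply: eq_integral => y _; rewrite mulrA.
Qed.

Lemma log_energy_potential P Q : tame_line P -> tame_line Q ->
  mu.-integrable setT (fun x => (P x * log_potential Q x)%:E) /\
  log_energy P Q = \int[mu]_x (P x * log_potential Q x).
Proof.
move=> tP tQ; have iPQ := integrable_plane_log tP tQ.
have FE : (fun x => (P x * log_potential Q x)%:E) =
    fubini_F mu (fun w => (P w.1 * Q w.2 * ln `|w.1 - w.2|)%:E).
  by apply/funext => x; rewrite /fubini_F/= Rintegral_log_scaled.
split; first by rewrite FE; exact: integrable_fubini_F iPQ.
have := @integral12_prod_meas1 _ _ _ _ _ mu mu _ iPQ.
move=> E; rewrite /log_energy /Rintegral; congr fine.
by apply: etrans (esym E) _; apply: eq_integral => x _; rewrite /fubini_F/= Rintegral_log_scaled.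
Qed.

Lemma log_energyC P Q : tame_line P -> tame_line Q -> log_energy P Q = log_energy Q P.
Proof.
move=> tP tQ; rewrite (log_energy_potential tP tQ).2.
have iQP := integrable_plane_log tQ tP.
have := @integral21_prod_meas1 _ _ _ _ _ mu mu _ iQP.
move=> E; rewrite /log_energy /Rintegral; congr fine.
apply: etrans E; apply: eq_integral => x _; rewrite /fubini_G/=.
rewrite -Rintegral_log_scaled//; apply: eq_integral => y _.
by rewrite distrC (mulrC (P x)).
Qed.

(** Negativity of the logarithmic energy of [Q - P], expanded by bilinearity and symmetry. *)
Lemma log_energyBB P Q : tame_line P -> tame_line Q ->
  \int[mu]_x P x = \int[mu]_x Q x ->
  log_energy Q Q + log_energy P P - 2 * log_energy Q P <= 0.
Proof.
move=> tP tQ PQ.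
have [iP _ _] := tP; have [iQ _ _] := tQ.
have iQQ := integrable_plane_log tQ tQ; have iPP := integrable_plane_log tP tP.
have iQP := integrable_plane_log tQ tP; have iPQ := integrable_plane_log tP tQ.
have i1 := integrableD measurableT iQQ iPP.
have i2 := integrableD measurableT iQP iPQ.
have i12 := integrableB measurableT i1 i2.
pose f x := Q x - P x.
have fi : mu.-integrable setT (EFin \o f) by have := integrableB measurableT iQ iP; apply: eq_integrable => // x _; rewrite /f/= EFinB.
have f0 : \int[mu]_x f x = 0 by rewrite RintegralB// PQ subrr.
have ff w : (f w.1 * f w.2 * ln `|w.1 - w.2|)%:E =
   (((Q w.1 * Q w.2 * ln `|w.1 - w.2|)%:E + (P w.1 * P w.2 * ln `|w.1 - w.2|)%:E)
   - ((Q w.1 * P w.2 * ln `|w.1 - w.2|)%:E + (P w.1 * Q w.2 * ln `|w.1 - w.2|)%:E))%E.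
  by transitivity (Q w.1 * Q w.2 * ln `|w.1 - w.2| + P w.1 * P w.2 * ln `|w.1 - w.2|
      - (Q w.1 * P w.2 * ln `|w.1 - w.2| + P w.1 * Q w.2 * ln `|w.1 - w.2|))%:E;
    rewrite ?EFinB ?EFinD//; congr EFin; rewrite /f; ring.
have iff : mu2.-integrable setT (fun w => (f w.1 * f w.2 * ln `|w.1 - w.2|)%:E).
  by apply: eq_integrable i12 => // w _; rewrite ff.
have := log_energy_le0 fi f0 iff.
under eq_integral do rewrite ff.
rewrite integralB// !integralD// => h.
have K (U V : R -> R) : mu2.-integrable setT (fun w => (U w.1 * V w.2 * ln `|w.1 - w.2|)%:E) ->
   (\int[mu2]_w (U w.1 * V w.2 * ln `|w.1 - w.2|)%:E = (log_energy U V)%:E)%E.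
  by move=> i; rewrite /log_energy /Rintegral fineK//; exact: integrable_fin_num i.
move: h; rewrite !K// => h.
have {}h : log_energy Q Q + log_energy P P - (log_energy Q P + log_energy P Q) <= 0.
  by rewrite -lee_fin; exact: h.
by move: h; rewrite (log_energyC tP tQ); lra.
Qed.

Lemma Rintegral_halfline (f : R -> R) :
  \int[mu]_(x in halfline R) f x = \int[mu]_x (f \_ (halfline R)) x.
Proof. exact: Rintegral_mkcond. Qed.

(** Extension by zero moves every integral to the line. With [|x|] for [x], the first moment is the
    one in [tame_line], and [ln |x|] is the logarithmic kernel with one argument at 0, to which
    [integrable_log] applies. *)
Lemma energyE (beta : R) p : tame p -> let P := p \_ (halfline R) in
  energy beta p = \int[mu]_x (`|x| * P x) - (beta - 1) * \int[mu]_x (P x * ln `|x|)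
     - log_energy P P.
Proof.
move=> tp P; have tP : tame_line P by exact: tame_line_patch.
rewrite /energy; congr (_ - _ - _).
- rewrite Rintegral_halfline; apply: eq_Rintegral => x _; rewrite /P !patchE.
  by case: ifPn => [|_]; rewrite ?mulr0// inE /halfline/= => x0; rewrite ger0_norm.
- congr (_ * _); rewrite Rintegral_halfline; apply: eq_Rintegral => x _; rewrite /P !patchE.
  by case: ifPn => [|_]; rewrite ?mul0r// inE /halfline/= => x0; rewrite ger0_norm.
rewrite (log_energy_potential tP tP).2 Rintegral_halfline; apply: eq_Rintegral => y _.
rewrite {1}patchE; case: ifPn => [y0|yn]; last first.
  by rewrite /P patchE (negPf yn) mul0r.
rewrite Rintegral_halfline.
have := Rintegral_log_scaled (P y) y tP.
rewrite -[_ * log_potential _ _]/(fine (_%:E)) => <-.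
rewrite /Rintegral; congr fine; apply: eq_integral => x _; congr EFin.
rewrite /P !patchE y0; case: ifPn => xn; last by rewrite mulr0 mul0r.
by rewrite distrC (mulrC (p x)).
Qed.

Lemma density_line p : tame_density R p -> let P := p \_ (halfline R) in
  [/\ tame_line P, forall x, x < 0 -> P x = 0, forall x, 0 <= P x & \int[mu]_x P x = 1].
Proof.
move=> [tp p0 p1] P; split.
- exact: tame_line_patch.
- by move=> x x0; rewrite /P patchE ifN// notin_setE /halfline/= => /le_lt_trans/(_ x0); rewrite ltxx.
- by move=> x; rewrite /P patchE; case: ifPn => //; rewrite inE; exact: p0.
- by rewrite -Rintegral_halfline.
Qed.

Lemma integral_ln_affineE (rho : R) p :
  \int[mu]_(x in halfline R) (p x * ln (1 + rho * x)) =
  \int[mu]_x ((p \_ (halfline R)) x * ln (1 + rho * x)).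
Proof.
rewrite Rintegral_halfline; apply: eq_Rintegral => x _; rewrite !patchE.
by case: ifPn; rewrite ?mul0r.
Qed.

(** The Euler-Lagrange conditions are available for positive [x] only; this discards the point 0,
    where the default value of [ln] would interfere. *)
Lemma Rintegral_neq0 (f : R -> R) : measurable_fun setT f ->
  \int[mu]_x f x = \int[mu]_(x in [set~ 0]) f x.
Proof.
move=> mf; rewrite /Rintegral; congr fine.
rewrite -(@integral_setD1 _ _ 0 setT) ?setTD//; last first.
  by apply/measurable_EFinP; exact: measurable_funTS.
exact: measurableC.
Qed.

Section first_variation.
Variables (beta rho t l : R) (P Q : R -> R).
Hypothesis rho0 : 0 <= rho.
Hypotheses (tP : tame_line P) (tQ : tame_line Q).
Hypotheses (Qneg : forall x, x < 0 -> Q x = 0) (Q1 : \int[mu]_x Q x = 1).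

(** First variation at [P] of the energy minus [t] times the moment, shifted by the level [l]. *)
Let g x := `|x| - (beta - 1) * ln `|x| - t * ln (1 + rho * x) - 2 * log_potential P x - l.

Lemma first_variation_rep :
  mu.-integrable setT (EFin \o (fun x => Q x * g x)) /\
  \int[mu]_x (`|x| * Q x) - (beta - 1) * \int[mu]_x (Q x * ln `|x|)
  - t * \int[mu]_x (Q x * ln (1 + rho * x)) - 2 * log_energy Q P - l
  = \int[mu]_x (Q x * g x).
Proof.
have [iQ ixQ _] := tQ.
have iln : mu.-integrable setT (EFin \o (fun x => Q x * ln `|x|)).
  have := integrable_log 0 tQ; apply: eq_integrable => // x _.
  by rewrite /= sub0r normrN.
have ila : mu.-integrable setT (EFin \o (fun x => Q x * ln (1 + rho * x))).
  exact: integrable_ln_affine.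
have [iU ->] := log_energy_potential tQ tP.
have sc (f : R -> R) (c : R) : mu.-integrable setT (EFin \o f) ->
    mu.-integrable setT (EFin \o (fun x => c * f x)).
  by move=> /(integrableZl measurableT c); apply: eq_integrable => // x _; rewrite /= EFinM.
have sb (f h : R -> R) : mu.-integrable setT (EFin \o f) -> mu.-integrable setT (EFin \o h) ->
    mu.-integrable setT (EFin \o (fun x => f x - h x)).
  by move=> fi hi; have := integrableB measurableT fi hi; apply: eq_integrable => // x _; rewrite /= EFinB.
have j1 := sc _ (beta - 1) iln; have j2 := sc _ t ila; have j3 := sc _ 2 iU; have j4 := sc _ l iQ.
have k1 := sb _ _ ixQ j1; have k2 := sb _ _ k1 j2; have k3 := sb _ _ k2 j3; have k4 := sb _ _ k3 j4.
have gE x : Q x * g x = `|x| * Q x - (beta - 1) * (Q x * ln `|x|)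
    - t * (Q x * ln (1 + rho * x)) - 2 * (Q x * log_potential P x) - l * Q x.
  by rewrite /g; ring.
split; first by apply: eq_integrable k4 => // x _; rewrite /= gE.
under [RHS]eq_Rintegral do rewrite gE.
rewrite RintegralB// RintegralB// RintegralB// RintegralB//.
by rewrite RintegralZl// RintegralZl// RintegralZl// RintegralZl// Q1 mulr1.
Qed.

Lemma measurable_first_variation : measurable_fun setT (fun x => Q x * g x).
Proof. by have [i _] := first_variation_rep; have /measurable_EFinP := measurable_int _ i. Qed.

Lemma first_variation_ge : (forall x, 0 <= Q x) ->
  (forall x, 0 < x -> l <= x - (beta - 1) * ln x - t * ln (1 + rho * x) - 2 * log_potential P x) ->
  l <= \int[mu]_x (`|x| * Q x) - (beta - 1) * \int[mu]_x (Q x * ln `|x|)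
  - t * \int[mu]_x (Q x * ln (1 + rho * x)) - 2 * log_energy Q P.
Proof.
move=> Q0 gl; have [_ E] := first_variation_rep.
rewrite -subr_ge0 E Rintegral_neq0; last exact: measurable_first_variation.
apply: Rintegral_ge0 => x /eqP x0; have [xn|xp] := ltP x 0; first by rewrite Qneg// mul0r.
have {xp}x0 : 0 < x by rewrite lt_neqAle eq_sym x0.
by rewrite mulr_ge0// /g gtr0_norm// subr_ge0 gl.
Qed.

Lemma first_variation_eq :
  (forall x, 0 < x -> Q x != 0 ->
     l = x - (beta - 1) * ln x - t * ln (1 + rho * x) - 2 * log_potential P x) ->
  l = \int[mu]_x (`|x| * Q x) - (beta - 1) * \int[mu]_x (Q x * ln `|x|)
  - t * \int[mu]_x (Q x * ln (1 + rho * x)) - 2 * log_energy Q P.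
Proof.
move=> gl; have [_ E] := first_variation_rep.
apply/eqP; rewrite eq_sym -subr_eq0 E Rintegral_neq0; last exact: measurable_first_variation.
rewrite (_ : \int[mu]_(x in [set~ 0]) (Q x * g x) = \int[mu]_(x in [set~ 0]) 0).
  by rewrite /Rintegral integral0.
apply: eq_Rintegral => x; rewrite inE/= => /eqP x0.
have [xn|xp] := ltP x 0; first by rewrite Qneg// mul0r.
have {xp}x0 : 0 < x by rewrite lt_neqAle eq_sym x0.
have [->|Qx] := eqVneq (Q x) 0; first by rewrite mul0r.
by rewrite /g gtr0_norm// -(gl x x0 Qx) subrr mulr0.
Qed.
End first_variation.

(** The functional is quadratic: the difference of its values at q and p is the difference of the
    first variation at p integrated against q and against p, minus the logarithmic energy of q - p.
    The first is at least l - l = 0, and the second is nonpositive before the minus sign. *)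
Lemma equilibrium_minimizes (beta rho t l : R) p q : 0 <= rho ->
  tame_density R p -> tame_density R q -> let P := p \_ (halfline R) in
  (forall x, 0 < x -> l <= x - (beta - 1) * ln x - t * ln (1 + rho * x) - 2 * log_potential P x) ->
  (forall x, 0 < x -> P x != 0 ->
     l = x - (beta - 1) * ln x - t * ln (1 + rho * x) - 2 * log_potential P x) ->
  energy beta p - t * \int[mu]_(x in halfline R) (p x * ln (1 + rho * x)) <=
  energy beta q - t * \int[mu]_(x in halfline R) (q x * ln (1 + rho * x)).
Proof.
move=> rho0 dp dq P hge heq; pose Q := q \_ (halfline R).
have [tP Pn P0 P1] := density_line dp; have [tQ Qn Q0 Q1] := density_line dq.
rewrite !energyE ?integral_ln_affineE; [|by case: dq|by case: dp].
have h1 := first_variation_ge rho0 tP tQ Qn Q1 Q0 hge.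
have h2 := first_variation_eq rho0 tP tP Pn P1 heq.
have := log_energyBB tP tQ; rewrite P1 Q1 => /(_ erefl).
by move: h1 h2; rewrite -/P -/Q; lra.
Qed.
End variational.

(** * Fourier series of the logarithmic kernel *)

Section trig.
Variable R : realType.
Notation mu := (@lebesgue_measure R).
Implicit Types (r : R).

Notation "'Ipi' f" := (\int[mu]_(x in `[0, pi]) f x) (at level 10).

(** |1 - r e^(i a)|^2. Correspondingly [geo] is the real part of r e^(i a) / (1 - r e^(i a)), the
    limit of [gsum], and - 2 [lsum] tends to [ln (den r a)]. *)
Definition den r (a : R) : R := 1 - 2 * r * cos a + r ^+ 2.

Definition gsum r N (a : R) : R := \sum_(n < N) r ^+ n.+1 * cos (n.+1%:R * a).

Definition lsum r N (a : R) : R := \sum_(n < N) r ^+ n.+1 / n.+1%:R * cos (n.+1%:R * a).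

Definition geo r (a : R) : R := (r * cos a - r ^+ 2) / den r a.

Lemma den_ge r a : (1 - `|r|) ^+ 2 <= den r a.
Proof.
rewrite /den; have : r * cos a <= `|r|.
  by rewrite (le_trans (ler_norm _))// normrM ler_piMr// cos_max.
have -> : (1 - `|r|) ^+ 2 = 1 - 2 * `|r| + r ^+ 2 by rewrite -[r ^+ 2]real_normK ?num_real//; ring.
lra.
Qed.

Lemma den_gt0 r a : `|r| < 1 -> 0 < den r a.
Proof. by move=> r1; apply: lt_le_trans (den_ge r a); rewrite exprn_gt0// subr_gt0. Qed.

(** Both [gsum] divided by [r] and the derivative of [lsum] in [r], so that one closed form serves
    the two series. *)
Definition hsum r N (a : R) : R := \sum_(n < N) r ^+ n * cos (n.+1%:R * a).

(** Multiplication by [den] telescopes the sum, by the recurrence cos ((n + 2) a) = 2 cos a cos ((n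
    + 1) a) - cos (n a). *)
Lemma hsumE r N a : den r a * hsum r N a =
  cos a - r - r ^+ N * cos (N.+1%:R * a) + r ^+ N.+1 * cos (N%:R * a).
Proof.
elim: N => [|N IH].
  by rewrite /hsum big_ord0 mulr0 mul0r cos0 expr1 ?expr0 !mul1r; ring.
rewrite /hsum big_ord_recr /= -/(hsum r N a) mulrDr IH.
have -> : cos (N.+2%:R * a) = 2 * cos a * cos (N.+1%:R * a) - cos (N%:R * a).
  have -> : N.+2%:R * a = N.+1%:R * a + a by rewrite -natr1; ring.
  have -> : N%:R * a = N.+1%:R * a - a by rewrite -natr1; ring.
  by rewrite cosB cosD; ring.
by rewrite /den !exprS; ring.
Qed.

(** Uniform over |r| <= |r0|, as required by the mean value theorem along the segment from 0 to [r0]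
    in [log_bound]. *)
Lemma hsum_tail_bound r r0 N a : `|r| <= `|r0| -> `|r0| < 1 ->
  `|(r ^+ N * cos (N.+1%:R * a) - r ^+ N.+1 * cos (N%:R * a)) / den r a|
  <= 2 / (1 - `|r0|) ^+ 2 * `|r0| ^+ N.
Proof.
move=> rr0 r1; have d0 := den_gt0 a (le_lt_trans rr0 r1).
have b0 : 0 < (1 - `|r0|) ^+ 2 by rewrite exprn_gt0// subr_gt0.
rewrite normrM normfV (gtr0_norm d0) mulrAC ler_pM ?invr_ge0 ?(ltW d0)//; last first.
  rewrite lef_pV2 ?posrE//; apply: le_trans (den_ge r a).
  by rewrite lerXn2r// ?nnegrE ?subr_ge0 ?(ltW r1)// ?lerD2l ?lerN2// (le_trans rr0)// ltW.
have rN k : `|r ^+ (N + k) | <= `|r0| ^+ N.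
  rewrite exprD normrM !normrX.
  have h1 : `|r| ^+ N <= `|r0| ^+ N by rewrite lerXn2r// nnegrE.
  rewrite (le_trans _ h1)// ler_piMr ?exprn_ge0// exprn_ile1// ltW//.
  exact: le_lt_trans r1.
have bnd k x : `|r ^+ (N + k) * cos x| <= `|r0| ^+ N.
  by rewrite normrM (le_trans _ (rN k))// ler_piMr// cos_max.
rewrite (le_trans (ler_normB _ _))// -[X in _ ^+ X.+1]addn0 -addnS.
have := bnd 1%N (N%:R * a); have := bnd 0%N (N.+1%:R * a); rewrite addn0; lra.
Qed.

Lemma gsum_hsum r N a : gsum r N a = r * hsum r N a.
Proof. by rewrite /gsum /hsum mulr_sumr; apply: eq_bigr => n _; rewrite exprS mulrA. Qed.

Lemma geo_bound r N a : `|r| < 1 ->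
  `|geo r a - gsum r N a| <= 2 / (1 - `|r|) ^+ 2 * `|r| ^+ N.
Proof.
move=> r1; have d0 := den_gt0 a r1.
have dn0 : den r a != 0 by rewrite gt_eqF.
have -> : geo r a - gsum r N a = r *
  ((r ^+ N * cos (N.+1%:R * a) - r ^+ N.+1 * cos (N%:R * a)) / den r a).
  rewrite gsum_hsum /geo -[hsum r N a](mulKf dn0) hsumE.
  by field.
rewrite normrM; apply: le_trans (hsum_tail_bound N a (lexx _) r1).
by rewrite ler_piMl// ltW.
Qed.

Lemma is_derive_den r a : is_derive r (1 : R) (fun r => den r a) (- (2 * cos a) + 2 * r).
Proof.
have D := dvD (dvB (dvC 1 r) (dvM (dvZ 2 (dvI r)) (dvC (cos a) r))) (dvX 2 (dvI r)).
apply: (dv_eq D); rewrite /=.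
by rewrite expr1; ring.
Qed.

Lemma is_derive_lsum r N a : is_derive r (1 : R) (fun r => lsum r N a) (hsum r N a).
Proof.
elim: N => [|N IH].
  have -> : (fun r => lsum r 0 a) = fun=> 0 by apply/funext => x; rewrite /lsum big_ord0.
  by rewrite /hsum big_ord0; exact: dvC.
have -> : (fun r => lsum r N.+1 a) = fun r => lsum r N a + r ^+ N.+1 * (cos (N.+1%:R * a) / N.+1%:R).
  by apply/funext => x; rewrite /lsum big_ord_recr/= mulrAC mulrA.
rewrite /hsum big_ord_recr/= -/(hsum r N a); apply: dvD IH _.
apply: (dv_eq (dvM (dvX N.+1 (dvI r)) (dvC _ r))).
have N0 := ler0n R N.
by rewrite /= -natr1; field; lra.
Qed.

(** The expression vanishes at [r = 0], and its derivative in [r] is, up to sign, twice the tail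
    bounded above; hence 4 in place of 2. *)
Lemma log_bound r N a : `|r| < 1 ->
  `|ln (den r a) + 2 * lsum r N a| <= 4 / (1 - `|r|) ^+ 2 * `|r| ^+ N.
Proof.
move=> r1.
pose f x := ln (den x a) + 2 * lsum x N a.
have f0 : f 0 = 0.
  rewrite /f /den mulr0 mul0r subr0 expr0n addr0 ln1 add0r /lsum big1 ?mulr0// => n _.
  by rewrite expr0n !mul0r.
have -> : ln (den r a) + 2 * lsum r N a = f r - f 0 by rewrite f0 subr0.
pose df x := 2 * (- ((x ^+ N * cos (N.+1%:R * a) - x ^+ N.+1 * cos (N%:R * a)) / den x a)).
apply: le_trans (@dv_bound _ f df 0 r (4 / (1 - `|r|) ^+ 2 * `|r| ^+ N) _) _; last first.
  rewrite subr0 ler_piMr ?mulr_ge0 ?exprn_ge0 ?invr_ge0 ?exprn_ge0 ?subr_ge0//; exact: ltW.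
move=> x xr; have xr' : `|x| <= `|r|.
  move: xr; have [r0|r0] := leP 0 r.
    by rewrite ?(min_l r0) ?(max_r r0) => /andP[x0 xr]; rewrite !ger0_norm.
  by move=> /andP[x0 xr]; rewrite !ler0_norm ?lerN2// ltW.
have d0 := den_gt0 a (le_lt_trans xr' r1); split; last first.
  rewrite /df normrM normrN ger0_norm//.
  by have := hsum_tail_bound N a xr' r1; lra.
have D : is_derive x (1 : R) f _ := dvD (@dvln _ (fun y => den y a) x _ d0 (is_derive_den x a)) (dvZ 2 (is_derive_lsum x N a)).
apply: (dv_eq D).
have dn0 : den x a != 0 by rewrite gt_eqF.
by rewrite /df -[hsum x N a](mulKf dn0) hsumE; field.
Qed.

Lemma sin_nat_pi n : sin (n%:R * pi) = 0 :> R.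
Proof.
elim: n => [|n IH]; first by rewrite mul0r sin0.
by rewrite -natr1 mulrDl mul1r sinD IH sinpi mul0r mulr0 addr0.
Qed.

Lemma Rintegral_FTC (F f : R -> R) (a b : R) : a <= b ->
  (forall x, a <= x <= b -> is_derive x (1 : R) F (f x)) -> continuous f ->
  \int[mu]_(x in `[a, b]) f x = F b - F a.
Proof.
move=> ab dF cf; rewrite /Rintegral (_ : integral _ _ _ = (F b - F a)%:E)//.
by apply: integral_FTC => //; exact: continuous_subspaceT.
Qed.

Lemma Rintegral_cst_0pi (M : R) : Ipi (fun=> M) = M * pi.
Proof.
transitivity (M * pi - M * 0); last by rewrite mulr0 subr0.
apply: (@Rintegral_FTC (fun x => M * x) (fun=> M) 0 pi).
- exact: pi_ge0.
- by move=> x _; apply: dv_eq (dvZ M (dvI x)) _; rewrite mulr1.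
- by move=> x; exact: cvg_cst.
Qed.

Lemma integral_cos (m : R) : m != 0 -> sin (m * pi) = 0 -> Ipi (fun x => cos (m * x)) = 0.
Proof.
move=> m0 sm; transitivity (sin (m * pi) / m - sin (m * 0) / m); last first.
  by rewrite sm mulr0 sin0 !mul0r subrr.
apply: (@Rintegral_FTC (fun x => sin (m * x) / m) (fun x => cos (m * x)) 0 pi).
- exact: pi_ge0.
- move=> x _; have D := dvM (dvcomp (is_derive_sin (m * x)) (dvZ m (dvI x))) (dvC m^-1 x).
  by apply: dv_eq D _; field.
- move=> x; exact: dv_continuous (dvcomp (is_derive_cos (m * x)) (dvZ m (dvI x))).
Qed.

(** Stands in for exchanging series and integrals: the Fourier identities below are shown for
    partial sums with a geometric error. *)
Lemma geometric_squeeze (x C rho : R) : `|rho| < 1 -> (forall N, `|x| <= C * `|rho| ^+ N) -> x = 0.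
Proof.
move=> rho1 H; apply/eqP; rewrite -normr_le0.
have c0 : C * `|rho| ^+ N @[N --> \oo] --> C * 0.
  by apply: cvgM; [exact: cvg_cst|apply: cvg_expr; rewrite normr_id].
rewrite -(mulr0 C) -(cvg_lim _ c0)//; apply: limr_ge; first exact: cvgP c0.
by near=> N; exact: H.
Unshelve. all: by end_near. Qed.

Lemma integrable_0pi (f : R -> R) : continuous f -> mu.-integrable `[0, pi] (EFin \o f).
Proof.
move=> cf; apply: continuous_compact_integrable; first exact: segment_compact.
exact: continuous_subspaceT.
Qed.

Lemma continuous_cosM (m : R) : continuous (fun x => cos (m * x)).
Proof. move=> x; exact: dv_continuous (dvcomp (is_derive_cos (m * x)) (dvZ m (dvI x))). Qed.

Lemma continuous_sum N (c : nat -> R) (f : nat -> R -> R) : (forall n, continuous (f n)) ->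
  continuous (fun x => \sum_(n < N) c n * f n x).
Proof.
move=> cf; elim: N => [|N IH] x.
  have -> : (fun x => \sum_(n < 0) c n * f n x) = fun=> 0.
    by apply/funext => y; rewrite big_ord0.
  exact: cvg_cst.
have -> : (fun x => \sum_(n < N.+1) c n * f n x) =
    fun x => \sum_(n < N) c n * f n x + c N * f N x.
  by apply/funext => y; rewrite big_ord_recr.
by apply: cvgD; [exact: IH|apply: cvgM; [exact: cvg_cst|exact: cf]].
Qed.

Lemma integral_sum_0pi N (c : nat -> R) (f : nat -> R -> R) : (forall n, continuous (f n)) ->
  Ipi (fun x => \sum_(n < N) c n * f n x) = \sum_(n < N) c n * Ipi (f n).
Proof.
move=> cf; elim: N => [|N IH].
  by rewrite big_ord0; under eq_Rintegral do rewrite big_ord0; rewrite /Rintegral integral0.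
transitivity (Ipi (fun x => \sum_(n < N) c n * f n x + c N * f N x)).
  by apply: eq_Rintegral => x _; rewrite big_ord_recr.
rewrite big_ord_recr /= -IH -RintegralZl//; last exact: integrable_0pi.
rewrite RintegralD//; apply: integrable_0pi; first exact: continuous_sum.
by move=> x; apply: cvgM; [exact: cvg_cst|exact: cf].
Qed.

Lemma integral_coscos k n :
  Ipi (fun x => cos (k.+1%:R * x) * cos (n.+1%:R * x)) = if k == n then pi / 2 else 0 :> R.
Proof.
pose u : R := k.+1%:R - n.+1%:R; pose v : R := k.+1%:R + n.+1%:R.
have E x : cos (k.+1%:R * x) * cos (n.+1%:R * x) = 2^-1 * (cos (u * x) + cos (v * x)) :> R.
  by rewrite /u /v mulrBl mulrDl cosB cosD; field.
under eq_Rintegral do rewrite E.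
have cu : continuous (fun x => cos (u * x)) by exact: continuous_cosM.
have cv : continuous (fun x => cos (v * x)) by exact: continuous_cosM.
rewrite RintegralZl//; last by apply: integrable_0pi => x; apply: cvgD; [exact: cu|exact: cv].
rewrite RintegralD//; [|exact: integrable_0pi..].
have -> : Ipi (fun x => cos (v * x)) = 0.
  apply: integral_cos; first by rewrite gt_eqF// addr_gt0// ltr0n.
  by rewrite /v mulrDl sinD !sin_nat_pi mul0r mulr0 addr0.
rewrite addr0; case: eqP => [kn|/eqP kn].
  have u0 : u = 0 by rewrite /u kn subrr.
  under eq_Rintegral do rewrite u0 mul0r cos0.
  by rewrite Rintegral_cst_0pi mul1r mulrC.
rewrite integral_cos ?mulr0//.
  by rewrite /u subr_eq0 eqr_nat eqSS.
by rewrite /u mulrBl sinB !sin_nat_pi mul0r mulr0 subrr.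
Qed.

Lemma le_integral_0pi (f : R -> R) (M : R) : continuous f ->
  (forall x, `|f x| <= M) -> `|Ipi f| <= M * pi.
Proof.
move=> cf fM; have fi := integrable_0pi cf.
apply: le_trans (le_normr_Rintegral _ fi) _ => //.
rewrite -Rintegral_cst_0pi.
apply: le_Rintegral => //; first exact: integrable_norm fi.
by apply: integrable_0pi => x; exact: cvg_cst.
Qed.

Lemma continuous_geo r : `|r| < 1 -> continuous (geo r).
Proof.
move=> r1 x; have d0 := den_gt0 x r1; apply: cvgM.
  by apply: cvgB; [apply: cvgM; [exact: cvg_cst|exact: continuous_cos]|exact: cvg_cst].
apply: cvgV; first by rewrite gt_eqF.
apply: cvgD; last exact: cvg_cst.
by apply: cvgB; [exact: cvg_cst|apply: cvgM; [exact: cvg_cst|exact: continuous_cos]].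
Qed.

(** By orthogonality a partial sum of [geo] already has the exact coefficient, and its distance to
    [geo] is geometrically small. *)
Lemma geo_fourier r k : `|r| < 1 ->
  Ipi (fun x => geo r x * cos (k.+1%:R * x)) = pi / 2 * r ^+ k.+1.
Proof.
move=> r1; apply/eqP; rewrite -subr_eq0; apply/eqP.
apply: (@geometric_squeeze _ (2 / (1 - `|r|) ^+ 2 * pi) r r1) => M.
(* Long enough for the partial sum to contain the frequency [k.+1]. *)
pose N := (M + k.+1)%N.
have cg := continuous_geo r1.
have cs (n : nat) : continuous (fun x : R => cos (n.+1%:R * x) * cos (k.+1%:R * x)).
  by move=> x; apply: cvgM; exact: continuous_cosM.
have sE x : gsum r N x * cos (k.+1%:R * x) =
    \sum_(n < N) r ^+ n.+1 * (cos (n.+1%:R * x) * cos (k.+1%:R * x)).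
  by rewrite /gsum mulr_suml; apply: eq_bigr => n _; rewrite mulrA.
have csum : continuous (fun x : R => gsum r N x * cos (k.+1%:R * x)).
  have -> : (fun x => gsum r N x * cos (k.+1%:R * x)) =
      fun x => \sum_(n < N) r ^+ n.+1 * (cos (n.+1%:R * x) * cos (k.+1%:R * x)).
    by apply/funext => y; rewrite sE.
  exact: (@continuous_sum N (fun n => r ^+ n.+1) (fun n x => cos (n.+1%:R * x) * cos (k.+1%:R * x))).
have cgk : continuous (fun x : R => geo r x * cos (k.+1%:R * x)).
  by move=> x; apply: cvgM; [exact: cg|exact: continuous_cosM].
have I2 : Ipi (fun x => gsum r N x * cos (k.+1%:R * x)) = pi / 2 * r ^+ k.+1.
  under eq_Rintegral do rewrite sE.
  rewrite (@integral_sum_0pi N (fun n => r ^+ n.+1) (fun n x => cos (n.+1%:R * x) * cos (k.+1%:R * x)))//.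
  have kN : (k < N)%N by rewrite /N addnS ltnS leq_addl.
  rewrite (bigD1 (Ordinal kN))//= integral_coscos eqxx big1 ?addr0 1?mulrC// => n nk.
  rewrite integral_coscos ifN ?mulr0//.
rewrite -I2 -RintegralB//; [|exact: integrable_0pi..].
have B x : `|geo r x * cos (k.+1%:R * x) - gsum r N x * cos (k.+1%:R * x)|
    <= 2 / (1 - `|r|) ^+ 2 * `|r| ^+ M.
  rewrite -mulrBl normrM.
  apply: le_trans (_ : `|geo r x - gsum r N x| <= _); first by rewrite ler_piMr// cos_max.
  apply: le_trans (geo_bound N x r1) _; rewrite ler_wpM2l ?mulr_ge0 ?invr_ge0 ?sqr_ge0//.
  by rewrite /N exprD ler_piMr ?exprn_ge0// exprn_ile1// ltW.
rewrite mulrAC; apply: le_integral_0pi => // x.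
by apply: cvgB; [exact: cgk|exact: csum].
Qed.

Lemma integral_geo r : `|r| < 1 -> Ipi (geo r) = 0.
Proof.
move=> r1; apply: (@geometric_squeeze _ (2 / (1 - `|r|) ^+ 2 * pi) r r1) => N.
have cg := continuous_geo r1.
have I0 : Ipi (gsum r N) = 0.
  rewrite (@integral_sum_0pi N (fun n => r ^+ n.+1) (fun n x => cos (n.+1%:R * x))); last first.
    by move=> n; exact: continuous_cosM.
  by rewrite big1// => n _; rewrite integral_cos ?mulr0 ?pnatr_eq0 ?sin_nat_pi.
have cs : continuous (gsum r N).
  by apply: (@continuous_sum N (fun n => r ^+ n.+1) (fun n x => cos (n.+1%:R * x))) => n; exact: continuous_cosM.
rewrite -[Ipi (geo r)]subr0 -[X in _ - X]I0 -RintegralB//; [|exact: integrable_0pi..].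
rewrite mulrAC; apply: le_integral_0pi => [x|x]; last exact: geo_bound.
by apply: cvgB; [exact: cg|exact: cs].
Qed.

(** Up to the constant 2 ln (c / z), the logarithm of the squared distance between P + 2 c cos x and
    the complex point P + c (zeta + 1 / zeta), where zeta = z e^(i th). *)
Definition logker z (th x : R) : R := ln (den z (th - x)) + ln (den z (th + x)).

Lemma continuous_logker z th : `|z| < 1 -> continuous (logker z th).
Proof.
move=> z1.
have cd : continuous (fun y => ln (den z y)).
  move=> x; apply: (@dv_continuous _ _ _ _ (@dvln _ (den z) x _ (den_gt0 x z1)
    (dvD (dvB (dvC 1 x) (dvZ (2 * z) (is_derive_cos x))) (dvC (z ^+ 2) x)))).
move=> x; apply: cvgD.
  apply: (@continuous_comp _ _ _ (fun x => th - x) (fun y => ln (den z y))); last exact: cd.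
  by apply: cvgB => //; exact: cvg_cst.
apply: (@continuous_comp _ _ _ (fun x => th + x) (fun y => ln (den z y))); last exact: cd.
by apply: cvgD => //; exact: cvg_cst.
Qed.

(** The addition formula for cosines turns the two logarithmic series into - 4 times the sum of z^n
    / n cos (n th) cos (n x). *)
Lemma logker_approx (G : R -> R) (z th : R) N : continuous G -> `|z| < 1 ->
  `|Ipi (fun x => G x * logker z th x) + 4 * \sum_(n < N)
     z ^+ n.+1 / n.+1%:R * cos (n.+1%:R * th) * Ipi (fun x => G x * cos (n.+1%:R * x))|
  <= 8 / (1 - `|z|) ^+ 2 * Ipi (fun x => `|G x|) * `|z| ^+ N.
Proof.
move=> cG z1; have cL := @continuous_logker z th z1.
pose c n := 4 * (z ^+ n.+1 / n.+1%:R * cos (n.+1%:R * th)).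
have cf n : continuous (fun x : R => G x * cos (n.+1%:R * x)).
  by move=> x; apply: cvgM; [exact: cG|exact: continuous_cosM].
have -> : 4 * \sum_(n < N) z ^+ n.+1 / n.+1%:R * cos (n.+1%:R * th)
      * Ipi (fun x => G x * cos (n.+1%:R * x)) =
    \sum_(n < N) c n * Ipi (fun x => G x * cos (n.+1%:R * x)).
  by rewrite mulr_sumr; apply: eq_bigr => n _; rewrite /c !mulrA.
rewrite -(@integral_sum_0pi N c _ cf).
have c1 : continuous (fun x : R => G x * logker z th x).
  by move=> x; apply: cvgM; [exact: cG|exact: cL].
have c2 : continuous (fun x : R => \sum_(n < N) c n * (G x * cos (n.+1%:R * x))).
  by have := @continuous_sum N c _ cf.
have i1 : mu.-integrable `[0, pi] (EFin \o (fun x => G x * logker z th x)).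
  exact: integrable_0pi.
have i2 : mu.-integrable `[0, pi] (EFin \o (fun x => \sum_(n < N) c n * (G x * cos (n.+1%:R * x)))).
  exact: integrable_0pi.
rewrite -RintegralD//.
have i3 : mu.-integrable `[0, pi] (EFin \o (fun x => G x * logker z th x
    + \sum_(n < N) c n * (G x * cos (n.+1%:R * x)))).
  by apply: integrable_0pi => x; apply: cvgD; [exact: c1|exact: c2].
apply: le_trans (le_normr_Rintegral _ i3) _ => //.
have i4 : mu.-integrable `[0, pi] (EFin \o (fun x => `|G x|)).
  by apply: integrable_0pi => x; apply: cvg_norm; exact: cG.
rewrite mulrAC -RintegralZl//.
apply: le_Rintegral => //; first exact: integrable_norm i3.
  by apply: integrable_0pi => x; apply: cvgM; [exact: cvg_cst|apply: cvg_norm; exact: cG].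
move=> x _.
have -> : G x * logker z th x + \sum_(n < N) c n * (G x * cos (n.+1%:R * x)) =
  ((ln (den z (th - x)) + 2 * lsum z N (th - x)) + (ln (den z (th + x)) + 2 * lsum z N (th + x))) * G x.
  have -> : \sum_(n < N) c n * (G x * cos (n.+1%:R * x)) =
      (2 * lsum z N (th - x) + 2 * lsum z N (th + x)) * G x.
    rewrite /lsum -mulrDr -big_split/= mulr_sumr mulr_suml; apply: eq_bigr => n _.
    by rewrite /c (mulrBr n.+1%:R) (mulrDr n.+1%:R) cosB cosD; ring.
  by rewrite /logker; ring.
rewrite normrM ler_wpM2r//; apply: le_trans (ler_normD _ _) _.
by have := log_bound N (th - x) z1; have := log_bound N (th + x) z1; lra.
Qed.

(** Coefficients proportional to r^n turn the expansion back into a logarithm, with [r * z] for [z].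
    The expansion has no constant term, so the mean of [G] does not enter; this covers [geo r] and,
    with [r = 0], constants. *)
Lemma logker_fourier (G : R -> R) (r z th : R) : continuous G -> `|z| < 1 -> `|r| < 1 ->
  (forall k, Ipi (fun x => G x * cos (k.+1%:R * x)) = pi / 2 * r ^+ k.+1) ->
  Ipi (fun x => G x * logker z th x) = pi * ln (den (r * z) th).
Proof.
move=> cG z1 r1 a; have rz1 : `|r * z| <= `|z| by rewrite normrM ler_piMl// ltW.
apply/eqP; rewrite -subr_eq0; apply/eqP.
apply: (@geometric_squeeze _ (8 / (1 - `|z|) ^+ 2 * Ipi (fun x => `|G x|)
   + pi * (4 / (1 - `|r * z|) ^+ 2)) z z1) => N.
have E : 4 * \sum_(n < N) z ^+ n.+1 / n.+1%:R * cos (n.+1%:R * th)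
    * Ipi (fun x => G x * cos (n.+1%:R * x)) = pi * (2 * lsum (r * z) N th).
  rewrite /lsum !mulr_sumr; apply: eq_bigr => n _; rewrite a exprMn; field.
  by rewrite addrC natr1 pnatr_eq0.
have := logker_approx th N cG z1; rewrite E.
have := log_bound N th (le_lt_trans rz1 z1).
have pN : `|r * z| ^+ N <= `|z| ^+ N by rewrite lerXn2r// nnegrE.
set I := Ipi (fun x => G x * logker z th x); set L := lsum _ _ _; set l := ln _ => h1 h2.
have {}h1 : `|pi * l + pi * (2 * L)| <= pi * (4 / (1 - `|r * z|) ^+ 2) * `|z| ^+ N.
  rewrite -mulrDr normrM (ger0_norm (pi_ge0 R)) -mulrA ler_wpM2l ?pi_ge0//.
  by apply: le_trans h1 _; rewrite ler_wpM2l// mulr_ge0// invr_ge0 sqr_ge0.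
have -> : I - pi * l = (I + pi * (2 * L)) - (pi * l + pi * (2 * L)) by ring.
by apply: le_trans (ler_normB _ _) _; rewrite [leRHS]mulrDl; exact: lerD.
Qed.

Lemma logker_geo (r z th : R) : `|z| < 1 -> `|r| < 1 ->
  Ipi (fun x => geo r x * logker z th x) = pi * ln (den (r * z) th).
Proof.
by move=> z1 r1; apply: logker_fourier => // [|k]; [exact: continuous_geo|exact: geo_fourier].
Qed.

Lemma logker_1 (z th : R) : `|z| < 1 -> Ipi (fun x => logker z th x) = 0.
Proof.
move=> z1; have z0 : `|0 : R| < 1 by rewrite normr0.
transitivity (Ipi (fun x => 1 * logker z th x)).
  by apply: eq_Rintegral => x _; rewrite mul1r.
rewrite (@logker_fourier (fun=> 1) 0)//.
- by rewrite mul0r /den mulr0 mul0r subr0 expr0n addr0 ln1 mulr0.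
- by move=> x; exact: cvg_cst.
move=> k; under eq_Rintegral do rewrite mul1r.
by rewrite integral_cos ?pnatr_eq0 ?sin_nat_pi// expr0n mulr0.
Qed.

(** The cosine has a single nonzero coefficient, so only the first term of the expansion
    survives. *)
Lemma logker_cos (z th : R) : `|z| < 1 ->
  Ipi (fun x => cos x * logker z th x) = - (2 * pi * z * cos th).
Proof.
move=> z1; apply/eqP; rewrite -subr_eq0; apply/eqP.
apply: (@geometric_squeeze _ (8 / (1 - `|z|) ^+ 2 * Ipi (fun x => `|cos x|)) z z1) => N.
have := @logker_approx _ _ th N.+1 (@continuous_cos R) z1.
rewrite big_ord_recl big1 => [|n _]; last first.
  have -> : Ipi (fun x => cos x * cos ((lift ord0 n).+1%:R * x)) =
            Ipi (fun x => cos (0.+1%:R * x) * cos ((bump 0 n).+1%:R * x)).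
    by apply: eq_Rintegral => x _; rewrite mul1r.
  by rewrite integral_coscos mulr0.
have -> : Ipi (fun x => cos x * cos ((@ord0 N).+1%:R * x)) =
          Ipi (fun x => cos (0.+1%:R * x) * cos (0.+1%:R * x)).
  by apply: eq_Rintegral => x _; rewrite mul1r.
rewrite integral_coscos eqxx/= addr0 expr1 mul1r.
set I := Ipi (fun x => cos x * logker z th x); set M := 8 / _ * _ => h.
have -> : I - - (2 * pi * z * cos th) = I + 4 * (z / 1%:R * cos th * (pi / 2)) by field.
apply: le_trans h _; rewrite ler_wpM2l//.
  rewrite /M mulr_ge0 ?mulr_ge0 ?invr_ge0 ?sqr_ge0//.
  by apply: Rintegral_ge0.
by rewrite exprS ler_piMl ?exprn_ge0// ltW.
Qed.

(** Continuity stops short of the left end because for [beta = 1] that end is 0 and the density is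
    unbounded there. The substitution is made on angles in [0, y] with y < pi, then y tends to
    pi. *)
Lemma cos_substitution (P c : R) (h g : R -> R) : 0 < c ->
  mu.-integrable `[P - 2 * c, P + 2 * c] (EFin \o h) ->
  (forall x, P - 2 * c < x <= P + 2 * c -> {for x, continuous h}) ->
  continuous g ->
  (forall y, 0 <= y < pi -> h (P + 2 * c * cos y) * (2 * c * sin y) = g y) ->
  \int[mu]_(x in `[P - 2 * c, P + 2 * c]) h x = Ipi g.
Proof.
move=> c0 ih ch cg hg.
pose F y := P + 2 * c * cos y.
have dF y : is_derive y (1 : R) F (- (2 * c * sin y)).
  by apply: dv_eq (dvD (dvC P y) (dvZ (2 * c) (is_derive_cos y))) _; rewrite add0r mulrN.
have F'E : derive1 F = fun y => - (2 * c * sin y).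
  by apply/funext => y; rewrite derive1E; have [_ ->] := dF y.
have cF : continuous F by move=> y; exact: dv_continuous (dF y).
have cF' : continuous (fun y : R => - (2 * c * sin y)).
  by move=> y; apply: cvgN; apply: cvgM; [exact: cvg_cst|exact: continuous_sin].
have Fpi : F pi = P - 2 * c by rewrite /F cospi mulrN1.
have F0 : F 0 = P + 2 * c by rewrite /F cos0 mulr1.
have Frange y : P - 2 * c <= F y <= P + 2 * c.
  have := cos_geN1 y; have := cos_le1 y => c1 c2; rewrite /F.
  have : 2 * c * cos y <= 2 * c * 1 by rewrite ler_pM2l ?mulr_gt0.
  have : 2 * c * -1 <= 2 * c * cos y by rewrite ler_pM2l ?mulr_gt0.
  by move=> ? ?; apply/andP; split; lra.
have Fdec : {in `[0, pi] &, {homo F : x y /~ x < y}}.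
  move=> x y xpi ypi xy; rewrite /F ltrD2l ltr_pM2l ?mulr_gt0//.
  by rewrite ltr_cos.
have ab : P - 2 * c < P + 2 * c by lra.
pose int a y (f : R -> R) := \int[mu]_(x in `[a, y]) f x.
have key y : 0 < y < pi ->
    int (P - 2 * c) (P + 2 * c) h - int (P - 2 * c) (F y) h = int 0 y g.
  move=> /andP[y0 ypi].
  have sub : {subset `[0, y] <= `[0, pi]}.
    by move=> x; rewrite !in_itv/= => /andP[-> /le_trans->]//; exact: ltW.
  have Fy : P - 2 * c < F y.
    by rewrite -Fpi; apply: Fdec; rewrite ?in_itv/= ?pi_ge0 ?lexx ?(ltW y0) ?(ltW ypi).
  have := Frange y => /andP[_ Fyb].
  have Fsub : `[F y, P + 2 * c] `<=` `[P - 2 * c, P + 2 * c].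
    by move=> x; rewrite /= !in_itv/= => /andP[/(le_trans (ltW Fy)) -> ->].
  rewrite /int (Rintegral_itvB ih) ?bnd_simp ?(ltW Fy)//.
  rewrite Rintegral_itv_obnd_cbnd; last first.
    by apply: integrableS ih => // x /=; rewrite !in_itv/= => /andP[/ltW/(le_trans (ltW Fy)) -> ->].
  rewrite -F0 /Rintegral; congr fine.
  rewrite (@integration_by_substitution_decreasing _ F h 0 y (ltW y0)).
  - apply: eq_integral => x; rewrite inE/= in_itv/= => /andP[x0 xy].
    rewrite /= F'E/= opprK; congr EFin; apply: hg.
    by rewrite x0 (le_lt_trans xy).
  - by move=> u v /sub ui /sub vi; exact: Fdec.
  - by rewrite F'E => x _; exact: cF'.
  - by rewrite F'E; apply/cvg_ex; exists (- (2 * c * sin 0)); apply: cvg_at_right_filter; exact: cF'.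
  - by rewrite F'E; apply/cvg_ex; exists (- (2 * c * sin y)); apply: cvg_at_left_filter; exact: cF'.
  - split.
    + by move=> x _; have [] := dF x.
    + by apply: cvg_at_right_filter; exact: cF.
    + by apply: cvg_at_left_filter; exact: cF.
  - apply: continuous_in_subspaceT => x; rewrite inE/= in_itv/= F0 => /andP[h1 h2].
    by apply: ch; rewrite (lt_le_trans Fy h1).
have lim1 : int 0 y g @[y --> pi^'-] --> int 0 pi g.
  exact: (@parameterized_integral_cvg_at_left _ 0 pi g (pi_gt0 R) (integrable_0pi cg)).
have lim2 : int (P - 2 * c) (P + 2 * c) h - int (P - 2 * c) (F y) h @[y --> pi^'-]
    --> int (P - 2 * c) (P + 2 * c) h - 0.
  apply: cvgB; first exact: cvg_cst.
  have Fl : F y @[y --> pi^'-] --> P - 2 * c.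
    by rewrite -Fpi; apply: cvg_at_left_filter; exact: cF.
  have L := @parameterized_integral_cvg_left _ _ _ h ab ih.
  exact: (cvg_comp _ _ Fl L).
have lim2' : int 0 y g @[y --> pi^'-] --> int (P - 2 * c) (P + 2 * c) h - 0.
  apply: cvg_trans lim2; apply: near_eq_cvg; near=> y; apply: key.
  by apply/andP; split; near: y; [exact: nbhs_left_gt (pi_gt0 R)|exact: nbhs_left_lt].
rewrite -[LHS]subr0; exact: (cvg_unique _ lim2' lim1).
Unshelve. all: by end_near. Qed.
End trig.

(** * Tameness on the line implies tameness on the half-line *)

Section tame_line.
Variable R : realType.
Notation mu := (@lebesgue_measure R).

Lemma tame_line_tame (p : R -> R) : tame_line p -> tame p.
Proof.
have mD := @measurable_halfline R.
have sub f : mu.-integrable setT f -> mu.-integrable (halfline R) f.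
  by move=> h; apply: integrableS h.
move=> tp; have mp := measurable_funTS (measurable_tame_line tp) : measurable_fun (halfline R) p.
case: tp => [ip ixp [eps eps0 iep]]; split; first exact: sub.
  have /integrableP[_ h] := sub _ ixp; apply: le_lt_trans h; apply: ge0_le_integral => //.
  - by move=> x x0; rewrite lee_fin mulr_ge0.
  - by apply/measurable_EFinP; apply: measurable_funM => //; exact: measurableT_comp.
  - by apply: measurableT_comp => //; apply/measurable_EFinP/measurable_funM => //; exact: measurableT_comp.
  - by move=> x x0; rewrite /= lee_fin normrM normr_id ler_wpM2r// ler_norm.
exists eps => //; have /integrableP[_ h] := sub _ iep; apply: le_lt_trans h; apply: ge0_le_integral => //.
- by apply/measurable_EFinP; apply: (measurableT_comp (measurable_powR _)); exact: measurableT_comp.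
- apply: measurableT_comp => //; apply/measurable_EFinP; apply: (measurableT_comp (measurable_powR _)).
  exact: measurableT_comp.
- by move=> x x0; rewrite /= lee_fin ler_norm.
Qed.
End tame_line.

(** * The explicit equilibrium density *)

Section equilibrium.
Variable R : realType.
Notation mu := (@lebesgue_measure R).
Variables (beta rho kappa delta P w t : R).
Hypotheses (beta1 : 1 <= beta) (rho0 : 0 < rho) (kappa0 : 0 < kappa) (w0 : 0 < w).
(** [kd] and [tE] are the residue conditions at 0 and - 1 / rho, [Pw] is total mass 1, [w2]
    evaluates (1 + rho a) (1 + rho b) from a + b = 2 P and a b = delta^2, and [dP] is a < b. *)
Hypothesis kd : kappa * delta = beta - 1.
Hypothesis w2 : w ^+ 2 = 1 + 2 * rho * P + rho ^+ 2 * delta ^+ 2.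
Hypothesis Pw : 2 * rho - rho * P + rho * delta = (1 - kappa) * (1 + rho * delta - w).
Hypothesis tE : rho * t = (1 - kappa) * w.
Hypothesis dP : delta < P.

(* [A2], [B2], [C2], [D2] are the squares of the Joukowski parameters in
   [x = |A + B e^(i phi)|^2] and [1 + rho x = |C + D e^(i phi)|^2]. *)
Let A2 : R := (P + delta) / 2.
Let B2 : R := (P - delta) / 2.
Let C2 : R := (1 + rho * P + w) / 2.
Let D2 : R := (1 + rho * P - w) / 2.
Let c : R := Num.sqrt (P ^+ 2 - delta ^+ 2) / 2.
Let q : R := c / A2.
Let s : R := rho * c / C2.

Lemma eq_delta_ge0 : 0 <= delta.
Proof. by rewrite -(pmulr_rge0 _ kappa0) kd subr_ge0. Qed.

Lemma eq_P_gt0 : 0 < P.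
Proof. exact: le_lt_trans eq_delta_ge0 dP. Qed.

Lemma eq_c_gt0 : 0 < c.
Proof.
rewrite divr_gt0// sqrtr_gt0 subr_gt0 ltr_pXn2r// nnegrE ?eq_delta_ge0//.
exact/ltW/eq_P_gt0.
Qed.

Lemma eq_c2 : 4 * c ^+ 2 = P ^+ 2 - delta ^+ 2.
Proof.
have h : 0 <= P ^+ 2 - delta ^+ 2.
  by rewrite subr_ge0 ler_pXn2r// ?nnegrE ?eq_delta_ge0// ?ltW// eq_P_gt0.
by rewrite /c expr_div_n sqr_sqrtr//; field.
Qed.

Lemma eq_A_gt0 : 0 < A2.
Proof. by rewrite divr_gt0// ltr_wpDr// ?eq_delta_ge0// eq_P_gt0. Qed.

Lemma eq_C_gt0 : 0 < C2.
Proof. by rewrite divr_gt0// !addr_gt0// mulr_gt0// eq_P_gt0. Qed.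

Lemma eq_AB : A2 * B2 = c ^+ 2.
Proof. by have := eq_c2; rewrite /A2 /B2; lra. Qed.

Lemma eq_CD : C2 * D2 = (rho * c) ^+ 2.
Proof.
have h : C2 * D2 = ((1 + rho * P) ^+ 2 - w ^+ 2) / 4 by rewrite /C2 /D2; field.
have h' : (rho * c) ^+ 2 = rho ^+ 2 * (P ^+ 2 - delta ^+ 2) / 4 by rewrite -eq_c2; field.
by rewrite h h' w2; field.
Qed.

Lemma eq_q2 : q ^+ 2 = B2 / A2.
Proof. by rewrite /q expr_div_n -eq_AB; field; rewrite gt_eqF// eq_A_gt0. Qed.

Lemma eq_s2 : s ^+ 2 = D2 / C2.
Proof. by rewrite /s expr_div_n -eq_CD; field; rewrite gt_eqF// eq_C_gt0. Qed.

Lemma eq_q_gt0 : 0 < q. Proof. by apply: divr_gt0; [exact: eq_c_gt0|exact: eq_A_gt0]. Qed.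

Lemma eq_s_gt0 : 0 < s.
Proof. by apply: divr_gt0; [apply: mulr_gt0 => //; exact: eq_c_gt0|exact: eq_C_gt0]. Qed.

Lemma eq_s_lt1 : s < 1.
Proof.
rewrite -(@ltr_pXn2r _ 2)// ?nnegrE ?(ltW eq_s_gt0)//.
by rewrite eq_s2 expr1n ltr_pdivrMr ?eq_C_gt0// mul1r /C2 /D2; have := w0; lra.
Qed.

Lemma eq_q_le1 : q <= 1.
Proof.
rewrite -(@ler_pXn2r _ 2)// ?nnegrE ?(ltW eq_q_gt0)//.
rewrite eq_q2 expr1n ler_pdivrMr ?eq_A_gt0// mul1r /A2 /B2.
by have := eq_delta_ge0; lra.
Qed.

Lemma eq_q_lt1 : delta != 0 -> q < 1.
Proof.
move=> dn0; have d0 : 0 < delta by rewrite lt_neqAle eq_sym dn0 eq_delta_ge0.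
rewrite -(@ltr_pXn2r _ 2)// ?nnegrE ?(ltW eq_q_gt0)//.
by rewrite eq_q2 expr1n ltr_pdivrMr ?eq_A_gt0// mul1r /A2 /B2; move: d0; lra.
Qed.

(* When [beta = 1] the term in [q] (then equal to 1) has coefficient 0. *)
Let q0 : R := if delta == 0 then 0 else q.

Lemma eq_q0_lt1 : `|q0| < 1.
Proof.
rewrite /q0; case: eqP => [_|/eqP dn0]; first by rewrite normr0.
by rewrite gtr0_norm ?eq_q_lt1// eq_q_gt0.
Qed.

Lemma eq_beta_q0 (h : R -> R) : (beta - 1) * h q0 = (beta - 1) * h q.
Proof.
rewrite /q0; case: eqP => // d0.
by have := kd; rewrite d0 mulr0 => <-; rewrite !mul0r.
Qed.

(** At Y = cos a the right-hand side is A2 |1 + q e^(i a)|^2, the form in which [ln x] has a known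
    Fourier series. *)
Lemma eq_xE Y : P + 2 * c * Y = A2 * (1 + 2 * q * Y + q ^+ 2).
Proof.
rewrite eq_q2 /q; have := eq_A_gt0 => a0.
have -> : A2 * (1 + 2 * (c / A2) * Y + B2 / A2) = A2 + B2 + 2 * c * Y.
  by field; rewrite gt_eqF.
by rewrite /A2 /B2; field.
Qed.

Lemma eq_1xE Y : 1 + rho * (P + 2 * c * Y) = C2 * (1 + 2 * s * Y + s ^+ 2).
Proof.
rewrite eq_s2 /s; have := eq_C_gt0 => a0.
have -> : C2 * (1 + 2 * (rho * c / C2) * Y + D2 / C2) = C2 + D2 + 2 * rho * c * Y.
  by field; rewrite gt_eqF.
by rewrite /C2 /D2; field.
Qed.

Lemma eq_density_identity x : x != 0 -> 1 + rho * x != 0 ->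
  1 - (x - P) / 2 + (beta - 1) * (x - delta) / (2 * x) + t * (1 + rho * x - w) / (2 * (1 + rho * x))
  = (2 * P * x - x ^+ 2 - delta ^+ 2) * (kappa + rho * x) / (2 * x * (1 + rho * x)).
Proof.
move=> x0 x1; apply/eqP; rewrite -subr_eq0 -kd.
have -> : t = (1 - kappa) * w / rho by rewrite -tE; field; rewrite gt_eqF.
(* The two sides differ by a combination of the mass condition and of the equation for [w]. *)
pose pd := 2 * rho - rho * P + rho * delta - (1 - kappa) * (1 + rho * delta - w).
pose wd := w ^+ 2 - (1 + 2 * rho * P + rho ^+ 2 * delta ^+ 2).
have pd0 : pd = 0 by rewrite /pd Pw subrr.
have wd0 : wd = 0 by rewrite /wd w2 subrr.
rewrite [X in X == 0](_ : _ = (pd / rho - (1 - kappa) * wd / (rho * (1 + rho * x))) / 2).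
  by rewrite pd0 wd0 mulr0 !mul0r subrr mul0r.
by rewrite /pd /wd; field; rewrite x0 x1 gt_eqF.
Qed.

(** [Num.sqrt] vanishes on negative numbers, which confines the density to the support; at 0 the
    value is 0 because division by 0 yields 0. *)
Definition eq_density x : R :=
  Num.sqrt (2 * P * x - x ^+ 2 - delta ^+ 2) * (kappa + rho * x) / (2 * pi * x * (1 + rho * x)).

(** [pi] times the density times the Jacobian 2 c sin a of x = P + 2 c cos a, decomposed into
    functions whose cosine coefficients are known. *)
Let g (a : R) : R := 1 - c * cos a - (beta - 1) * geo (- q0) a - t * geo (- s) a.

Lemma eq_Aq : A2 * q = c.
Proof. by rewrite /q; field; rewrite gt_eqF// eq_A_gt0. Qed.

Lemma eq_Aq2 : A2 * q ^+ 2 = B2.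
Proof. by rewrite eq_q2; field; rewrite gt_eqF// eq_A_gt0. Qed.

Lemma eq_Cs : C2 * s = rho * c.
Proof. by rewrite /s; field; rewrite gt_eqF// eq_C_gt0. Qed.

Lemma eq_Cs2 : C2 * s ^+ 2 = D2.
Proof. by rewrite eq_s2; field; rewrite gt_eqF// eq_C_gt0. Qed.

Lemma abs_s : `|s| < 1.
Proof. by rewrite gtr0_norm ?eq_s_lt1// eq_s_gt0. Qed.

Lemma geoN (r a : R) : - geo (- r) a = (r * cos a + r ^+ 2) / (1 + 2 * r * cos a + r ^+ 2).
Proof. by rewrite /geo /den -mulNr; congr (_ / _); ring. Qed.

Lemma eq_support a : P - 2 * c <= P + 2 * c * cos a <= P + 2 * c.
Proof.
have := cos_geN1 a; have := cos_le1 a => c1 c2; have c0 := eq_c_gt0.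
have cc : 0 < 2 * c by rewrite mulr_gt0.
have h1 : 2 * c * cos a <= 2 * c * 1 by rewrite ler_pM2l.
have h2 : 2 * c * -1 <= 2 * c * cos a by rewrite ler_pM2l.
by apply/andP; split; lra.
Qed.

Lemma eq_left_ge0 : 0 <= P - 2 * c.
Proof.
rewrite subr_ge0 -(@ler_pXn2r _ 2)//; last 2 first.
- by rewrite nnegrE mulr_ge0// ltW// eq_c_gt0.
- by rewrite nnegrE ltW// eq_P_gt0.
have -> : (2 * c) ^+ 2 = 4 * c ^+ 2 by ring.
by rewrite eq_c2 gerBl sqr_ge0.
Qed.

Lemma eq_radicand x : 2 * P * x - x ^+ 2 - delta ^+ 2 = 4 * c ^+ 2 - (x - P) ^+ 2.
Proof. by rewrite eq_c2; ring. Qed.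

Lemma eq_gE a : 0 < P + 2 * c * cos a -> let x := P + 2 * c * cos a in
  g a = (2 * P * x - x ^+ 2 - delta ^+ 2) * (kappa + rho * x) / (2 * x * (1 + rho * x)).
Proof.
move=> x0 x; have x1 : 0 < 1 + rho * x by rewrite addr_gt0// mulr_gt0.
rewrite -eq_density_identity ?gt_eqF//.
have -> : g a = 1 - c * cos a + (beta - 1) * (- geo (- q0) a) + t * (- geo (- s) a) by rewrite /g; ring.
rewrite (eq_beta_q0 (fun r => - geo (- r) a)) !geoN.
have dx : 0 < 1 + 2 * q * cos a + q ^+ 2.
  by move: x0; rewrite eq_xE pmulr_rgt0// eq_A_gt0.
have d1 : 0 < 1 + 2 * s * cos a + s ^+ 2.
  by move: x1; rewrite /x eq_1xE pmulr_rgt0// eq_C_gt0.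
have a0 := eq_A_gt0; have c0 := eq_C_gt0.
have -> : (q * cos a + q ^+ 2) / (1 + 2 * q * cos a + q ^+ 2) = (x - delta) / (2 * x).
  have n1 : 1 + 2 * q * cos a + q ^+ 2 != 0 by rewrite gt_eqF.
  have n2 : 2 * x != 0 by rewrite gt_eqF// mulr_gt0.
  apply/eqP; rewrite (eqr_div _ _ n1 n2); apply/eqP.
  have xE : x = A2 * (1 + 2 * q * cos a + q ^+ 2) := eq_xE _.
  rewrite [in LHS]xE.
  have -> : x - delta = 2 * (A2 * (q * cos a + q ^+ 2)).
    by rewrite (mulrDr A2) eq_Aq2 (mulrA A2) eq_Aq /x /B2; field.
  ring.
have -> : (s * cos a + s ^+ 2) / (1 + 2 * s * cos a + s ^+ 2) = (1 + rho * x - w) / (2 * (1 + rho * x)).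
  have n1 : 1 + 2 * s * cos a + s ^+ 2 != 0 by rewrite gt_eqF.
  have n2 : 2 * (1 + rho * x) != 0 by rewrite gt_eqF// mulr_gt0.
  apply/eqP; rewrite (eqr_div _ _ n1 n2); apply/eqP.
  have xE : 1 + rho * x = C2 * (1 + 2 * s * cos a + s ^+ 2) := eq_1xE _.
  rewrite [in LHS]xE.
  have -> : 1 + rho * x - w = 2 * (C2 * (s * cos a + s ^+ 2)).
    by rewrite (mulrDr C2) eq_Cs2 (mulrA C2) eq_Cs /x /D2; field.
  ring.
by rewrite /x; field; rewrite ?gt_eqF.
Qed.

Lemma eq_density_out x : ~~ (P - 2 * c <= x <= P + 2 * c) -> eq_density x = 0.
Proof.
move=> xout; rewrite /eq_density ler0_sqrtr ?mul0r// eq_radicand subr_le0.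
have -> : 4 * c ^+ 2 = (2 * c) ^+ 2 by ring.
have c0 : 0 <= 2 * c by rewrite mulr_ge0// ltW// eq_c_gt0.
rewrite -[leRHS]real_normK ?num_real// ler_pXn2r ?nnegrE// ltW//.
by rewrite ltNge ler_distl.
Qed.

Lemma eq_density0 : eq_density 0 = 0.
Proof. by rewrite /eq_density (mulr0 (2 * pi)) mul0r invr0 mulr0. Qed.

Lemma eq_density_neg x : x <= 0 -> eq_density x = 0.
Proof.
rewrite le_eqVlt => /predU1P[->|x0]; first exact: eq_density0.
by apply: eq_density_out; rewrite negb_and -ltNge (lt_le_trans x0 eq_left_ge0).
Qed.

Lemma eq_density_ge0 x : 0 <= eq_density x.
Proof.
have [x0|x0] := leP x 0; first by rewrite eq_density_neg.
rewrite divr_ge0//; first by rewrite mulr_ge0 ?sqrtr_ge0// addr_ge0 ?mulr_ge0// ltW.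
by rewrite !mulr_ge0 ?pi_ge0 ?(ltW x0)// addr_ge0// mulr_ge0// ltW.
Qed.

Lemma measurable_eq_density : measurable_fun setT eq_density.
Proof.
apply: measurable_funM; last first.
  apply: measurable_funV; apply: measurable_funM; first by apply: measurable_funM.
  by apply: measurable_funD => //; apply: measurable_funM.
apply: measurable_funM; last by apply: measurable_funD => //; apply: measurable_funM.
apply: (measurableT_comp (continuous_measurable_fun (@sqrt_continuous R))).
apply: measurable_funB => //; apply: measurable_funB; first exact: measurable_funM.
exact: measurable_funX.
Qed.

(** One bound for all [beta]: the radicand is at most 2 P x. The order x^(-1/2) is reached for
    [beta = 1], when the support begins at 0. *)
Lemma eq_density_bound : exists2 K, 0 <= K & forall x, 0 < x -> eq_density x <= K * x `^ (- 2^-1).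
Proof.
exists ((kappa + 1) * Num.sqrt (2 * P) / (2 * pi)).
  rewrite !mulr_ge0 ?invr_ge0 ?sqrtr_ge0 ?mulr_ge0 ?pi_ge0// addr_ge0// ltW//.
move=> x x0; have pi0 := pi_gt0 R.
have x1 : 0 < 1 + rho * x by rewrite addr_gt0// mulr_gt0.
have sx : 0 < Num.sqrt x by rewrite sqrtr_gt0.
have h1 : Num.sqrt (2 * P * x - x ^+ 2 - delta ^+ 2) <= Num.sqrt (2 * P) * Num.sqrt x.
  rewrite -sqrtrM; last by rewrite mulr_ge0// ltW// eq_P_gt0.
  by apply: ler_wsqrtr; have := sqr_ge0 x; have := sqr_ge0 delta; lra.
have h2 : (kappa + rho * x) / (1 + rho * x) <= kappa + 1.
  rewrite ler_pdivrMr//; have := mulr_gt0 rho0 x0 => ?.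
  by have := mulr_gt0 kappa0 (mulr_gt0 rho0 x0); have := kappa0; lra.
rewrite powRN powR12_sqrt ?(ltW x0)//.
have -> : eq_density x = Num.sqrt (2 * P * x - x ^+ 2 - delta ^+ 2) * ((kappa + rho * x) / (1 + rho * x))
    / (2 * pi) / (Num.sqrt x * Num.sqrt x).
  rewrite /eq_density -expr2 sqr_sqrtr ?(ltW x0)//; move: (@pi R) pi0 => p p0.
  by field; rewrite !gt_eqF.
have -> : (kappa + 1) * Num.sqrt (2 * P) / (2 * pi) / Num.sqrt x =
   (Num.sqrt (2 * P) * Num.sqrt x) * (kappa + 1) / (2 * pi) / (Num.sqrt x * Num.sqrt x).
  by move: (@pi R) pi0 => p p0; field; rewrite !gt_eqF.
rewrite !ler_pM2r ?invr_gt0 ?mulr_gt0// ler_pM ?sqrtr_ge0//.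
by rewrite divr_ge0 ?(ltW x1)// addr_ge0 ?mulr_ge0// ltW.
Qed.

Lemma eq_density_powR_integrable :
  mu.-integrable setT (EFin \o (fun x => `|eq_density x| `^ (1 + 2^-1))).
Proof.
have [K K0 hK] := eq_density_bound.
have c0 := eq_c_gt0; pose b := P + 2 * c + 1.
have b0 : 0 < b by have := eq_P_gt0; rewrite /b; move: c0; lra.
have i1 : mu.-integrable setT ((EFin \o (fun x => x `^ (- (3 / 4)))) \_ `]0, b[).
  exact: ((@integrable_mkcond _ _ R mu _ _ (measurable_itv _)).1 (integrable_powR34 b0)).
apply: le_integrable (integrableZl measurableT (K `^ (1 + 2^-1)) i1) => //.
  apply/measurable_EFinP; apply: (measurableT_comp (measurable_powR _)).
  by apply: measurableT_comp => //; exact: measurable_eq_density.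
move=> x _; rewrite patchE; case: ifPn => [|xn].
  rewrite mem_setE in_itv/= => /andP[x0 _]; rewrite /= lee_fin.
  rewrite (ger0_norm (powR_ge0 _ _)) (ger0_norm (eq_density_ge0 x)).
  rewrite ger0_norm ?mulr_ge0 ?powR_ge0//.
  have -> : - (3 / 4) = - 2^-1 * (1 + 2^-1) :> R by field.
  rewrite powRrM -powRM ?powR_ge0//.
  apply: ge0_ler_powR; rewrite ?nnegrE; [lra|exact: eq_density_ge0| |exact: hK].
  by rewrite mulr_ge0 ?powR_ge0.
rewrite mule0 /= lee_fin.
suff -> : eq_density x = 0 by rewrite normr0 powR0 ?normr0//; lra.
move: xn; rewrite mem_setE in_itv/= negb_and -!leNgt => /orP[|bx].
  exact: eq_density_neg.
by apply: eq_density_out; rewrite negb_and -!ltNge; apply/orP; right; move: bx; rewrite /b; lra.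
Qed.

Lemma eq_density_integrable : mu.-integrable setT (EFin \o eq_density).
Proof.
have i1 : mu.-integrable setT (EFin \o \1_[set` `[P - 2 * c, P + 2 * c] ]) by exact: integrable_indic_itv.
have i2 := integrableD measurableT i1 eq_density_powR_integrable.
apply: le_integrable i2 => //; first by apply/measurable_EFinP; exact: measurable_eq_density.
move=> x _; rewrite /= lee_fin indicE mem_setE in_itv/= (ger0_norm (eq_density_ge0 x)).
rewrite [leRHS]ger0_norm ?addr_ge0 ?powR_ge0//.
have [xin|xout] := boolP (P - 2 * c <= x <= P + 2 * c); last first.
  by rewrite eq_density_out// add0r powR_ge0.
rewrite /=; have [d1|d1] := leP (eq_density x) 1.
  by rewrite (le_trans d1)// lerDl powR_ge0.
rewrite (le_trans (le1r_powR (ltW d1) (_ : 1 <= 1 + 2^-1)))// ?lerDr//.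
by rewrite lerDl.
Qed.

Lemma eq_density_mul_integrable (f : R -> R) (M : R) : measurable_fun setT f ->
  (forall x, P - 2 * c <= x <= P + 2 * c -> `|f x| <= M) ->
  mu.-integrable setT (EFin \o (fun x => eq_density x * f x)).
Proof.
move=> mf fM; apply: le_integrable (integrableZl measurableT M eq_density_integrable) => //.
  by apply/measurable_EFinP; apply: measurable_funM => //; exact: measurable_eq_density.
move=> x _; rewrite /= lee_fin (normrM (eq_density x)) (normrM M).
have [xin|xout] := boolP (P - 2 * c <= x <= P + 2 * c); last first.
  by rewrite eq_density_out// normr0 mul0r mulr0.
rewrite mulrC ler_wpM2r//; apply: le_trans (fM x xin) (ler_norm M).
Qed.

Lemma eq_density_tame : tame_line eq_density.
Proof.
split; first exact: eq_density_integrable.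
- have bnd x : P - 2 * c <= x <= P + 2 * c -> `| `|x| | <= P + 2 * c.
    by move=> /andP[ax xb]; rewrite normr_id ger0_norm//; exact: le_trans eq_left_ge0 ax.
  have := eq_density_mul_integrable (@normr_measurable R setT) bnd.
  by apply: eq_integrable => // x _; rewrite /= mulrC.
- by exists 2^-1; [rewrite invr_gt0|exact: eq_density_powR_integrable].
Qed.

Lemma continuous_eq_g : continuous g.
Proof.
have cq : continuous (geo (- q0)) by apply: continuous_geo; rewrite normrN eq_q0_lt1.
have cs : continuous (geo (- s)) by apply: continuous_geo; rewrite normrN abs_s.
move=> x; apply: cvgB; last by apply: cvgM; [exact: cvg_cst|exact: cs].
apply: cvgB; last by apply: cvgM; [exact: cvg_cst|exact: cq].
by apply: cvgB; [exact: cvg_cst|apply: cvgM; [exact: cvg_cst|exact: continuous_cos]].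
Qed.

Lemma continuous_eq_density x : 0 < x -> {for x, continuous eq_density}.
Proof.
move=> x0; have x1 : 0 < 1 + rho * x by rewrite addr_gt0// mulr_gt0.
have cid : (fun y : R => y) @ x --> x by [].
have clin (k : R) : k * y @[y --> x] --> k * x by apply: cvgM => //; exact: cvg_cst.
apply: cvgM.
  apply: cvgM; last by apply: cvgD; [exact: cvg_cst|exact: clin].
  apply: (@continuous_comp _ _ _ (fun y => 2 * P * y - y ^+ 2 - delta ^+ 2) Num.sqrt); last exact: sqrt_continuous.
  apply: cvgB; last exact: cvg_cst.
  by apply: cvgB; [exact: clin|exact: exprn_continuous].
apply: cvgV.
  by rewrite gt_eqF// mulr_gt0// mulr_gt0// mulr_gt0// pi_gt0.
by apply: cvgM; [exact: clin|apply: cvgD; [exact: cvg_cst|exact: clin]].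
Qed.

Lemma eq_support_gt a : 0 <= a < pi -> P - 2 * c < P + 2 * c * cos a.
Proof.
move=> /andP[a0 api]; have c0 := eq_c_gt0.
have : cos pi < cos a by rewrite ltr_cos ?in_itv/= ?pi_ge0 ?lexx ?a0 ?(ltW api).
rewrite cospi => h; have : 2 * c * -1 < 2 * c * cos a by rewrite ltr_pM2l// mulr_gt0.
by lra.
Qed.

Lemma eq_density_subst (f : R -> R) : measurable_fun setT f ->
  (forall x, P - 2 * c <= x <= P + 2 * c -> {for x, continuous f}) ->
  mu.-integrable setT (EFin \o (fun x => eq_density x * f x)) /\
  \int[mu]_x (eq_density x * f x) =
    pi^-1 * \int[mu]_(a in `[0, pi]) (g a * f (P + 2 * c * cos a)).
Proof.
move=> mf cf; have c0 := eq_c_gt0.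
have ab : P - 2 * c <= P + 2 * c by lra.
have int : mu.-integrable setT (EFin \o (fun x => eq_density x * f x)).
  have cnf : {within `[P - 2 * c, P + 2 * c], continuous (fun x => `|f x|)}.
    by apply: continuous_in_subspaceT => x; rewrite inE/= in_itv/= => /cf h; exact: cvg_norm.
  have [x0 _ hx0] := EVT_max ab cnf.
  by apply: (@eq_density_mul_integrable f `|f x0|) => // x xin; apply: hx0; rewrite in_itv.
split=> //.
have cF : continuous (fun a : R => f (P + 2 * c * cos a)).
  move=> a; apply: (@continuous_comp _ _ _ (fun a : R => P + 2 * c * cos a) f); last exact/cf/eq_support.
  by apply: cvgD; [exact: cvg_cst|apply: cvgM; [exact: cvg_cst|exact: continuous_cos]].
have cgF : continuous (fun a : R => g a * f (P + 2 * c * cos a)).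
  by move=> a; apply: cvgM; [exact: continuous_eq_g|exact: cF].
rewrite -RintegralZl//; last exact: integrable_0pi.
rewrite -(@cos_substitution R P c (fun x => eq_density x * f x)
  (fun a => pi^-1 * (g a * f (P + 2 * c * cos a)))) //.
- rewrite [RHS]Rintegral_mkcond; apply: eq_Rintegral => x _; rewrite patchE mem_setE in_itv/=.
  by case: ifPn => // h; rewrite eq_density_out// mul0r.
- by apply: integrableS int.
- move=> x /andP[ax xb]; apply: cvgM; last by apply: cf; rewrite (ltW ax).
  by apply: continuous_eq_density; exact: le_lt_trans eq_left_ge0 ax.
- by move=> a; apply: cvgM; [exact: cvg_cst|exact: cgF].
move=> a aint; have x0 := le_lt_trans eq_left_ge0 (eq_support_gt aint).
have /andP[a0 api] := aint.
have sa : 0 <= sin a by rewrite sin_ge0_pi// a0 ltW.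
have x1 : 0 < 1 + rho * (P + 2 * c * cos a) by rewrite addr_gt0// mulr_gt0.
rewrite (eq_gE x0) /eq_density.
set x := P + 2 * c * cos a in x0 x1 *.
have rE : 2 * P * x - x ^+ 2 - delta ^+ 2 = (2 * c * sin a) ^+ 2.
  rewrite eq_radicand; transitivity (4 * c ^+ 2 * sin a ^+ 2); last by ring.
  by rewrite sin2cos2 /x; ring.
rewrite rE sqrtr_sqr ger0_norm ?mulr_ge0 ?(ltW c0)//.
have := pi_gt0 R; move: (@pi R) => p p0.
by field; rewrite !gt_eqF.
Qed.

Lemma eq_g_linear (h : R -> R) : continuous h ->
  \int[mu]_(a in `[0, pi]) (g a * h a) =
  \int[mu]_(a in `[0, pi]) h a - c * \int[mu]_(a in `[0, pi]) (cos a * h a)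
  - (beta - 1) * \int[mu]_(a in `[0, pi]) (geo (- q0) a * h a)
  - t * \int[mu]_(a in `[0, pi]) (geo (- s) a * h a).
Proof.
move=> ch.
have cq : continuous (geo (- q0)) by apply: continuous_geo; rewrite normrN eq_q0_lt1.
have cs : continuous (geo (- s)) by apply: continuous_geo; rewrite normrN abs_s.
have c1 : continuous (fun a : R => cos a * h a) by move=> a; apply: cvgM; [exact: continuous_cos|exact: ch].
have c2 : continuous (fun a : R => geo (- q0) a * h a) by move=> a; apply: cvgM; [exact: cq|exact: ch].
have c3 : continuous (fun a : R => geo (- s) a * h a) by move=> a; apply: cvgM; [exact: cs|exact: ch].
have cZ (k : R) (f : R -> R) : continuous f -> continuous (fun a => k * f a).
  by move=> cf a; apply: cvgM; [exact: cvg_cst|exact: cf].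
have cB (f f' : R -> R) : continuous f -> continuous f' -> continuous (fun a => f a - f' a).
  by move=> cf cf' a; apply: cvgB; [exact: cf|exact: cf'].
have E a : g a * h a = h a - c * (cos a * h a) - (beta - 1) * (geo (- q0) a * h a) - t * (geo (- s) a * h a).
  by rewrite /g; ring.
under eq_Rintegral do rewrite E.
have d1 := cB _ _ ch (cZ c _ c1); have d2 := cB _ _ d1 (cZ (beta - 1) _ c2).
rewrite RintegralB//; [|exact: integrable_0pi|exact/integrable_0pi/cZ].
rewrite RintegralB//; [|exact: integrable_0pi|exact/integrable_0pi/cZ].
rewrite RintegralB//; [|exact: integrable_0pi|exact/integrable_0pi/cZ].
by rewrite !RintegralZl//; exact: integrable_0pi.
Qed.

Lemma eq_g_mass : \int[mu]_(a in `[0, pi]) (g a * 1) = pi.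
Proof.
rewrite (@eq_g_linear (fun=> 1)); last by move=> x; exact: cvg_cst.
under [X in _ - c * X - _ - _]eq_Rintegral do rewrite mulr1.
under [X in _ - (beta - 1) * X - _]eq_Rintegral do rewrite mulr1.
under [X in _ - t * X]eq_Rintegral do rewrite mulr1.
rewrite !integral_geo ?normrN ?abs_s ?eq_q0_lt1// Rintegral_cst_0pi.
have -> : \int[mu]_(a in `[0, pi]) (cos a : R) = \int[mu]_(a in `[0, pi]) cos (1 * a).
  by apply: eq_Rintegral => a _; rewrite mul1r.
by rewrite integral_cos ?oner_eq0 ?mul1r ?sinpi//; ring.
Qed.

Lemma eq_density_mass : \int[mu]_x eq_density x = 1.
Proof.
have [_] := @eq_density_subst (fun=> 1) (measurable_cst _) (fun x _ => cvg_cst _).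
rewrite eq_g_mass mulVf ?gt_eqF ?pi_gt0// => <-.
by apply: eq_Rintegral => x _; rewrite mulr1.
Qed.

(* Twice the logarithmic potential of [eq_density] at [P + Y c (z + 1/z)] for
   [Y = 1] or [-1], and at [P + 2 c Y] for [z = 1]. *)
Definition eq_potential z Y : R := 2 * ln (c / z) + 2 * c * z * Y
  - (beta - 1) * ln (1 + 2 * (q * z) * Y + (q * z) ^+ 2)
  - t * ln (1 + 2 * (s * z) * Y + (s * z) ^+ 2).

Lemma eq_g_logker z th : `|z| < 1 ->
  \int[mu]_(a in `[0, pi]) (g a * (2 * ln (c / z) + logker z th a)) = pi * eq_potential z (cos th).
Proof.
move=> z1; have cl := @continuous_logker R z th z1.
have i0 (k : R) (f : R -> R) : continuous f -> continuous (fun a => g a * (k + f a)).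
  move=> cf a; apply: cvgM; first exact: continuous_eq_g.
  by apply: cvgD; [exact: cvg_cst|exact: cf].
have E a : g a * (2 * ln (c / z) + logker z th a) = 2 * ln (c / z) * (g a * 1) + g a * logker z th a.
  by ring.
under eq_Rintegral do rewrite E.
have cg1 : continuous (fun a : R => g a * 1).
  by move=> a; apply: cvgM; [exact: continuous_eq_g|exact: cvg_cst].
have cg2 : continuous (fun a : R => g a * logker z th a).
  by move=> a; apply: cvgM; [exact: continuous_eq_g|exact: cl].
rewrite RintegralD//; last 2 first.
- by apply: integrable_0pi => a; apply: cvgM; [exact: cvg_cst|exact: cg1].
- exact: integrable_0pi.
rewrite RintegralZl//; last exact: integrable_0pi.
rewrite eq_g_mass eq_g_linear// logker_1// logker_cos//.
rewrite !logker_geo ?normrN ?abs_s ?eq_q0_lt1//.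
have E1 r : den (- r * z) th = 1 + 2 * (r * z) * cos th + (r * z) ^+ 2 by rewrite /den; ring.
rewrite !E1.
have := eq_beta_q0 (fun r => pi * ln (1 + 2 * (r * z) * cos th + (r * z) ^+ 2)); rewrite /= => ->.
by rewrite /eq_potential; move: (@pi R) => p; ring.
Qed.

(** [X] and [e] are the real part and the squared imaginary part of P + c (zeta + 1 / zeta), zeta =
    z e^(i th). The squared distance from this point to P + 2 c cos a factors into two values of
    [den], which are positive since z < 1. *)
Lemma eq_potential_reg z th X e : 0 < z < 1 ->
  X = P + c * (z + z^-1) * cos th -> e = (c * (z^-1 - z) * sin th) ^+ 2 ->
  mu.-integrable setT (EFin \o (fun y => eq_density y * ln ((X - y) ^+ 2 + e))) /\
  \int[mu]_y (eq_density y * ln ((X - y) ^+ 2 + e)) = eq_potential z (cos th).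
Proof.
move=> /andP[z0 z1] XE eE; have c0 := eq_c_gt0.
have az : `|z| < 1 by rewrite gtr0_norm.
have cz : 0 < c / z by rewrite divr_gt0.
have fact a : (X - (P + 2 * c * cos a)) ^+ 2 + e = (c / z) ^+ 2 * (den z (th - a) * den z (th + a)).
  rewrite XE eE /den cosB cosD.
  move: (sin2cos2 th) (sin2cos2 a).
  move: (cos th) (sin th) (cos a) (sin a) => u v u' v' hv hv'.
  have -> : (1 - 2 * z * (u * u' + v * v') + z ^+ 2) * (1 - 2 * z * (u * u' - v * v') + z ^+ 2) =
     (1 + z ^+ 2 - 2 * z * (u * u')) ^+ 2 - 4 * z ^+ 2 * (v ^+ 2 * v' ^+ 2) by ring.
  by rewrite (exprMn _ _ v) hv hv'; field; rewrite gt_eqF.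
have posf a : 0 < (X - (P + 2 * c * cos a)) ^+ 2 + e.
  by rewrite fact mulr_gt0 ?exprn_gt0// mulr_gt0 ?den_gt0.
have mf : measurable_fun setT (fun y : R => ln ((X - y) ^+ 2 + e)).
  apply: (measurableT_comp (@measurable_ln R)); apply: measurable_funD => //.
  by apply: measurable_funX; exact: measurable_funB.
have cf x : P - 2 * c <= x <= P + 2 * c -> {for x, continuous (fun y : R => ln ((X - y) ^+ 2 + e))}.
  move=> /andP[ax xb].
  have Y1 : -1 <= (x - P) / (2 * c) <= 1.
    have cc : 0 < 2 * c by rewrite mulr_gt0.
    by apply/andP; split; rewrite ?ler_pdivlMr ?ler_pdivrMr//; lra.
  have xE : x = P + 2 * c * cos (acos ((x - P) / (2 * c))).
    by rewrite acosK ?in_itv//; field; rewrite gt_eqF.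
  have pos := posf (acos ((x - P) / (2 * c))); rewrite -xE in pos.
  have D := dvD (dvX 2 (dvB (dvC X x) (dvI x))) (dvC e x).
  exact: (dv_continuous (@dvln _ (fun y => (X - y) ^+ 2 + e) x _ pos D)).
have [int ->] := eq_density_subst mf cf; split=> //.
rewrite (_ : \int[mu]_(a in _) _ = pi * eq_potential z (cos th)).
  by rewrite mulKf// gt_eqF// pi_gt0.
rewrite -eq_g_logker//; apply: eq_Rintegral => a _; congr (_ * _).
have d1 : den z (th - a) \is Num.pos by rewrite posrE den_gt0.
have d2 : den z (th + a) \is Num.pos by rewrite posrE den_gt0.
have d3 : (c / z) ^+ 2 \is Num.pos by rewrite posrE exprn_gt0.
have d4 : den z (th - a) * den z (th + a) \is Num.pos by rewrite posrE mulr_gt0 -?posrE.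
rewrite fact (lnM d3 d4).
by rewrite (lnM d1 d2) lnXn// mulr_natl.
Qed.

Lemma ln_sqr (u : R) : ln (u ^+ 2) = 2 * ln `|u|.
Proof.
have [->|u0] := eqVneq u 0; first by rewrite normr0 expr0n ln0// mulr0.
by rewrite -[u ^+ 2]real_normK ?num_real// lnXn ?normr_gt0// mulr_natl.
Qed.

Lemma log_potential_sqr X :
  \int[mu]_y (eq_density y * ln ((X - y) ^+ 2)) = 2 * log_potential eq_density X.
Proof.
rewrite /log_potential -RintegralZl//; last exact/integrable_log/eq_density_tame.
by apply: eq_Rintegral => y _; rewrite ln_sqr mulrCA.
Qed.

(** For the angles 0 and pi the imaginary part vanishes: the point is real, outside the support, and
    the kernel is already regular. *)
Lemma eq_potential_off z (b : bool) : 0 < z < 1 ->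
  2 * log_potential eq_density (P + (-1) ^+ b * (c * (z + z^-1))) = eq_potential z ((-1) ^+ b).
Proof.
move=> z01; pose th : R := if b then pi else 0.
have cth : cos th = (-1) ^+ b by rewrite /th; case: (b); rewrite ?cospi ?cos0.
have sth : sin th = 0 by rewrite /th; case: (b); rewrite ?sinpi ?sin0.
have [||_] := @eq_potential_reg z th (P + (-1) ^+ b * (c * (z + z^-1))) 0 z01.
- by rewrite cth mulrC.
- by rewrite sth mulr0 expr0n.
rewrite cth => <-; rewrite -log_potential_sqr.
by apply: eq_Rintegral => y _; rewrite addr0.
Qed.

(** If u + e < 1, both logarithms are negative and monotonicity applies; otherwise ln y < y. This is
    the domination, uniform in [e], for the limit below. *)
Lemma ln_add_bound (u e : R) : 0 < u -> 0 <= e -> `|ln (u + e)| <= `|ln u| + (u + e).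
Proof.
move=> u0 e0; have ue : 0 < u + e by lra.
have := normr_ge0 (ln u); have [h|h] := leP 1 (u + e).
  by rewrite (ger0_norm (ln_ge0 h)); have := ln_sublinear ue; lra.
have l1 : ln u <= ln (u + e) by rewrite ler_ln ?posrE//; lra.
have l2 : ln (u + e) <= 0 by rewrite ln_le0// ltW.
by rewrite (ler0_norm l2) (ler0_norm (le_trans l1 l2)); lra.
Qed.

(** Dominated convergence. The point [y = X], where [ln (e n)] need not approach the default
    [ln 0 = 0], is excluded as a null set. *)
Lemma cvg_eq_potential_reg X (e : nat -> R) E : (forall n, 0 <= e n <= E) -> e n @[n --> \oo] --> 0 ->
  (forall n, mu.-integrable setT (EFin \o (fun y => eq_density y * ln ((X - y) ^+ 2 + e n)))) ->
  \int[mu]_y (eq_density y * ln ((X - y) ^+ 2 + e n)) @[n --> \oo] --> 2 * log_potential eq_density X.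
Proof.
move=> eE ecvg ie.
have E0 : 0 <= E by have /andP[h1 h2] := eE 0%N; exact: le_trans h2.
pose G y := 2 * (eq_density y * `|ln `|X - y| |) + eq_density y * ((X - y) ^+ 2 + E).
have iG : mu.-integrable setT (EFin \o G).
  have i1 := integrableZl measurableT 2 (integrable_norm (integrable_log X eq_density_tame)).
  have bnd x : P - 2 * c <= x <= P + 2 * c -> `|(X - x) ^+ 2 + E| <= (`|X| + (P + 2 * c)) ^+ 2 + E.
    move=> /andP[ax xb]; rewrite ger0_norm ?addr_ge0 ?sqr_ge0// lerD2r.
    rewrite -[leLHS]real_normK ?num_real// lerXn2r// ?nnegrE//.
      by rewrite addr_ge0// (le_trans eq_left_ge0)// (le_trans ax).
    apply: le_trans (ler_normB _ _) _; rewrite lerD2l ger0_norm//; exact: le_trans eq_left_ge0 ax.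
  have mf : measurable_fun setT (fun y : R => (X - y) ^+ 2 + E).
    by apply: measurable_funD => //; apply: measurable_funX; exact: measurable_funB.
  have i2 := eq_density_mul_integrable mf bnd.
  have := integrableD measurableT i1 i2; apply: eq_integrable => // y _.
  by rewrite /G /= EFinD EFinM normrM (ger0_norm (eq_density_ge0 y)).
have mfn n : measurable_fun setT (fun y => (eq_density y * ln ((X - y) ^+ 2 + e n))%:E).
  exact: measurable_int (ie n).
have mf0 : measurable_fun setT (fun y => (eq_density y * ln ((X - y) ^+ 2))%:E).
  apply/measurable_EFinP; apply: measurable_funM; first exact: measurable_eq_density.
  by apply: (measurableT_comp (@measurable_ln R)); apply: measurable_funX; exact: measurable_funB.
have aeX (Q : R -> Prop) : (forall y, y != X -> Q y) -> {ae mu, forall y, Q y}.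
  move=> HQ; exists [set X]; split => //; first exact: lebesgue_measure_set1.
  by move=> y /= h; apply: contrapT => /eqP yX; apply: h; exact: HQ.
have sq0 y : y != X -> 0 < (X - y) ^+ 2.
  by move=> yX; rewrite exprn_even_gt0//= subr_eq0 eq_sym.
have h1 : {ae mu, forall y, setT y -> (eq_density y * ln ((X - y) ^+ 2 + e n))%:E @[n --> \oo]
    --> (eq_density y * ln ((X - y) ^+ 2))%:E}.
  apply: aeX => y yX _; apply: cvg_EFin; first by near=> n.
  apply: cvgM; first exact: cvg_cst.
  have hl : (X - y) ^+ 2 + e n @[n --> \oo] --> (X - y) ^+ 2.
    by rewrite -[X in _ --> X]addr0; apply: cvgD => //; exact: cvg_cst.
  exact: (continuous_cvg _ (continuous_ln (sq0 _ yX)) hl).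
have h2 : {ae mu, forall y n, setT y ->
    (`|(eq_density y * ln ((X - y) ^+ 2 + e n))%:E| <= (EFin \o G) y)%E}.
  apply: aeX => y yX n _; rewrite /= lee_fin normrM (ger0_norm (eq_density_ge0 y)) /G.
  have /andP[en0 enE] := eE n.
  have := ln_add_bound (sq0 _ yX) en0; rewrite ln_sqr normrM (ger0_norm (ler0n R 2)) => B.
  rewrite [2 * _]mulrCA -mulrDr ler_wpM2l ?eq_density_ge0//.
  by apply: le_trans B _; lra.
have [_ _ /=] := @dominated_convergence _ _ _ mu setT measurableT
  (fun n y => (eq_density y * ln ((X - y) ^+ 2 + e n))%:E)
  (fun y => (eq_density y * ln ((X - y) ^+ 2))%:E) (EFin \o G) mfn mf0 h1 iG h2.
rewrite -log_potential_sqr => H.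
apply: fine_cvg; rewrite /Rintegral fineK; first exact: H.
have i0 := integrableZl measurableT 2 (integrable_log X eq_density_tame).
have := integrable_fin_num measurableT i0.
by congr (_ \is a fin_num); apply: eq_integral => y _; rewrite -EFinM ln_sqr mulrCA.
Unshelve. all: by end_near. Qed.

Lemma eq_potential_on Y : -1 <= Y <= 1 -> 0 < P + 2 * c * Y ->
  2 * log_potential eq_density (P + 2 * c * Y) = eq_potential 1 Y.
Proof.
move=> Y1 x0; have c0 := eq_c_gt0; set X := P + 2 * c * Y.
(* The angle [acos (y n)] is chosen so that the real part is [X] for every [n] while [z n] tends to
   1. Starting from [z 0 = 1 / 2] keeps [e n] bounded. *)
pose z n : R := 1 - n.+2%:R^-1.
pose y n : R := 2 * Y / (z n + (z n)^-1).
pose e n : R := (c * ((z n)^-1 - z n) * sin (acos (y n))) ^+ 2.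
have nV n : 0 < n.+2%:R^-1 :> R by rewrite invr_gt0 ltr0n.
have nV2 n : n.+2%:R^-1 <= 2^-1 :> R by rewrite lef_pV2 ?posrE ?ltr0n// ler_nat.
have z01 n : 0 < z n < 1 by move: (nV n) (nV2 n); rewrite /z; move: (n.+2%:R^-1) => v ? ?; apply/andP; split; lra.
have zz n : 2 <= z n + (z n)^-1.
  have /andP[a b] := z01 n.
  have E : z n + (z n)^-1 - 2 = (z n - 1) ^+ 2 / z n by move: (z n) a => v a; field; rewrite gt_eqF.
  by rewrite -subr_ge0 E divr_ge0 ?sqr_ge0// ltW.
have y1 n : -1 <= y n <= 1.
  have zp : 0 < z n + (z n)^-1 by have := zz n; lra.
  have /andP[Ya Yb] := Y1; have zzn := zz n.
  by apply/andP; split; rewrite /y ?ler_pdivlMr ?ler_pdivrMr//; nra.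
have zcvg : z n @[n --> \oo] --> (1 : R).
  rewrite -[X in _ --> X]subr0; apply: cvgB; first exact: cvg_cst.
  by have := @cvg_harmonic R; rewrite -(cvg_shiftS (@harmonic R)).
have zVcvg : (z n)^-1 @[n --> \oo] --> (1 : R).
  by rewrite -[X in _ --> X]invr1; apply: cvgV => //; exact: oner_neq0.
have ycvg : y n @[n --> \oo] --> Y.
  have -> : Y = 2 * Y / (1 + 1) by field.
  apply: cvgM; first exact: cvg_cst.
  by apply: cvgV; [lra|apply: cvgD].
have ac n : cos (acos (y n)) = y n by rewrite acosK// in_itv/=; exact: y1.
have XE n : X = P + c * (z n + (z n)^-1) * cos (acos (y n)).
  rewrite ac; have := z01 n; rewrite /X /y; move: (z n) => v /andP[v0 _].
  have k0 : v + v^-1 != 0 by rewrite gt_eqF// addr_gt0// invr_gt0.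
  by rewrite [c * _ * _]mulrAC -[_ * _ * (v + _)]mulrA divfK//; ring.
have eE n : 0 <= e n <= (c * ((z n)^-1 - z n)) ^+ 2.
  have -> : e n = (c * ((z n)^-1 - z n)) ^+ 2 * sin (acos (y n)) ^+ 2 by rewrite -exprMn.
  have s1 : sin (acos (y n)) ^+ 2 <= 1 by rewrite sin2cos2 gerBl sqr_ge0.
  by rewrite mulr_ge0 ?sqr_ge0//= ler_piMr ?sqr_ge0.
have bcvg : (c * ((z n)^-1 - z n)) ^+ 2 @[n --> \oo] --> (0 : R).
  have -> : 0 = (c * (1 - 1)) ^+ 2 :> R by rewrite subrr mulr0 expr0n.
  have h : c * ((z n)^-1 - z n) @[n --> \oo] --> c * (1 - 1).
    by apply: cvgM; [exact: cvg_cst|apply: cvgB].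
  by rewrite expr2; apply: cvgM.
have ecvg : e n @[n --> \oo] --> (0 : R).
  apply: (squeeze_cvgr _ (cvg_cst 0) bcvg); near=> n; exact: eE.
have eB n : 0 <= e n <= (c * 2) ^+ 2.
  have /andP[h1 h2] := eE n; rewrite h1 (le_trans h2)// ler_pXn2r ?nnegrE//; last 2 first.
  - by rewrite mulr_ge0 ?(ltW c0)// subr_ge0; have := zz n; have /andP[? ?] := z01 n; lra.
  - by rewrite mulr_ge0// ltW.
  rewrite ler_wpM2l ?(ltW c0)//.
  have zh : 2^-1 <= z n by move: (nV2 n); rewrite /z; move: (n.+2%:R^-1) => v ?; lra.
  have : (z n)^-1 <= 2.
    by rewrite -[leRHS]invrK lef_pV2 ?posrE ?invr_gt0//; have /andP[] := z01 n.
  by have /andP[? ?] := z01 n; lra.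
have R1 n := eq_potential_reg (z01 n) (XE n) (erefl (e n)).
have L1 := cvg_eq_potential_reg eB ecvg (fun n => (R1 n).1).
have L2 : \int[mu]_y (eq_density y * ln ((X - y) ^+ 2 + e n)) @[n --> \oo] --> eq_potential 1 Y.
  have -> : (fun n => \int[mu]_y (eq_density y * ln ((X - y) ^+ 2 + e n))) =
      (fun n => eq_potential (z n) (y n)).
    by apply/funext => n; rewrite (R1 n).2 ac.
  have quad r : 0 < 1 + 2 * r * Y + r ^+ 2 ->
      ln (1 + 2 * (r * z n) * y n + (r * z n) ^+ 2) @[n --> \oo] --> ln (1 + 2 * (r * 1) * Y + (r * 1) ^+ 2).
    move=> pos; have pos1 : 0 < 1 + 2 * (r * 1) * Y + (r * 1) ^+ 2 by rewrite mulr1.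
    apply: (continuous_cvg _ (continuous_ln pos1)).
    have rz : r * z n @[n --> \oo] --> r * 1 by apply: cvgM => //; exact: cvg_cst.
    apply: cvgD; last by rewrite expr2; under eq_fun do rewrite expr2; exact: cvgM.
    by apply: cvgD; [exact: cvg_cst|apply: cvgM => //; apply: cvgM => //; exact: cvg_cst].
  have posq : 0 < 1 + 2 * q * Y + q ^+ 2.
    by move: x0; rewrite eq_xE pmulr_rgt0// eq_A_gt0.
  have poss : 0 < 1 + 2 * s * Y + s ^+ 2.
    have : 0 < 1 + rho * X by rewrite addr_gt0// mulr_gt0.
    by rewrite eq_1xE pmulr_rgt0// eq_C_gt0.
  apply: cvgB; last by apply: cvgM; [exact: cvg_cst|exact: quad].
  apply: cvgB; last by apply: cvgM; [exact: cvg_cst|exact: quad].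
  apply: cvgD; last by apply: cvgM => //; apply: cvgM => //; exact: cvg_cst.
  apply: cvgM; first exact: cvg_cst.
  have pos : 0 < c / 1 by rewrite divr1.
  apply: (continuous_cvg _ (continuous_ln pos)).
  by apply: cvgM; [exact: cvg_cst|rewrite invr1].
exact: (cvg_unique _ L1 L2).
Unshelve. all: by end_near. Qed.

(** The Euler-Lagrange constant: on the support [ln x] and [ln (1 + rho * x)] factor as in [eq_xE]
    and [eq_1xE], their variable parts cancel against the potential, and this remains. *)
Definition eq_level : R := P - (beta - 1) * ln A2 - t * ln C2 - 2 * ln c.

Lemma eq_level_on Y : 0 < P + 2 * c * Y -> let x := P + 2 * c * Y in
  x - (beta - 1) * ln x - t * ln (1 + rho * x) - eq_potential 1 Y = eq_level.
Proof.
move=> x0 x; have x1 : 0 < 1 + rho * x by rewrite addr_gt0// mulr_gt0.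
have a0 := eq_A_gt0; have c0 := eq_C_gt0.
have posq : 0 < 1 + 2 * q * Y + q ^+ 2 by move: x0; rewrite eq_xE pmulr_rgt0.
have poss : 0 < 1 + 2 * s * Y + s ^+ 2 by move: x1; rewrite /x eq_1xE pmulr_rgt0.
have lx : ln x = ln A2 + ln (1 + 2 * q * Y + q ^+ 2) by rewrite /x eq_xE lnM.
have l1 : ln (1 + rho * x) = ln C2 + ln (1 + 2 * s * Y + s ^+ 2) by rewrite /x eq_1xE lnM.
by rewrite lx l1 /eq_potential /eq_level !mulr1 divr1 /x; ring.
Qed.

(** As e = 1 or -1, the denominator on the left is the square of 1 + e r u, and Z = A (1 + e r u) (1
    + e r / u); one factor cancels in each fraction. *)
Lemma quad_ratio (A r e u Z : R) : e ^+ 2 = 1 -> 0 < u -> Z != 0 ->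
  Z = A * (1 + e * r * (u + u^-1) + r ^+ 2) ->
  1 + 2 * (r * u) * e + (r * u) ^+ 2 != 0 /\
  (2 * r * e + 2 * r ^+ 2 * u) / (1 + 2 * (r * u) * e + (r * u) ^+ 2) =
  (2 * e * (A * r) + 2 * (A * r ^+ 2) / u) / Z.
Proof.
move=> e2 u0 Z0 ZE.
have QE : 1 + 2 * (r * u) * e + (r * u) ^+ 2 = (1 + e * r * u) ^+ 2.
  by transitivity (1 + 2 * (r * u) * e + e ^+ 2 * (r * u) ^+ 2); [rewrite e2; ring|ring].
have ZE2 : Z = A * (1 + e * r * u) * (1 + e * r / u).
  transitivity (A * (1 + e * r * (u + u^-1) + e ^+ 2 * r ^+ 2)); first by rewrite e2 mul1r.
  by field; rewrite gt_eqF.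
have n0 : 1 + e * r * u != 0 by apply: contraNneq Z0 => h; rewrite ZE2 h mulr0 mul0r.
have n1 : 1 + e * r / u != 0 by apply: contraNneq Z0 => h; rewrite ZE2 h mulr0.
have A0 : A != 0 by apply: contraNneq Z0 => h; rewrite ZE2 h !mul0r.
have un0 : u != 0 by rewrite gt_eqF.
have n1' : u + e * r != 0.
  by apply: contraNneq n1 => h; rewrite -(mulfK un0 (1 + e * r / u)) mulrDl divfK// mul1r h mul0r.
split; first by rewrite QE expf_neq0.
have -> : 2 * r * e + 2 * r ^+ 2 * u = 2 * r * e * (1 + e * r * u).
  transitivity (2 * r * e + 2 * (e ^+ 2 * r ^+ 2) * u); first by rewrite e2 mul1r.
  by ring.
have -> : 2 * e * (A * r) + 2 * (A * r ^+ 2) / u = 2 * A * r * e * (1 + e * r / u).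
  transitivity (2 * e * (A * r) + 2 * (A * (e ^+ 2 * r ^+ 2)) / u); first by rewrite e2 mul1r.
  by field.
by rewrite QE ZE2; field; rewrite n0 A0 un0 n1'.
Qed.

Lemma level_deriv_scale (y k x r u : R) : u != 0 -> x != 0 -> 1 + r * x != 0 ->
  y * k / (x * (1 + r * x)) / u = 2 / u * (y * k / (2 * x * (1 + r * x))).
Proof. by move=> u0 x0 r0; field; rewrite u0 x0 r0. Qed.

Lemma level_deriv_identity (a b d r y p v x e : R) : v != 0 -> x != 0 -> 1 + r * x != 0 ->
  2 * e * y - (x - p) / v - a * ((2 * e * y - (x - p) / v) / x)
    - b * (r * (2 * e * y - (x - p) / v) / (1 + r * x))
    - (2 * - v^-1 + 2 * y * e - a * ((2 * e * y + 2 * ((p - d) / 2) / v) / x)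
       - b * ((2 * e * (r * y) + 2 * ((1 + r * p - w) / 2) / v) / (1 + r * x)))
  = 2 / v * (1 - (x - p) / 2 + a * (x - d) / (2 * x) + b * (1 + r * x - w) / (2 * (1 + r * x))).
Proof. by move=> v0 x0 r0; field; rewrite v0 x0 r0. Qed.

(** The partial fractions of [eq_density_identity] reappear off the support, so the derivative in
    the Joukowski parameter has the sign of 4 c^2 - (X - P)^2. *)
Lemma eq_level_off_deriv (e u : R) : e ^+ 2 = 1 -> 0 < u -> let X := P + e * (c * (u + u^-1)) in 0 < X ->
  is_derive u (1 : R) (fun u => let X := P + e * (c * (u + u^-1)) in
     X - (beta - 1) * ln X - t * ln (1 + rho * X) - eq_potential u e)
  ((4 * c ^+ 2 - (X - P) ^+ 2) * (kappa + rho * X) / (X * (1 + rho * X)) / u).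
Proof.
move=> e2 u0 X X0; have c0 := eq_c_gt0.
have un0 : u != 0 by rewrite gt_eqF.
have X1 : 0 < 1 + rho * X by rewrite addr_gt0// mulr_gt0.
have Xn0 : X != 0 by rewrite gt_eqF.
have X1n0 : 1 + rho * X != 0 by rewrite gt_eqF.
have XE : X = A2 * (1 + e * q * (u + u^-1) + q ^+ 2).
  transitivity (A2 + e * (A2 * q) * (u + u^-1) + A2 * q ^+ 2); last by ring.
  by rewrite eq_Aq eq_Aq2 /X /A2 /B2; field.
have X1E : 1 + rho * X = C2 * (1 + e * s * (u + u^-1) + s ^+ 2).
  transitivity (C2 + e * (C2 * s) * (u + u^-1) + C2 * s ^+ 2); last by ring.
  by rewrite eq_Cs eq_Cs2 /X /C2 /D2; field.
have [Qq Eq] := quad_ratio e2 u0 Xn0 XE.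
have [Qs Es] := quad_ratio e2 u0 X1n0 X1E.
have Qpos r : 1 + 2 * (r * u) * e + (r * u) ^+ 2 != 0 -> 0 < 1 + 2 * (r * u) * e + (r * u) ^+ 2.
  have -> : 1 + 2 * (r * u) * e + (r * u) ^+ 2 = (1 + e * r * u) ^+ 2.
    by transitivity (1 + 2 * (r * u) * e + e ^+ 2 * (r * u) ^+ 2); [rewrite e2; ring|ring].
  by rewrite lt_neqAle sqr_ge0 andbT eq_sym.
have dX : is_derive u (1 : R) (fun u => P + e * (c * (u + u^-1))) (e * c * (1 - (u ^+ 2)^-1)).
  apply: dv_eq (dvD (dvC P u) (dvZ e (dvZ c (dvD (dvI u) (dvV un0 (dvI u)))))) _.
  by field.
have dQ r : 1 + 2 * (r * u) * e + (r * u) ^+ 2 != 0 ->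
    is_derive u (1 : R) (fun u => ln (1 + 2 * (r * u) * e + (r * u) ^+ 2))
    ((2 * r * e + 2 * r ^+ 2 * u) / (1 + 2 * (r * u) * e + (r * u) ^+ 2)).
  move=> n0.
  have D := dvD (dvD (dvC 1 u) (dvM (dvZ 2 (dvZ r (dvI u))) (dvC e u))) (dvX 2 (dvZ r (dvI u))).
  apply: dv_eq (@dvln _ (fun u => 1 + 2 * (r * u) * e + (r * u) ^+ 2) u _ (Qpos r n0) D) _.
  by congr (_ / _); rewrite /= expr1; ring.
have cu0 : 0 < c / u by rewrite divr_gt0.
have dlc : is_derive u (1 : R) (fun u => ln (c / u)) (- u^-1).
  have D := @dvln _ (fun u => c / u) u _ cu0 (dvZ c (dvV un0 (dvI u))).
  by apply: dv_eq D _; field; rewrite un0 gt_eqF.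
have dlX := @dvln _ (fun u => P + e * (c * (u + u^-1))) u _ X0 dX.
have dl1 := @dvln _ (fun u => 1 + rho * (P + e * (c * (u + u^-1)))) u _ X1 (dvD (dvC 1 u) (dvZ rho dX)).
have dpot : is_derive u (1 : R) (eq_potential ^~ e)
   (2 * - u^-1 + 2 * c * e - (beta - 1) * ((2 * e * (A2 * q) + 2 * (A2 * q ^+ 2) / u) / X)
     - t * ((2 * e * (C2 * s) + 2 * (C2 * s ^+ 2) / u) / (1 + rho * X))).
  rewrite -Eq -Es.
  have D := dvB (dvB (dvD (dvZ 2 dlc) (dvM (dvZ (2 * c) (dvI u)) (dvC e u))) (dvZ (beta - 1) (dQ q Qq)))
     (dvZ t (dQ s Qs)).
  by apply: dv_eq D _; rewrite mulr0 add0r; congr (_ - _ - _); rewrite /=; ring.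
have D := dvB (dvB (dvB dX (dvZ (beta - 1) dlX)) (dvZ t dl1)) dpot.
apply: (dv_eq D); rewrite -eq_radicand.
have := eq_density_identity Xn0 X1n0 => I.
have -> : (2 * P * X - X ^+ 2 - delta ^+ 2) * (kappa + rho * X) / (X * (1 + rho * X)) / u =
  2 / u * ((2 * P * X - X ^+ 2 - delta ^+ 2) * (kappa + rho * X) / (2 * X * (1 + rho * X))).
  by move: (2 * P * X - _ - _) (kappa + _) => y k; exact: level_deriv_scale.
rewrite -I eq_Aq eq_Aq2 eq_Cs eq_Cs2 -/X.
have XP : e * c * (1 - (u ^+ 2)^-1) = 2 * e * c - (X - P) / u by rewrite /X; field.
rewrite XP /B2 /D2 add0r; exact: level_deriv_identity.
Qed.

(** [b] selects the side of the support, [true] being the left. Along P + e c (u + 1 / u) the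
    left-hand function of the Euler-Lagrange condition is nonincreasing in u, from [x] at u = z to
    the end of the support at u = 1, where it equals [eq_level]. *)
Lemma eq_level_off (b : bool) x : 0 < x -> 2 * c < (-1) ^+ b * (x - P) ->
  eq_level <= x - (beta - 1) * ln x - t * ln (1 + rho * x) - 2 * log_potential eq_density x.
Proof.
move=> x0; set e : R := (-1) ^+ b; set v := e * (x - P) => cv.
have c0 := eq_c_gt0; have c20 : 0 < 2 * c by exact: mulr_gt0.
have e2 : e ^+ 2 = 1 by rewrite /e sqrr_sign.
have v0 : 0 < v by apply: lt_trans cv; rewrite mulr_gt0.
have xv : x = P + e * v by rewrite /v mulrA -expr2 e2 mul1r addrC subrK.
(* Discriminant of c (z + 1 / z) = v, an equation whose two roots are inverse to each other; [z] is
   the smaller one. *)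
pose d := Num.sqrt (v ^+ 2 - 4 * c ^+ 2).
have vc : 0 < v ^+ 2 - 4 * c ^+ 2.
  have -> : v ^+ 2 - 4 * c ^+ 2 = (v - 2 * c) * (v + 2 * c) by ring.
  by rewrite mulr_gt0// ?subr_gt0// addr_gt0// mulr_gt0.
have d0 : 0 < d by rewrite sqrtr_gt0.
have d2 : d ^+ 2 = v ^+ 2 - 4 * c ^+ 2 by rewrite sqr_sqrtr// ltW.
have dv : d < v.
  rewrite -(@ltr_pXn2r _ 2)// ?nnegrE ?ltW// d2.
  by rewrite gtrBl mulr_gt0// exprn_gt0.
have vcd : v - 2 * c < d.
  rewrite -(@ltr_pXn2r _ 2)// ?nnegrE ?subr_ge0 ?ltW// d2 -subr_gt0.
  have -> : v ^+ 2 - 4 * c ^+ 2 - (v - 2 * c) ^+ 2 = 4 * c * (v - 2 * c) by ring.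
  by apply: mulr_gt0; [exact: mulr_gt0|rewrite subr_gt0].
pose z := (v - d) / (2 * c).
have z0 : 0 < z by rewrite divr_gt0 ?subr_gt0.
have z1 : z < 1 by rewrite /z (ltr_pdivrMr _ _ c20) mul1r; move: vcd; lra.
have zinv : z^-1 = (v + d) / (2 * c).
  apply: (mulfI (lt0r_neq0 z0)); rewrite mulfV ?gt_eqF//.
  have -> : z * ((v + d) / (2 * c)) = (v ^+ 2 - d ^+ 2) / (4 * c ^+ 2).
    by rewrite /z; field; rewrite gt_eqF.
  by rewrite d2; field; rewrite gt_eqF.
have zv : c * (z + z^-1) = v by rewrite zinv /z; field; rewrite gt_eqF.
have mono y : z <= y -> y <= 1 -> c * (y + y^-1) <= v /\ 2 * c <= c * (y + y^-1).
  move=> zy y1; have y0 : 0 < y by exact: lt_le_trans zy.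
  split.
    rewrite -zv ler_pM2l// -subr_ge0.
    have -> : z + z^-1 - (y + y^-1) = (y - z) * (1 - z * y) / (z * y).
      by field; rewrite !gt_eqF.
    have zy1 : z * y <= 1 by rewrite mulr_ile1// ltW.
    by apply: divr_ge0; apply: mulr_ge0; rewrite ?subr_ge0// ltW.
  rewrite [2 * c]mulrC ler_pM2l// -subr_ge0.
  have -> : y + y^-1 - 2 = (y - 1) ^+ 2 / y by field; rewrite gt_eqF.
  by rewrite divr_ge0 ?sqr_ge0// ltW.
(* On the left side the path runs from the end of the support down to [x], so it stays above
   [x > 0]. *)
have Xpos y : z <= y -> y <= 1 -> 0 < P + e * (c * (y + y^-1)).
  move=> zy y1; have [h1 h2] := mono y zy y1.
  have cy : 0 < c * (y + y^-1) by apply: lt_le_trans h2; rewrite mulr_gt0.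
  move: xv; rewrite /e; case: (b) => xv.
    rewrite expr1 mulN1r; apply: lt_le_trans x0 _.
    by rewrite xv expr1 mulN1r lerD2l lerN2.
  by rewrite expr0 mul1r addr_gt0// eq_P_gt0.
pose h u := let X := P + e * (c * (u + u^-1)) in
     X - (beta - 1) * ln X - t * ln (1 + rho * X) - eq_potential u e.
have dh y : z <= y -> y <= 1 -> exists2 dy, is_derive y (1 : R) h dy & dy <= 0.
  move=> zy y1; have y0 : 0 < y by exact: lt_le_trans zy.
  have X0 := Xpos y zy y1; have [_ h2] := mono y zy y1.
  exists ((4 * c ^+ 2 - (P + e * (c * (y + y^-1)) - P) ^+ 2) * (kappa + rho * (P + e * (c * (y + y^-1)))) /
    ((P + e * (c * (y + y^-1))) * (1 + rho * (P + e * (c * (y + y^-1))))) / y).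
    exact: eq_level_off_deriv.
  rewrite -mulrA -mulrA; apply: mulr_le0_ge0.
    rewrite [P + _]addrC addrK (exprMn 2 e) e2 mul1r subr_le0.
    have -> : 4 * c ^+ 2 = (2 * c) ^+ 2 by ring.
    by rewrite ler_pXn2r// nnegrE ?(le_trans (ltW c20))// ltW.
  have X1 : 0 <= rho * (P + e * (c * (y + y^-1))) by apply: mulr_ge0; exact: ltW.
  apply: mulr_ge0; first by rewrite addr_ge0// ltW.
  by rewrite mulr_ge0 ?invr_ge0 ?(ltW y0)// mulr_ge0 ?(ltW X0)// addr_ge0.
have hz1 : h 1 <= h z.
  apply: (@ler0_derive1_le_cc _ h z 1).
  - move=> y; rewrite in_itv/= => /andP[zy y1].
    by have [dy [dd _] _] := dh y (ltW zy) (ltW y1).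
  - move=> y; rewrite in_itv/= => /andP[zy y1].
    have [dy D dy0] := dh y (ltW zy) (ltW y1).
    by rewrite derive1E (@derive_val _ _ _ _ _ _ _ D).
  - apply: derivable_within_continuous => y; rewrite in_itv/= => /andP[zy y1].
    by have [dy [dd _] _] := dh y zy y1.
  - by rewrite in_itv/= lexx ltW.
  - by rewrite in_itv/= lexx ltW.
  - exact: ltW.
have h1E : h 1 = eq_level.
  have X1 : P + e * (c * (1 + 1^-1)) = P + 2 * c * e by rewrite invr1; ring.
  rewrite /h X1 eq_level_on// -X1; apply: Xpos => //; exact: ltW.
rewrite -h1E; apply: le_trans hz1 _.
by rewrite /h zv -xv -eq_potential_off ?z0//= zv -/e -xv.
Qed.

Lemma eq_level_support x : 0 < x -> eq_density x != 0 ->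
  eq_level = x - (beta - 1) * ln x - t * ln (1 + rho * x) - 2 * log_potential eq_density x.
Proof.
move=> x0 px; have c0 := eq_c_gt0; have c20 : 0 < 2 * c by exact: mulr_gt0.
have /andP[ax xb] : P - 2 * c <= x <= P + 2 * c.
  by apply: contraNT px => /eq_density_out ->.
pose Y := (x - P) / (2 * c).
have xE : x = P + 2 * c * Y by rewrite /Y; field; rewrite gt_eqF.
rewrite xE eq_potential_on -?xE//; first by rewrite xE eq_level_on -?xE.
rewrite /Y (ler_pdivrMr _ _ c20) (ler_pdivlMr _ _ c20).
by apply/andP; split; lra.
Qed.

Lemma eq_level_le x : 0 < x ->
  eq_level <= x - (beta - 1) * ln x - t * ln (1 + rho * x) - 2 * log_potential eq_density x.
Proof.
move=> x0; have c0 := eq_c_gt0; have c20 : 0 < 2 * c by exact: mulr_gt0.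
have [xr|xr] := ltP (P + 2 * c) x.
  by apply: (@eq_level_off false) => //; rewrite expr0 mul1r; move: xr; lra.
have [xl|xl] := ltP x (P - 2 * c).
  by apply: (@eq_level_off true) => //; rewrite expr1 mulN1r; move: xl; lra.
pose Y := (x - P) / (2 * c).
have xE : x = P + 2 * c * Y by rewrite /Y; field; rewrite gt_eqF.
rewrite xE eq_potential_on -?xE//; first by rewrite xE eq_level_on -?xE.
rewrite /Y (ler_pdivrMr _ _ c20) (ler_pdivlMr _ _ c20).
by apply/andP; split; lra.
Qed.

Lemma eq_density_halfline : eq_density \_ (halfline R) = eq_density.
Proof.
apply/funext => x; rewrite patchE; case: ifPn => // /negP xn.
rewrite eq_density_neg// leNgt; apply/negP => x0; apply: xn.
by rewrite inE /halfline/= ltW.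
Qed.

Lemma eq_density_tame_density : tame_density R eq_density.
Proof.
split; first exact: tame_line_tame eq_density_tame.
  by move=> x _; exact: eq_density_ge0.
by rewrite Rintegral_halfline eq_density_halfline eq_density_mass.
Qed.

(** ln (1 + rho x) = ln rho + ln |x + 1 / rho|, so the moment is a value of the potential, at - 1 /
    rho. This point lies left of the support and its Joukowski parameter is [s] itself. *)
Lemma eq_density_log_moment :
  \int[mu]_(x in halfline R) (eq_density x * ln (1 + rho * x)) =
  ln C2 - rho * (A2 * B2) / C2 - (beta - 1) * ln (1 - rho * B2 / C2) - t * ln (1 - D2 / C2).
Proof.
have c0 := eq_c_gt0; have C0 := eq_C_gt0; have A0 := eq_A_gt0; have s0 := eq_s_gt0.
have rn : rho != 0 by rewrite gt_eqF.
have Cn : C2 != 0 by rewrite gt_eqF.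
have cs : c * s = D2 / rho.
  transitivity ((rho * c) ^+ 2 / (rho * C2)); first by rewrite /s; field; rewrite rn Cn.
  by rewrite -eq_CD; field; rewrite rn Cn.
have cis : c / s = C2 / rho by rewrite /s; field; rewrite rn Cn gt_eqF.
have XE : - rho^-1 = P + (-1) ^+ true * (c * (s + s^-1)).
  by rewrite expr1 mulN1r mulrDr cs cis /C2 /D2; field.
have pot : 2 * log_potential eq_density (- rho^-1) = eq_potential s (-1).
  by rewrite XE eq_potential_off ?expr1// s0 eq_s_lt1.
transitivity (ln rho + log_potential eq_density (- rho^-1)).
  rewrite integral_ln_affineE eq_density_halfline.
  transitivity (\int[mu]_x (ln rho * eq_density x + eq_density x * ln `|- rho^-1 - x|)).
    apply: eq_Rintegral => x _; have [x0|x0] := leP x 0.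
      by rewrite eq_density_neg// !(mulr0,mul0r) addr0.
    have -> : 1 + rho * x = rho * `|- rho^-1 - x|.
      rewrite -normrN opprB opprK gtr0_norm ?addr_gt0 ?invr_gt0//.
      by rewrite mulrDr mulfV// addrC.
    have xx : 0 < `|- rho^-1 - x|.
      by rewrite -normrN opprB opprK gtr0_norm ?addr_gt0 ?invr_gt0.
    by rewrite lnM// mulrDr [eq_density x * ln rho]mulrC.
  rewrite RintegralD//.
  - by rewrite RintegralZl ?eq_density_mass ?mulr1//; exact: eq_density_integrable.
  - by have := integrableZl measurableT (ln rho) eq_density_integrable.
  - exact: integrable_log eq_density_tame.
have qs : q * s = rho * B2 / C2.
  transitivity (rho * c ^+ 2 / (A2 * C2)); first by rewrite /q /s; field; rewrite Cn gt_eqF.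
  by rewrite -eq_AB; field; rewrite Cn gt_eqF.
have qs1 : q * s < 1.
  by apply: le_lt_trans eq_s_lt1; rewrite ler_piMl ?eq_q_le1// ltW.
have ss1 : s * s < 1.
  by apply: le_lt_trans eq_s_lt1; rewrite ler_piMl// ltW// eq_s_lt1.
have sq a : a < 1 -> ln (1 + 2 * a * -1 + a ^+ 2) = 2 * ln (1 - a).
  move=> a1; have -> : 1 + 2 * a * -1 + a ^+ 2 = (1 - a) ^+ 2 by ring.
  by rewrite lnXn ?subr_gt0// mulr_natl.
have ->: log_potential eq_density (- rho^-1) = eq_potential s (-1) / 2.
  by rewrite -pot; field.
rewrite /eq_potential !sq// cis lnM ?posrE ?invr_gt0// lnV//.
have ->: 2 * c * s * -1 = - 2 * (rho * (A2 * B2) / C2).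
  transitivity (- 2 * (c * s)); first by ring.
  by rewrite eq_AB /s; field.
have -> : s * s = D2 / C2 by rewrite -expr2 eq_s2.
rewrite qs.
move: (ln C2) (ln rho) (ln (1 - rho * B2 / C2)) (ln (1 - D2 / C2)) => x1 x2 x3 x4.
by field.
Qed.
Lemma equilibrium_exists : exists p, [/\ tame_density R p,
  \int[mu]_(x in halfline R) (p x * ln (1 + rho * x)) =
    ln C2 - rho * (A2 * B2) / C2 - (beta - 1) * ln (1 - rho * B2 / C2) - t * ln (1 - D2 / C2) &
  forall q', tame_density R q' ->
    energy beta p - t * \int[mu]_(x in halfline R) (p x * ln (1 + rho * x)) <=
    energy beta q' - t * \int[mu]_(x in halfline R) (q' x * ln (1 + rho * x))].
Proof.
exists eq_density; split; [exact: eq_density_tame_density|exact: eq_density_log_moment|] => q' tq'.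
apply: (equilibrium_minimizes (l := eq_level) (ltW rho0) eq_density_tame_density tq');
  rewrite eq_density_halfline; [exact: eq_level_le|exact: eq_level_support].
Qed.
End equilibrium.

(** * Derivative of an infimum by squeezing *)

Section envelope.
Variable R : realType.
Implicit Types f F : R -> R.

(** On either side of [x] the difference quotient lies between [F x] and [F y], so continuity of [F]
    suffices. *)
Lemma is_derive_squeeze f F (x : R) : {for x, continuous F} ->
  (\forall y \near x, F x * (y - x) <= f y - f x <= F y * (y - x)) ->
  is_derive x (1 : R) f (F x).
Proof.
move=> cF bnd.
suff h : h^-1 *: ((f \o shift x) (h *: (1 : R)) - f x) @[h --> (0 : R)^'] --> F x.
  by apply: DeriveDef; [apply/cvg_ex; exists (F x)|exact: (cvg_lim _ h)].
under eq_fun do rewrite /= [_ *: 1]mulr1.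
apply/cvgrPdist_le => e e0.
have shift : h + x @[h --> (0 : R)] --> x.
  by rewrite -[X in _ --> X]add0r; apply: cvgD; [exact: cvg_id|exact: cvg_cst].
have n1 : \forall h \near (0 : R), `|F x - F (h + x)| <= e.
  by apply: (@cvgr_dist_le _ _ _ _ _ _ _ (continuous_cvg _ cF shift)).
have n2 := shift _ bnd.
near=> h; have h0 : h != 0 by near: h; exact: nbhs_dnbhs_neq.
have /andP[l u] : F x * (h + x - x) <= f (h + x) - f x <= F (h + x) * (h + x - x).
  by near: h; apply: nbhs_dnbhs n2.
have d : `|F x - F (h + x)| <= e by near: h; apply: nbhs_dnbhs n1.
apply: le_trans d; move: l u; rewrite addrK /GRing.scale/=; set D := f _ - f _ => l u.
have -> : F x - h^-1 * D = - ((D - F x * h) / h) by field.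
have -> : F x - F (h + x) = - ((F (h + x) * h - F x * h) / h) by field.
rewrite !normrN !normrM ler_wpM2r// !ger0_norm ?subr_ge0 ?lerB//.
exact: le_trans l u.
Unshelve. all: by end_near. Qed.

Lemma inf_minimum (S : set R) (x : R) : S x -> lbound S x -> inf S = x.
Proof.
move=> Sx lb; apply/eqP; rewrite eq_le; apply/andP; split.
  by apply: ge_inf => //; exists x.
by apply: lb_le_inf => //; exists x.
Qed.

End envelope.

(** * The branch of equilibrium parameters *)

Section branch.
Variables (R : realType) (beta rho : R).
Hypotheses (beta1 : 1 <= beta) (rho0 : 0 < rho).
Notation mu := (@lebesgue_measure R).
Implicit Types k : R.

(* The parameters of the equilibrium density as functions of [kappa = k]. *)
Definition br_delta k : R := (beta - 1) / k.
(** Eliminating P between [w2] and [Pw] leaves (w - (1 - k))^2 = 4 rho + (k + rho delta)^2; the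
    larger root is positive near [k = 1]. *)
Definition br_w k : R := 1 - k + Num.sqrt (4 * rho + (k + rho * br_delta k) ^+ 2).
Definition br_t k : R := (1 - k) * br_w k / rho.
Definition br_P k : R := (br_w k ^+ 2 - 1 - rho ^+ 2 * br_delta k ^+ 2) / (2 * rho).
Definition br_A k : R := (br_P k + br_delta k) / 2.
Definition br_B k : R := (br_P k - br_delta k) / 2.
Definition br_C k : R := (1 + rho * br_P k + br_w k) / 2.
Definition br_D k : R := (1 + rho * br_P k - br_w k) / 2.
Definition br_r k : R := ln (br_C k) - rho * (br_A k * br_B k) / br_C k
  - (beta - 1) * ln (1 - rho * br_B k / br_C k) - br_t k * ln (1 - br_D k / br_C k).

Let u : R := u_erg beta rho.

Lemma u_erg_sqr : u ^+ 2 = (1 + rho * (beta - 1)) * u + rho.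
Proof.
have h : 0 <= (1 + rho * (beta - 1)) ^+ 2 + 4 * rho.
  by rewrite addr_ge0 ?sqr_ge0// mulr_ge0// ltW.
rewrite /u /u_erg; set q := 1 + _; set s := Num.sqrt _.
have s2 : s ^+ 2 = q ^+ 2 + 4 * rho by rewrite sqr_sqrtr.
have -> : (2^-1 * (q + s)) ^+ 2 = (s ^+ 2 + 2 * q * s + q ^+ 2) / 4 by field.
by rewrite s2; field.
Qed.

Lemma u_erg_gt1 : 1 < u.
Proof.
have b0 : 0 <= rho * (beta - 1) by rewrite mulr_ge0 ?(ltW rho0)// subr_ge0.
have u0 : 0 < u.
  by rewrite /u /u_erg mulr_gt0// ltr_pwDl ?sqrtr_ge0// ltr_pwDl.
rewrite -(ltr_pM2l u0) mulr1 -expr2 u_erg_sqr mulrDl mul1r -addrA ltrDl.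
by apply: ltr_wpDl => //; rewrite mulr_ge0// ltW.
Qed.

Let u0 : 0 < u. Proof. exact: lt_trans u_erg_gt1. Qed.
Let un : u != 0. Proof. by rewrite gt_eqF. Qed.
Let rn : rho != 0. Proof. by rewrite gt_eqF. Qed.

(** [beta] is rational in [u] although [u] is not rational in [beta]: with this substitution the
    identities at kappa = 1 become free of square roots. *)
Lemma beta_u_erg : beta - 1 = (u - rho / u - 1) / rho.
Proof.
have h : (beta - 1) * rho * u = u ^+ 2 - rho - u by rewrite u_erg_sqr; ring.
transitivity ((beta - 1) * rho * u / (rho * u)); first by field; rewrite un rn.
by rewrite h; field; rewrite un rn.
Qed.

Lemma br_delta1 : br_delta 1 = beta - 1. Proof. exact: divr1. Qed.

Lemma br_w1 : br_w 1 = u + rho / u.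
Proof.
rewrite /br_w br_delta1 subrr add0r [4 * rho + _]addrC.
have -> : Num.sqrt ((1 + rho * (beta - 1)) ^+ 2 + 4 * rho) = 2 * u - (1 + rho * (beta - 1)).
  by rewrite /u /u_erg; set q := 1 + _; set s := Num.sqrt _; field.
by rewrite beta_u_erg; field; rewrite un rn.
Qed.

Lemma br_P1 : br_P 1 = beta + 1.
Proof.
have -> : beta + 1 = (beta - 1) + 2 by ring.
by rewrite /br_P br_w1 br_delta1 beta_u_erg; field; rewrite un rn.
Qed.

Lemma br_A1 : br_A 1 = beta.
Proof. by rewrite /br_A br_P1 br_delta1; field. Qed.

Lemma br_B1 : br_B 1 = 1.
Proof. by rewrite /br_B br_P1 br_delta1; field. Qed.

Lemma br_C1 : br_C 1 = u + rho.
Proof.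
rewrite /br_C br_P1 br_w1; have -> : beta + 1 = (beta - 1) + 2 by ring.
by rewrite beta_u_erg; field; rewrite un rn.
Qed.

Lemma br_t1 : br_t 1 = 0. Proof. by rewrite /br_t subrr !mul0r. Qed.

Let ur0 : 0 < u + rho. Proof. exact: addr_gt0. Qed.
Let urn : u + rho != 0. Proof. by rewrite gt_eqF. Qed.

Lemma br_BC1 : 1 - rho * br_B 1 / br_C 1 = u / (u + rho).
Proof. by rewrite br_B1 br_C1; field. Qed.

(** Identifies [v_erg] as - ln (1 - D / C), the logarithm that multiplies [t] in the moment; D / C
    is the square of the ratio [s]. *)
Lemma br_DC1 : 1 - br_D 1 / br_C 1 = 1 - (1 - u) ^+ 2 / (beta * u ^+ 2).
Proof.
have bu : beta = (u - 1) * (u + rho) / (rho * u).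
  by rewrite -[LHS](subrK 1) beta_u_erg; field; rewrite un rn.
have -> : br_D 1 = rho * (u - 1) / u.
  rewrite /br_D br_P1 br_w1; have -> : beta + 1 = (beta - 1) + 2 by ring.
  by rewrite beta_u_erg; field; rewrite un rn.
rewrite br_C1 bu; field; rewrite un urn rn /= subr_eq0 gt_eqF//.
exact: u_erg_gt1.
Qed.

Lemma br_DC1_bounds : 0 < 1 - br_D 1 / br_C 1 < 1.
Proof.
have D1 : br_D 1 = rho * (u - 1) / u.
  rewrite /br_D br_P1 br_w1; have -> : beta + 1 = (beta - 1) + 2 by ring.
  by rewrite beta_u_erg; field; rewrite un rn.
have D0 : 0 < br_D 1.
  by rewrite D1 divr_gt0// mulr_gt0// subr_gt0 u_erg_gt1.
rewrite br_C1 subr_gt0 ltr_pdivrMr// mul1r; apply/andP; split.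
  rewrite D1 ltr_pdivrMr//; have := rho0; have := u0; move=> a b; nra.
by rewrite gtrBl divr_gt0.
Qed.

Lemma br_r1 : br_r 1 = r_erg beta rho.
Proof.
rewrite /br_r br_BC1 br_t1 mul0r subr0 br_A1 br_B1 br_C1 mulr1 /r_erg -/u.
have -> : 1 + rho / u = (u + rho) / u by field.
rewrite !ln_div ?posrE//.
have -> : rho * beta / (u + rho) = 1 - u^-1.
  rewrite -[beta](subrK 1) beta_u_erg; field; by rewrite un urn rn.
by ring.
Qed.

Lemma v_erg_gt0 : 0 < v_erg beta rho.
Proof.
by have /andP[a b] := br_DC1_bounds; rewrite /v_erg -/u -br_DC1 oppr_gt0 ln_lt0// a b.
Qed.

Lemma Ck_br_delta n : Ck n br_delta 1.
Proof. by apply: Ck_div; [exact: oner_neq0|exact: Ck_cst|exact: Ck_id]. Qed.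

Lemma Ck_br_w n : Ck n br_w 1.
Proof.
apply: CkD; first by apply: CkB; [exact: Ck_cst|exact: Ck_id].
apply: Ck_sqrt; first by rewrite ltr_pwDl ?sqr_ge0// mulr_gt0.
apply: CkD; first exact: Ck_cst.
apply: CkX; apply: CkD; first exact: Ck_id.
by apply: CkM; [exact: Ck_cst|exact: Ck_br_delta].
Qed.

Lemma Ck_br_t n : Ck n br_t 1.
Proof.
apply: CkM; last exact: Ck_cst.
by apply: CkM; [apply: CkB; [exact: Ck_cst|exact: Ck_id]|exact: Ck_br_w].
Qed.

Lemma Ck_br_P n : Ck n br_P 1.
Proof.
apply: CkM; last exact: Ck_cst.
apply: CkB; last by apply: CkM; [exact: Ck_cst|apply: CkX; exact: Ck_br_delta].
by apply: CkB; [apply: CkX; exact: Ck_br_w|exact: Ck_cst].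
Qed.

Let Ck_half n (f : R -> R) : Ck n f 1 -> Ck n (fun y => f y / 2) 1.
Proof. by move=> h; apply: CkM => //; exact: Ck_cst. Qed.

Lemma Ck_br_r n : Ck n br_r 1.
Proof.
have dk := Ck_br_delta n; have wk := Ck_br_w n; have pk := Ck_br_P n.
have rk : Ck n (fun y => 1 + rho * br_P y) 1.
  by apply: CkD; [exact: Ck_cst|apply: CkM => //; exact: Ck_cst].
have ak : Ck n br_A 1 by apply: Ck_half; exact: CkD.
have bk : Ck n br_B 1 by apply: Ck_half; exact: CkB.
have ck : Ck n br_C 1 by apply: Ck_half; exact: CkD.
have dk' : Ck n br_D 1 by apply: Ck_half; exact: CkB.
have C0 : br_C 1 != 0 by rewrite br_C1.
apply: CkB; last first.
  apply: CkM; first exact: Ck_br_t.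
  apply: Ck_ln; first by have /andP[] := br_DC1_bounds.
  by apply: CkB; [exact: Ck_cst|exact: Ck_div].
apply: CkB; last first.
  apply: CkM; first exact: Ck_cst.
  apply: Ck_ln; first by rewrite br_BC1 divr_gt0.
  by apply: CkB; [exact: Ck_cst|apply: Ck_div => //; apply: CkM => //; exact: Ck_cst].
apply: CkB; first by apply: Ck_ln => //; rewrite br_C1.
by apply: Ck_div => //; apply: CkM; [exact: Ck_cst|exact: CkM].
Qed.

Lemma is_derive_br_t : is_derive (1 : R) (1 : R) br_t (- br_w 1 / rho).
Proof.
have [w1 dw] := Ck_is_derive (Ck_br_w 1).
apply: dv_eq (dvM (dvM (dvB (dvC 1 (1 : R)) (dvI (1 : R))) dw) (dvC rho^-1 (1 : R))) _.
by rewrite subrr; ring.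
Qed.

(* Only the explicit factor [t] contributes: the derivatives of [P], [delta]
   and [w] cancel, because at [kappa = 1] the density is the unconstrained minimizer. *)
Lemma is_derive_br_r : is_derive (1 : R) (1 : R) br_r (- br_w 1 / rho * v_erg beta rho).
Proof.
have [w1 dw] := Ck_is_derive (Ck_br_w 1); have [d1 dd] := Ck_is_derive (Ck_br_delta 1).
pose p1 : R := (br_w 1 * w1 - rho ^+ 2 * (beta - 1) * d1) / rho.
have dP : is_derive (1 : R) (1 : R) br_P p1.
  have D := dvM (dvB (dvB (dvX 2 dw) (dvC 1 (1 : R))) (dvZ (rho ^+ 2) (dvX 2 dd))) (dvC (2 * rho)^-1 (1 : R)).
  by apply: dv_eq D _; rewrite /= !expr1 br_delta1 /p1; field.
have half (f : R -> R) a : is_derive (1 : R) (1 : R) f a -> is_derive (1 : R) (1 : R) (fun y => f y / 2) (a / 2).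
  by move=> D; apply: dv_eq (dvM D (dvC 2^-1 (1 : R))) _; rewrite mulr0 add0r mulrC.
have dA : is_derive (1 : R) (1 : R) br_A ((p1 + d1) / 2) by apply: half; exact: dvD.
have dB : is_derive (1 : R) (1 : R) br_B ((p1 - d1) / 2) by apply: half; exact: dvB.
have dC : is_derive (1 : R) (1 : R) br_C ((rho * p1 + w1) / 2).
  by apply: half; apply: dv_eq (dvD (dvD (dvC 1 (1 : R)) (dvZ rho dP)) dw) _; rewrite add0r.
have dD : is_derive (1 : R) (1 : R) br_D ((rho * p1 - w1) / 2).
  by apply: half; apply: dv_eq (dvB (dvD (dvC 1 (1 : R)) (dvZ rho dP)) dw) _; rewrite add0r.
have Cn : br_C 1 != 0 by rewrite br_C1.
have C0 : 0 < br_C 1 by rewrite br_C1.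
have dCV := dvV Cn dC.
have DC0 : 0 < 1 - br_D 1 / br_C 1 by have /andP[] := br_DC1_bounds.
have BC0 : 0 < 1 - rho * br_B 1 / br_C 1 by rewrite br_BC1 divr_gt0.
have l1 := dvln C0 dC.
have l2 := @dvln _ (fun k => 1 - rho * br_B k / br_C k) 1 _ BC0
  (dvB (dvC 1 (1 : R)) (dvM (dvZ rho dB) dCV)).
have l3 := @dvln _ (fun k => 1 - br_D k / br_C k) 1 _ DC0 (dvB (dvC 1 (1 : R)) (dvM dD dCV)).
have D := dvB (dvB (dvB l1 (dvM (dvZ rho (dvM dA dB)) dCV)) (dvZ (beta - 1) l2)) (dvM is_derive_br_t l3).
apply: (dv_eq D).
rewrite br_t1 mul0r add0r {D l1 l2 l3 dA dB dC dD dCV half dP dw dd}.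
rewrite /v_erg -/u -br_DC1; set L := ln _; rewrite br_BC1 br_A1 br_B1 br_C1 /p1.
rewrite br_w1; have -> : beta = (u - rho / u - 1) / rho + 1 by rewrite -beta_u_erg subrK.
clear p1; rewrite addrK; move: un rn urn; clearbody L; move: L u w1 d1 => L v w1 d1 vn rn' vrn.
by field; rewrite vn rn' vrn.
Qed.
End branch.

(** * The expansion of the constrained energy *)

Section expansion.
Variables (R : realType) (beta rho : R).
Hypotheses (beta1 : 1 <= beta) (rho0 : 0 < rho).
Notation mu := (@lebesgue_measure R).
Local Notation T := (br_t beta rho).
Local Notation Rf := (br_r beta rho).
Local Notation E1 := (energy1 beta rho).
Local Notation r0 := (r_erg beta rho).
Local Notation moment q := (\int[mu]_(x in halfline R) (q x * ln (1 + rho * x))).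

Definition attained k : Prop := exists p, [/\ tame_density R p, moment p = Rf k &
  forall q, tame_density R q -> energy beta p - T k * moment p <= energy beta q - T k * moment q].

(** The equations between the parameters hold along the branch by construction. The strict
    inequalities hold at 1, where P - delta = 2, and persist by continuity. *)
Lemma near_attained : \forall k \near (1 : R), attained k.
Proof.
have cw := Ck_continuous (Ck_br_w beta rho0 1); have cP := Ck_continuous (Ck_br_P beta rho0 1).
have cd := Ck_continuous (Ck_br_delta beta 1).
have rn : rho != 0 by rewrite gt_eqF.
near=> k; have k0 : 0 < k by near: k; apply: (cvgr_gt (1 : R)) => //; exact: cvg_id.
have w0 : 0 < br_w beta rho k.
  near: k; apply: (cvgr_gt (br_w beta rho 1) cw).
  have u1 := u_erg_gt1 beta1 rho0; rewrite br_w1// addr_gt0 ?divr_gt0// (lt_trans _ u1)//.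
have dP : br_delta beta k < br_P beta rho k.
  rewrite -subr_gt0; near: k; apply: (cvgr_gt (br_P beta rho 1 - br_delta beta 1)).
    exact: cvgB cP cd.
  by rewrite br_P1// br_delta1 subr_gt0; lra.
have kn : k != 0 by rewrite gt_eqF.
apply: (equilibrium_exists beta1 rho0 k0 w0 _ _ _ _ dP).
- by rewrite /br_delta; field.
- by rewrite /br_P; field.
- rewrite /br_P; have s2 : (br_w beta rho k - (1 - k)) ^+ 2 = 4 * rho + (k + rho * br_delta beta k) ^+ 2.
    by rewrite /br_w addrAC subrr add0r sqr_sqrtr// addr_ge0 ?sqr_ge0// mulr_ge0// ltW.
  move: (br_w beta rho k) (br_delta beta k) s2 => w d s2.
  apply/eqP; rewrite -subr_eq0; apply/eqP.
  transitivity ((4 * rho + (k + rho * d) ^+ 2 - (w - (1 - k)) ^+ 2) / 2); first by field.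
  by rewrite s2 subrr mul0r.
- by rewrite /br_t; field.
Unshelve. all: by end_near. Qed.

(** Among densities with the same moment the term in [t] is constant, so a minimizer of the tilted
    energy also solves the constrained problem at its own moment. *)
Lemma attained_energy1 k : attained k -> exists2 p, [/\ tame_density R p, moment p = Rf k &
  energy beta p = E1 (Rf k)] & forall q, tame_density R q -> energy beta p - T k * moment p <= energy beta q - T k * moment q.
Proof.
move=> [p [dp mp hp]]; exists p => //; split=> //; apply/esym/inf_minimum.
  by exists p.
move=> _ [q [dq mq] <-]; have := hp q dq.
by rewrite mp mq lerD2r.
Qed.

(** The minimizer for [k'] is a competitor for [k], which gives a supporting line of slope [T k]. *)
Lemma energy1_supergradient k k' : attained k -> attained k' ->
  T k * (Rf k' - Rf k) <= E1 (Rf k') - E1 (Rf k).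
Proof.
move=> /attained_energy1[p [dp mp <-] hp] /attained_energy1[q [dq mq <-] _].
have := hp q dq; rewrite mp mq.
move: (energy beta p) (energy beta q) (T k) (Rf k) (Rf k') => ep eq tk rk rk'.
lra.
Qed.

(** At kappa = 1 the multiplier [t] is 0, so the constrained minimizer there is the unconstrained
    one. *)
Lemma energy0E : energy0 beta = E1 r0.
Proof.
have /attained_energy1[p [dp mp Ep] hp] := nbhs_singleton near_attained.
rewrite -(br_r1 beta1 rho0) -Ep; apply: inf_minimum; first by exists p.
move=> _ [q dq <-]; have := hp q dq; rewrite (br_t1 beta rho).
by move: (moment p) (moment q) (energy beta p) (energy beta q) => a b e e'; rewrite !mul0r !subr0.
Qed.

Lemma energy1_derivatives : exists f1 f2 f3 d,
  [/\ \forall r \near r0, is_derive r (1 : R) E1 (f1 r),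
      \forall r \near r0, is_derive r (1 : R) f1 (f2 r),
      \forall r \near r0, is_derive r (1 : R) f2 (f3 r) &
      is_derive r0 (1 : R) f3 d] /\ f1 r0 = 0 /\ f2 r0 = (v_erg beta rho)^-1.
Proof.
have v0 := v_erg_gt0 beta1 rho0.
have r1 := br_r1 beta1 rho0.
have Rn n := Ck_br_r beta1 rho0 n.
have dR := is_derive_br_r beta1 rho0; have dT := is_derive_br_t beta rho0.
have w0 : 0 < br_w beta rho 1.
  by have u1 := u_erg_gt1 beta1 rho0; rewrite br_w1// addr_gt0 ?divr_gt0// (lt_trans _ u1).
have Tn : - br_w beta rho 1 / rho != 0.
  by rewrite mulf_neq0 ?oppr_eq0 ?invr_eq0 ?gt_eqF.
have Rd : - br_w beta rho 1 / rho * v_erg beta rho != 0 by rewrite mulf_neq0// gt_eqF.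
have [dRf nR cR] := Rn 2%N.
have dRfE : dRf 1 = - br_w beta rho 1 / rho * v_erg beta rho.
  have D := nbhs_singleton nR.
  by rewrite -(@derive_val _ _ _ _ _ _ _ D) (@derive_val _ _ _ _ _ _ _ dR).
(* [K] recovers kappa from the moment; the slope of the energy then becomes the function [T (K r)]
   of [r]. *)
have [K KR] : exists g : R -> R, {near (1 : R), cancel Rf g}.
  have cd : {for (1 : R), continuous dRf} := @Ck_continuous _ 0 _ _ cR.
  by apply: (local_inverse nR cd); rewrite dRfE.
have [cK RK] : (\forall r \near r0, {for r, continuous K}) /\ {near r0, cancel K Rf}.
  rewrite -r1; apply: near_can_continuousAcan_sym KR _.
  exact: Ck_near_continuous (Rn 1%N).
have K1 : K r0 = 1 by rewrite -r1; exact: (nbhs_singleton KR).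
have CK : Ck 4 K r0 by rewrite -r1; exact: (Ck_inverse KR (Rn 4%N) dR Rd).
have CF : Ck 4 (fun r => T (K r)) r0.
  by apply: Ck_comp => //; rewrite K1; exact: Ck_br_t.
have cF := Ck_near_continuous CF.
have nA : \forall r \near r0, attained (K r).
  have cK0 : {for r0, continuous K} := nbhs_singleton cK.
  by apply: cK0; rewrite K1; exact: near_attained.
have nA2 : \forall r \near r0, attained (K r) /\ Rf (K r) = r.
  by near=> r; split; near: r.
have dE1 : \forall r \near r0, is_derive r (1 : R) E1 (T (K r)).
  near=> r; apply: (@is_derive_squeeze _ E1 (fun r => T (K r))); first by near: r.
  have [ar er] : attained (K r) /\ Rf (K r) = r by near: r.
  have : \forall s \near r, attained (K s) /\ Rf (K s) = s by near: r; exact: (near_join nA2).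
  apply: filterS => s [as' es].
  have h1 := energy1_supergradient ar as'; have h2 := energy1_supergradient as' ar.
  by move: h1 h2; rewrite er es => h1 h2; apply/andP; split; lra.
have [f2 n2 [f3 n3 [f4 n4 _]]] := CF.
exists (fun r => T (K r)), f2, f3, (f4 r0).
split; first by split => //; exact: (nbhs_singleton n4).
split; first by rewrite K1 br_t1.
(* Chain rule: [f2 r0] is T'(1) K'(r0), and Rf'(1) K'(r0) = 1 since [Rf] undoes [K]. As Rf'(1) =
   T'(1) [v_erg], the product of [f2 r0] and [v_erg] is 1. *)
have [dK DK] := Ck_is_derive CK.
have D2 := nbhs_singleton n2.
have E2 : f2 r0 = - br_w beta rho 1 / rho * dK.
  have DT : is_derive (K r0) (1 : R) T (- br_w beta rho 1 / rho) by rewrite K1.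
  have D := dvcomp DT DK.
  by rewrite -(@derive_val _ _ _ _ _ _ _ D2) (@derive_val _ _ _ _ _ _ _ D).
have E3 : - br_w beta rho 1 / rho * v_erg beta rho * dK = 1.
  have DR : is_derive (K r0) (1 : R) Rf (- br_w beta rho 1 / rho * v_erg beta rho) by rewrite K1.
  have D := dvcomp DR DK.
  have D1 : is_derive r0 (1 : R) (fun r => Rf (K r)) 1.
    by apply: is_derive_near_eq (dvI r0); near=> r; apply/esym; near: r.
  by rewrite -(@derive_val _ _ _ _ _ _ _ D) (@derive_val _ _ _ _ _ _ _ D1).
apply: (mulIf (lt0r_neq0 v0)); rewrite mulVf ?gt_eqF// E2 -[RHS]E3; ring.
Unshelve. all: by end_near. Qed.

End expansion.

Theorem mainTheorem4 (R : realType) (beta rho : R)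
    (hbeta : 1 <= beta) (hrho : 0 < rho) :
  thrice_derivable_at (energy1 beta rho) (r_erg beta rho) /\
  (forall r : R,
     energy1 beta rho r - energy0 beta
     = (r - r_erg beta rho) ^+ 2 / (2 * v_erg beta rho)
       + s_erg beta rho / 6 * (r - r_erg beta rho) ^+ 3
     +O_(r \near r_erg beta rho) ((r - r_erg beta rho) ^+ 4)).
Proof.
have v0 := v_erg_gt0 hbeta hrho.
have [f1 [f2 [f3 [d [[n1 n2 n3 D] [f10 f20]]]]]] := energy1_derivatives hbeta hrho.
have [d1 d2 d3 s3] := derive1n_near n1 n2 n3.
split; first by split.
have [M M0 bnd] := taylor3 n1 n2 n3 D.
(* The error term is one function of [r], so the claim at [r] is the value there of an identity of
   functions. *)
suff E : (fun r => energy1 beta rho r - energy0 beta)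
     = (fun r => (r - r_erg beta rho) ^+ 2 / (2 * v_erg beta rho)
       + s_erg beta rho / 6 * (r - r_erg beta rho) ^+ 3)
     +O_ (nbhs (r_erg beta rho)) (fun r => (r - r_erg beta rho) ^+ 4).
  by move=> r; exact: (congr1 (@^~ r) E).
apply/eqaddOP; apply/(@bigO_exP _ _ _ _ (nbhs (r_erg beta rho))).
(* The constant must be positive, while [M] may be 0. *)
exists (M + 1); first by rewrite ltr_wpDl.
apply: filterS bnd => r; rewrite f10 f20 mul0r addr0 -s3 -/(s_erg beta rho) (energy0E hbeta hrho).
rewrite normrX => h; apply: le_trans (_ : _ <= M * `|r - r_erg beta rho| ^+ 4) _.
  apply: le_trans h; rewrite le_eqVlt; apply/orP; left; apply/eqP; congr `|_|.
  rewrite -[LHS]/(energy1 beta rho r - energy1 beta rho (r_erg beta rho) -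
    ((r - r_erg beta rho) ^+ 2 / (2 * v_erg beta rho) + s_erg beta rho / 6 * (r - r_erg beta rho) ^+ 3)).
  move: v0; move: (v_erg _ _) (s_erg _ _) (energy1 _ _ r) (energy1 beta rho (r_erg beta rho)) => v s e e' v0.
  by field; rewrite gt_eqF.
by rewrite ler_wpM2r ?exprn_ge0// lerDl.
Qed.
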